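(* Suppose Assumptions (A), (B), (C), (D), (E), (F) of the context hold. Let $(\lambda_t,\beta_t)$ be generated by the SOBBO algorithm described in the context, with window size $w\ge1$, inner step size $0<\eta\le\frac{2}{\ell_{g,1}+\mu_g}$, inner iteration count $K\ge1$, outer step size $$0<\alpha\le\min\left\{\frac{3\rho}{4\ell_{F,1}},\ \frac{\rho\sqrt{1-\nu}}{\kappa_g^2\sqrt{72\,C_{\mu_g}}}\right\},$$ and batch sizes $$s=w,\qquad m=\left\lceil\frac{\log w}{\log\left(\left(1-\frac{\mu_g}{\ell_{g,1}}\right)^{-1}\right)}\right\rceil+1 .$$ Then the (expected) bilevel local regret of SOBBO satisfies $$\mathbb E\left[\sum_{t=1}^T\left\|\mathcal G_{\mathcal X,t}\big(\lambda_t,\nabla F_{t,w}(\lambda_t),\alpha\big)\right\|^2\right]\le O\left(\frac{T}{w}\left(1+\kappa_g^2+\sigma_f^2+\kappa_g^2\sigma_{g_\beta}^2\right)+V_{1,T}+\kappa_g^2H_{2,T}\right).$$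
   Context: **Problem.** Stochastic online bilevel optimization over $t=1,\dots,T$ (functions for $t=T+1$ are also given wherever they appear). $\mathcal X\subseteq\mathbb R^{d_1}$; $f_t(\lambda,\beta,\epsilon)$ and $g_t(\lambda,\beta,\zeta)$ are stochastic objectives on $\mathcal X\times\mathbb R^{d_2}$ with $\epsilon\sim D$, $\zeta\sim D'$; $f_t(\lambda,\beta):=\mathbb E_\epsilon[f_t(\lambda,\beta,\epsilon)]$, $g_t(\lambda,\beta):=\mathbb E_\zeta[g_t(\lambda,\beta,\zeta)]$; $h$ is a convex, possibly nonsmooth, function on $\mathcal X$. $\widehat\beta_t(\lambda):=\arg\min_{\beta\in\mathbb R^{d_2}}g_t(\lambda,\beta)$ and $F_t(\lambda):=\mathbb E_\epsilon[f_t(\lambda,\widehat\beta_t(\lambda),\epsilon)]$. $\|\cdot\|$ is the $\ell_2$ norm (spectral norm for matrices). **Assumptions.** (A) For all $t$ and every $\epsilon,\zeta$: $f_t(\cdot,\cdot,\epsilon)$ is $\ell_{f,0}$-Lipschitz, $\nabla f_t(\cdot,\cdot,\epsilon)$ is $\ell_{f,1}$-Lipschitz, $\nabla g_t(\cdot,\cdot,\zeta)$ is $\ell_{g,1}$-Lipschitz, and $\nabla^2_{\lambda,\beta}g_t(\cdot,\cdot,\zeta)$, $\nabla^2_{\beta,\beta}g_t(\cdot,\cdot,\zeta)$ are both $\ell_{g,2}$-Lipschitz; the same holds for $f_t(\cdot,\cdot)$ and $g_t(\cdot,\cdot)$. (B) $g_t(\lambda,\cdot)$ and $g_t(\lambda,\cdot,\zeta)$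 are $\mu_g$-strongly convex for all $t$, $\zeta$ and all $\lambda\in\mathcal X$. (C) For all $t,\lambda,\beta$: $\mathbb E[\nabla_\beta g_t(\lambda,\beta,\zeta)]=\nabla_\beta g_t(\lambda,\beta)$ with finite variance $\sigma^2_{g_\beta}$, and the stochastic hypergradient estimate $\widetilde\nabla f_t(\lambda,\beta,\mathcal E)$ defined below has finite variance $\sigma_f^2$. (D) $\mathcal X$ is closed, convex and bounded with $\|\lambda_1-\lambda_2\|\le S$ for all $\lambda_1,\lambda_2\in\mathcal X$. (E) $\sup_{\lambda\in\mathcal X}|F_t(\lambda)|\le Q<\infty$ for all $t$. (F) For all $t$ the distance generating function $\phi_t:\mathcal X\to\mathbb R$ is continuously differentiable and $\rho$-strongly convex with respect to $\|\cdot\|$. **Bregman step.** $\mathcal D_{\phi}(\lambda_2,\lambda_1):=\phi(\lambda_2)-\phi(\lambda_1)-\langle\nabla\phi(\lambda_1),\lambda_2-\lambda_1\rangle$. For $u\in\mathcal X$, $q\in\mathbb R^{d_1}$, $\alpha>0$ let $\lambda^+:=\arg\min_{\lambda\in\mathcal X}\{\langle q,\lambda\rangle+h(\lambda)+\frac1\alpha\mathcal D_{\phi_t}(\lambda,u)\}$ and define $\mathcal G_{\mathcal X,t}(u,q,\alpha):=\frac1\alpha(u-\lambda^+)$. **Stochastic hypergradient estimate.** For independent samples $\mathcal E=\{\epsilon,\zeta^0,\dots,\zeta^{m-1}\}$ and $\widetilde m$ uniform on $\{0,1,\dots,m-1\}$, $$\widetilde\nabla f_t(\lambda,\beta,\mathcal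 E):=\nabla_\lambda f_t(\lambda,\beta,\epsilon)-\nabla^2_{\lambda,\beta}g_t(\lambda,\beta,\zeta^0)\left[\frac{m}{\ell_{g,1}}\prod_{j=1}^{\widetilde m}\left(I_{d_2}-\frac{1}{\ell_{g,1}}\nabla^2_{\beta,\beta}g_t(\lambda,\beta,\zeta^j)\right)\right]\nabla_\beta f_t(\lambda,\beta,\epsilon),$$ where an empty product is $I_{d_2}$. **SOBBO algorithm.** Start from $\lambda_1\in\mathcal X$, $\beta_1\in\mathbb R^{d_2}$. For $t=1,\dots,T$: set $\omega_t^0=\beta_t$; for $k=1,\dots,K$ draw a batch $\bar\zeta_{t,k}$ of $s$ independent samples of $\zeta$ and set $\omega_t^k=\omega_t^{k-1}-\eta\nabla_\omega g_t(\lambda_t,\omega_t^{k-1},\bar\zeta_{t,k})$, where the gradient is averaged over the batch; set $\beta_{t+1}=\omega_t^K$; draw independent $\mathcal E_t=\{\epsilon_t,\zeta_t^0,\dots,\zeta_t^{m-1}\}$; form $\widetilde\nabla f_{t,w}:=\frac1w\sum_{i=0}^{w-1}\widetilde\nabla f_{t-i}(\lambda_{t-i},\beta_{t+1-i},\mathcal E_{t-i})$; set $\lambda_{t+1}=\arg\min_{\lambda\in\mathcal X}\{\langle\widetilde\nabla f_{t,w},\lambda\rangle+h(\lambda)+\frac1\alpha\mathcal D_{\phi_t}(\lambda,\lambda_t)\}$. Convention: $f_t=F_t=0$ for $t\le0$. $\mathbb E$ is expectation over the samples drawn by the algorithm. **Time smoothing.** $\nabla F_{t,w}(\lambda_t):=\frac1w\sum_{i=0}^{w-1}\nabla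 F_{t-i}(\lambda_{t-i})$. **Variation measures.** $V_{1,T}:=\sum_{t=1}^T\sup_{\lambda\in\mathcal X}|F_{t+1}(\lambda)-F_t(\lambda)|$, $H_{2,T}:=\sum_{t=2}^T\sup_{\lambda\in\mathcal X}\|\widehat\beta_{t-1}(\lambda)-\widehat\beta_t(\lambda)\|^2$. **Constants.** $\kappa_g:=\ell_{g,1}/\mu_g$; $M_f:=\ell_{f,1}+\ell_{f,1}\kappa_g+\frac{\ell_{f,0}\ell_{g,2}}{\mu_g}(1+\kappa_g)$; $\ell_{F,1}:=\ell_{f,1}(1+\kappa_g)+\frac{\ell_{f,0}\ell_{g,2}}{\mu_g}(1+\kappa_g)+M_f\kappa_g$ (a Lipschitz constant of $\nabla F_t$); $\nu:=\left(1-\frac{\eta\ell_{g,1}\mu_g}{\ell_{g,1}+\mu_g}\right)\left(1-\frac{2\eta\ell_{g,1}\mu_g}{\ell_{g,1}+\mu_g}\right)^{K-1}$; $C_{\mu_g}:=1+\frac{\ell_{g,1}+\mu_g}{\eta\ell_{g,1}\mu_g}$. The $O(\cdot)$ rate is reported in terms of the number of rounds $T$, the window $w$, the comparator sequences $V_{1,T},H_{2,T}$, the condition number $\kappa_g$ and the variances $\sigma_f^2,\sigma_{g_\beta}^2$.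
   Formalization: The window size is restricted to 1 ≤ w ≤ T, since for w > T the bound with a w-uniform constant fails (T = 1, f = 0, h linear, w → ∞); also ℓ_{f,1} > 0 and existence of the Bregman minimizers are assumed so that the step-size bound and the argmin make sense. *)

(* Defs.v *)
From HB Require Import structures.
From mathcomp Require Import all_boot all_order all_algebra.
From mathcomp Require Import all_classical all_reals all_analysis.

Set Implicit Arguments.
Unset Strict Implicit.
Unset Printing Implicit Defensive.

Import Order.TTheory GRing.Theory Num.Theory.
Import numFieldNormedType.Exports.

Local Open Scope classical_set_scope.
Local Open Scope ring_scope.

(* Vectors are columns.  The library norm on matrices is the max-entry norm, so
   the Euclidean and spectral norms are defined here. *)

Definition dotv (R : realType) n (u v : 'cV[R]_n) : R :=
  \sum_(i < n) u i 0 * v i 0.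

Definition l2norm (R : realType) n (u : 'cV[R]_n) : R := Num.sqrt (dotv u u).

Definition opnorm (R : realType) m n (M : 'M[R]_(m, n)) : R :=
  sup [set l2norm (M *m v) | v in [set v : 'cV[R]_n | l2norm v <= 1]].

(* Derivatives relative to a set A: the objectives live on X * R^d2, where X is
   closed and may have boundary points or an empty interior.  On such an X a
   gradient is determined up to directions orthogonal to X - X. *)

Definition gradient_at (R : realType) n (A : set 'cV[R]_n) (u : 'cV[R]_n -> R)
    (x v : 'cV[R]_n) : Prop :=
  forall e, 0 < e -> exists2 d, 0 < d & forall y, A y -> l2norm (y - x) < d ->
    `|u y - u x - dotv v (y - x)| <= e * l2norm (y - x).

Definition jacobian_at (R : realType) m n (A : set 'cV[R]_n)
    (u : 'cV[R]_n -> 'cV[R]_m) (x : 'cV[R]_n) (J : 'M[R]_(m, n)) : Prop :=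
  forall e, 0 < e -> exists2 d, 0 < d & forall y, A y -> l2norm (y - x) < d ->
    l2norm (u y - u x - J *m (y - x)) <= e * l2norm (y - x).

Definition grad_on (R : realType) n (A : set 'cV[R]_n) (u : 'cV[R]_n -> R)
    (x : 'cV[R]_n) : 'cV[R]_n :=
  get [set v | gradient_at A u x v].

Definition is_argmin (R : realType) T (A : set T) (u : T -> R) (x : T) : Prop :=
  A x /\ forall y, A y -> u x <= u y.

Definition argmin (R : realType) (T : pointedType) (A : set T) (u : T -> R) : T :=
  get [set x | is_argmin A u x].

Definition strongly_convex (R : realType) n (A : set 'cV[R]_n) (mu : R)
    (u : 'cV[R]_n -> R) : Prop :=
  forall x y a, A x -> A y -> 0 <= a <= 1 ->
    u (a *: x + (1 - a) *: y) <=
      a * u x + (1 - a) * u y - mu / 2 * a * (1 - a) * l2norm (x - y) ^+ 2.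

Definition vmean (R : realType) d (T : measurableType d) (P : probability T R) n
    (u : T -> 'cV[R]_n) : 'cV[R]_n :=
  \col_i (\int[P]_x (u x i 0)).

Section JointFunctions.
Context (R : realType) (d1 d2 : nat) (X : set 'cV[R]_d1).

(* Lipschitz on X * R^d2 for the Euclidean norm of the pair; nrm is the norm of
   the codomain. *)
Definition lipschitz_joint (V : zmodType) (nrm : V -> R) (L : R)
    (u : 'cV[R]_d1 -> 'cV[R]_d2 -> V) : Prop :=
  forall l l' b b', X l -> X l' ->
    nrm (u l b - u l' b') <= L * l2norm (col_mx (l - l') (b - b')).

Definition is_gradient (u : 'cV[R]_d1 -> 'cV[R]_d2 -> R)
    (ul : 'cV[R]_d1 -> 'cV[R]_d2 -> 'cV[R]_d1)
    (ub : 'cV[R]_d1 -> 'cV[R]_d2 -> 'cV[R]_d2) : Prop :=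
  forall l b, X l ->
    gradient_at [set z : 'cV[R]_(d1 + d2) | X (usubmx z)]
      (fun z => u (usubmx z) (dsubmx z)) (col_mx l b) (col_mx (ul l b) (ub l b)).

(* ulb i j is the second derivative in lambda_i and beta_j, hence the transpose
   of the lambda-Jacobian of the beta-gradient. *)
Definition is_hessian (ub : 'cV[R]_d1 -> 'cV[R]_d2 -> 'cV[R]_d2)
    (ulb : 'cV[R]_d1 -> 'cV[R]_d2 -> 'M[R]_(d1, d2))
    (ubb : 'cV[R]_d1 -> 'cV[R]_d2 -> 'M[R]_d2) : Prop :=
  forall l b, X l ->
    jacobian_at X (fun l' => ub l' b) l (ulb l b)^T /\
    jacobian_at setT (fun b' => ub l b') b (ubb l b).

Definition smooth_outer (lf0 lf1 : R) u ul ub : Prop :=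
  [/\ is_gradient u ul ub,
      lipschitz_joint (fun x : R => `|x|) lf0 u
    & lipschitz_joint (@l2norm R (d1 + d2)) lf1
        (fun l b => col_mx (ul l b) (ub l b))].

Definition smooth_inner (lg1 lg2 : R) u ul ub ulb ubb : Prop :=
  [/\ is_gradient u ul ub, is_hessian ub ulb ubb,
      lipschitz_joint (@l2norm R (d1 + d2)) lg1
        (fun l b => col_mx (ul l b) (ub l b)),
      lipschitz_joint (@opnorm R d1 d2) lg2 ulb
    & lipschitz_joint (@opnorm R d2 d2) lg2 ubb].

End JointFunctions.

(* The suffixes l, b stand for lambda- and beta-derivatives; reg is the nonsmooth
   term h and dgf the distance generating functions phi_t. *)
Record problem (R : realType) (d1 d2 : nat) (dE dZ : measure_display)
    (E : measurableType dE) (Z : measurableType dZ) := Problem {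
  dom : set 'cV[R]_d1 ;
  lawE : probability E R ;
  lawZ : probability Z R ;
  obj_f : nat -> E -> 'cV[R]_d1 -> 'cV[R]_d2 -> R ;
  obj_fl : nat -> E -> 'cV[R]_d1 -> 'cV[R]_d2 -> 'cV[R]_d1 ;
  obj_fb : nat -> E -> 'cV[R]_d1 -> 'cV[R]_d2 -> 'cV[R]_d2 ;
  obj_g : nat -> Z -> 'cV[R]_d1 -> 'cV[R]_d2 -> R ;
  obj_gl : nat -> Z -> 'cV[R]_d1 -> 'cV[R]_d2 -> 'cV[R]_d1 ;
  obj_gb : nat -> Z -> 'cV[R]_d1 -> 'cV[R]_d2 -> 'cV[R]_d2 ;
  obj_glb : nat -> Z -> 'cV[R]_d1 -> 'cV[R]_d2 -> 'M[R]_(d1, d2) ;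
  obj_gbb : nat -> Z -> 'cV[R]_d1 -> 'cV[R]_d2 -> 'M[R]_d2 ;
  reg : 'cV[R]_d1 -> R ;
  dgf : nat -> 'cV[R]_d1 -> R ;
  dgf_grad : nat -> 'cV[R]_d1 -> 'cV[R]_d1
}.

(* epsilon_t, zeta_t^j and tilde m_t for the hypergradient estimate of round t;
   batch t k j is the j-th sample of the k-th inner batch of round t. *)
Record samples (Omega E Z : Type) := Samples {
  eps : nat -> Omega -> E ;
  zeta : nat -> nat -> Omega -> Z ;
  mtil : nat -> Omega -> nat ;
  batch : nat -> nat -> nat -> Omega -> Z
}.

Section Problem.
Context (R : realType) (d1 d2 : nat) (dE dZ : measure_display)
  (E : measurableType dE) (Z : measurableType dZ) (pb : problem R d1 d2 E Z).
Local Notation X := (dom pb).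

Definition fmean t l b : R := \int[lawE pb]_e obj_f pb t e l b.
Definition gmean t l b : R := \int[lawZ pb]_z obj_g pb t z l b.

Definition betahat t l : 'cV[R]_d2 := argmin setT (gmean t l).

Definition obj_F t l : R := fmean t l (betahat t l).

Definition gradF t l : 'cV[R]_d1 := grad_on X (obj_F t) l.

Definition bregman t (l2 l1 : 'cV[R]_d1) : R :=
  dgf pb t l2 - dgf pb t l1 - dotv (dgf_grad pb t l1) (l2 - l1).

Definition bregman_obj t (alpha : R) (u q l : 'cV[R]_d1) : R :=
  dotv q l + reg pb l + alpha^-1 * bregman t l u.

Definition bregman_step t alpha u q : 'cV[R]_d1 :=
  argmin X (bregman_obj t alpha u q).

Definition grad_map t u q alpha : 'cV[R]_d1 :=
  alpha^-1 *: (u - bregman_step t alpha u q).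

(* k is the value of the uniform index tilde m *)
Definition hypergrad (lg1 : R) (m : nat) t l b (e : E) (z : nat -> Z) (k : nat) :
    'cV[R]_d1 :=
  obj_fl pb t e l b -
  obj_glb pb t (z 0%N) l b *m
    ((m%:R / lg1) *:
      \prod_(1 <= j < k.+1) (1%:M - lg1^-1 *: obj_gbb pb t (z j) l b)) *m
    obj_fb pb t e l b.

(* z k j is the j-th sample of the k-th batch *)
Fixpoint inner_loop (eta : R) (s t : nat) l (z : nat -> nat -> Z) b (k : nat) :
    'cV[R]_d2 :=
  if k is k'.+1 then
    let o := inner_loop eta s t l z b k' in
    o - eta *: (s%:R^-1 *: \sum_(j < s) obj_gb pb t (z k j) l o)
  else b.

Definition V1 (T : nat) : R :=
  \sum_(1 <= t < T.+1) sup [set `|obj_F t.+1 l - obj_F t l| | l in X].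

Definition H2 (T : nat) : R :=
  \sum_(2 <= t < T.+1)
    sup [set l2norm (betahat t.-1 l - betahat t l) ^+ 2 | l in X].

(* Standing conventions: the objectives are random variables with a mean, and
   the Bregman step has a minimizer. *)
Definition random_objectives (T : nat) : Prop :=
  forall t l b, (1 <= t <= T.+1)%N -> X l ->
  [/\ (lawE pb).-integrable setT (fun e => (obj_f pb t e l b)%:E),
      forall i, measurable_fun setT (fun e => obj_fl pb t e l b i 0)
    & forall i, measurable_fun setT (fun e => obj_fb pb t e l b i 0)] /\
  [/\ (lawZ pb).-integrable setT (fun z => (obj_g pb t z l b)%:E),
      forall i, measurable_fun setT (fun z => obj_gb pb t z l b i 0),
      forall i j, measurable_fun setT (fun z => obj_glb pb t z l b i j)
    & forall i j, measurable_fun setT (fun z => obj_gbb pb t z l b i j)].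

Definition bregman_steps_exist (T : nat) (alpha : R) : Prop :=
  forall t u q, (1 <= t <= T)%N -> X u ->
    exists l, is_argmin X (bregman_obj t alpha u q) l.

Definition convex_regularizer : Prop :=
  @convex_function R 'cV[R]_d1 X (reg pb).

Definition assumptionA (T : nat) (lf0 lf1 lg1 lg2 : R) : Prop :=
  forall t, (1 <= t <= T.+1)%N ->
  [/\ forall e, smooth_outer X lf0 lf1 (obj_f pb t e) (obj_fl pb t e) (obj_fb pb t e),
      forall z, smooth_inner X lg1 lg2 (obj_g pb t z) (obj_gl pb t z) (obj_gb pb t z)
                  (obj_glb pb t z) (obj_gbb pb t z),
      exists ul ub, smooth_outer X lf0 lf1 (fmean t) ul ub
    & exists ul ub ulb ubb, smooth_inner X lg1 lg2 (gmean t) ul ub ulb ubb].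

Definition assumptionB (T : nat) (mu : R) : Prop :=
  forall t l, (1 <= t <= T.+1)%N -> X l ->
    strongly_convex setT mu (gmean t l) /\
    forall z, strongly_convex setT mu (obj_g pb t z l).

Definition assumptionD (S : R) : Prop :=
  [/\ closed X, @convex_set R 'cV[R]_d1 X
    & forall l l', X l -> X l' -> l2norm (l - l') <= S].

Definition assumptionE (T : nat) (Q : R) : Prop :=
  forall t l, (1 <= t <= T.+1)%N -> X l -> `|obj_F t l| <= Q.

Definition assumptionF (T : nat) (rho : R) : Prop :=
  forall t, (1 <= t <= T)%N ->
  [/\ forall l, X l -> gradient_at X (dgf pb t) l (dgf_grad pb t l),
      {within X, continuous (dgf_grad pb t)}
    & strongly_convex X rho (dgf pb t)].

Section Run.
Context (dO : measure_display) (Omega : measurableType dO)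
  (P : probability Omega R) (smp : samples Omega E Z).

Definition hypergrad_est lg1 m t l b (o : Omega) : 'cV[R]_d1 :=
  hypergrad lg1 m t l b (eps smp t o) (fun j => zeta smp t j o) (mtil smp t o).

(* The samples of round t have the law of a generic draw, so the variance of the
   estimate is taken over them. *)
Definition assumptionC (T m : nat) (lg1 sf sg : R) : Prop :=
  forall t l b, (1 <= t <= T)%N -> X l ->
  [/\ vmean (lawZ pb) (fun z => obj_gb pb t z l b) = grad_on setT (gmean t l) b,
      (\int[lawZ pb]_z
        (l2norm (obj_gb pb t z l b - grad_on setT (gmean t l) b) ^+ 2)%:E
        <= (sg ^+ 2)%:E)%E
    & (\int[P]_o
        (l2norm (hypergrad_est lg1 m t l b o -
                 vmean P (hypergrad_est lg1 m t l b)) ^+ 2)%:E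
        <= (sf ^+ 2)%:E)%E].

(* Rounds are numbered from 1; the terms with t - i <= 0 are zero, so the
   window sum only keeps i < t. *)
Definition window_est lg1 m (w : nat) (lam : nat -> Omega -> 'cV[R]_d1)
    (beta : nat -> Omega -> 'cV[R]_d2) t (o : Omega) : 'cV[R]_d1 :=
  w%:R^-1 *: \sum_(i < w | (i < t)%N)
    hypergrad_est lg1 m (t - i) (lam (t - i)%N o) (beta (t - i).+1 o) o.

Definition gradFw (w : nat) (lam : nat -> Omega -> 'cV[R]_d1) t (o : Omega) :
    'cV[R]_d1 :=
  w%:R^-1 *: \sum_(i < w | (i < t)%N) gradF (t - i) (lam (t - i)%N o).

Definition sobbo (T K s m w : nat) (lg1 eta alpha : R)
    (lam1 : 'cV[R]_d1) (beta1 : 'cV[R]_d2)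
    (lam : nat -> Omega -> 'cV[R]_d1) (beta : nat -> Omega -> 'cV[R]_d2) : Prop :=
  forall o, [/\ lam 1%N o = lam1, beta 1%N o = beta1 &
    forall t, (1 <= t <= T)%N ->
      beta t.+1 o = inner_loop eta s t (lam t o)
                      (fun k j => batch smp t k j o) (beta t o) K /\
      lam t.+1 o = bregman_step t alpha (lam t o)
                      (window_est lg1 m w lam beta t o)].

Definition regret (T w : nat) (alpha : R) (lam : nat -> Omega -> 'cV[R]_d1) :
    \bar R :=
  ('E_P[fun o => (\sum_(1 <= t < T.+1)
     l2norm (grad_map t (lam t o) (gradFw w lam t o) alpha) ^+ 2)%R])%E.

End Run.
End Problem.

Definition mutually_independent (R : realType) d (Omega : measurableType d)
    (P : probability Omega R) (I : Type) (act : set I)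
    (ev : I -> set (set Omega)) : Prop :=
  forall (n : nat) (i : 'I_n -> I) (A : 'I_n -> set Omega), injective i ->
    (forall k, act (i k)) -> (forall k, ev (i k) (A k)) ->
    P (\bigcap_(k in [set: 'I_n]) A k) = (\prod_(k < n) P (A k))%E.

Variant draw :=
  | DrawEps of nat
  | DrawZeta of nat & nat
  | DrawM of nat
  | DrawBatch of nat & nat & nat.

Definition drawn (T K s m : nat) (d : draw) : Prop :=
  match d with
  | DrawEps t | DrawM t => (1 <= t <= T)%N
  | DrawZeta t j => (1 <= t <= T)%N /\ (j < m)%N
  | DrawBatch t k j => [/\ (1 <= t <= T)%N, (1 <= k <= K)%N & (j < s)%N]
  end.

Definition draw_events (Omega : Type) dE dZ (E : measurableType dE)
    (Z : measurableType dZ) (smp : samples Omega E Z) (d : draw) :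
    set (set Omega) :=
  match d with
  | DrawEps t => [set eps smp t @^-1` A | A in measurable]
  | DrawZeta t j => [set zeta smp t j @^-1` A | A in measurable]
  | DrawM t => [set mtil smp t @^-1` A | A in measurable]
  | DrawBatch t k j => [set batch smp t k j @^-1` A | A in measurable]
  end.

Definition has_law (R : realType) d (Omega : measurableType d)
    (P : probability Omega R) d' (E : measurableType d') (x : Omega -> E)
    (mu : probability E R) : Prop :=
  measurable_fun setT x /\ forall A, measurable A -> P (x @^-1` A) = mu A.

Definition independent_draws (R : realType) d1 d2 dE dZ dO
    (E : measurableType dE) (Z : measurableType dZ) (Omega : measurableType dO)
    (pb : problem R d1 d2 E Z) (P : probability Omega R)
    (smp : samples Omega E Z) (T K s m : nat) : Prop :=
  [/\ forall t, drawn T K s m (DrawEps t) -> has_law P (eps smp t) (lawE pb),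
      forall t j, drawn T K s m (DrawZeta t j) ->
        has_law P (zeta smp t j) (lawZ pb),
      forall t, drawn T K s m (DrawM t) ->
        [/\ measurable_fun setT (mtil smp t), forall o, (mtil smp t o < m)%N
          & forall k, (k < m)%N -> P (mtil smp t @^-1` [set k]) = (m%:R^-1)%:E],
      forall t k j, drawn T K s m (DrawBatch t k j) ->
        has_law P (batch smp t k j) (lawZ pb)
    & mutually_independent P (drawn T K s m) (draw_events smp)].

Section Constants.
Context (R : realType).

Definition kappa_g (lg1 mu : R) : R := lg1 / mu.

Definition M_f (lf0 lf1 lg1 lg2 mu : R) : R :=
  let kg := kappa_g lg1 mu in
  lf1 + lf1 * kg + lf0 * lg2 / mu * (1 + kg).

Definition l_F1 (lf0 lf1 lg1 lg2 mu : R) : R :=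
  let kg := kappa_g lg1 mu in
  lf1 * (1 + kg) + lf0 * lg2 / mu * (1 + kg) + M_f lf0 lf1 lg1 lg2 mu * kg.

Definition nu_rate (lg1 mu eta : R) (K : nat) : R :=
  (1 - eta * lg1 * mu / (lg1 + mu)) *
  (1 - 2 * eta * lg1 * mu / (lg1 + mu)) ^+ K.-1.

Definition C_mu (lg1 mu eta : R) : R := 1 + (lg1 + mu) / (eta * lg1 * mu).

Definition alpha_max (lf0 lf1 lg1 lg2 mu rho eta : R) (K : nat) : R :=
  Num.min (3 * rho / (4 * l_F1 lf0 lf1 lg1 lg2 mu))
    (rho * Num.sqrt (1 - nu_rate lg1 mu eta K) /
      (kappa_g lg1 mu ^+ 2 * Num.sqrt (72 * C_mu lg1 mu eta))).

(* For mu = lg1 the denominator is ln (0^-1) = 0 here, so the quotient is 0,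
   which is also its limit value. *)
Definition neumann_size (lg1 mu : R) (w : nat) : nat :=
  (`|Num.ceil (ln w%:R / ln (1 - mu / lg1)^-1)| + 1)%N.

End Constants.

(* Main.v *)
Require Import Defs.
From HB Require Import structures.
From mathcomp Require Import all_boot all_order all_algebra.
From mathcomp Require Import all_classical all_reals all_analysis.
From mathcomp Require Import measurable_realfun ring lra.

Set Implicit Arguments.
Unset Strict Implicit.
Unset Printing Implicit Defensive.

Import Order.TTheory GRing.Theory Num.Theory.
Import numFieldNormedType.Exports.

Local Open Scope classical_set_scope.
Local Open Scope ring_scope.

(** Gradients on X are only determined along X - X, so every estimate is made on pairings
    with x - y for x, y in X.  The Bregman step satisfies
    (rho / 2 alpha) |lam_(t+1) - lam_t|^2 <= <q_t, lam_t - lam_(t+1)> + h(lam_t) - h(lam_(t+1))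
    for the window estimate q_t.  Summing over t and exchanging the two sums pairs the
    estimate of each single round with a telescoped displacement of length at most S, with
    weight 1/w; hence the squared steps add up to O(T/w + gap_h) in mean.  The distance
    between q_t and the smoothed gradient splits into a martingale part, of variance at most
    sf^2/w because the draws of distinct rounds are independent, and a bias controlled by the
    truncation (1 - mu/lg1)^m <= 1/w of the Neumann series and by the inner errors
    |beta_(t+1) - betahat_t(lam_t)|.  The squared inner errors contract by 1 - eta mu per
    round, up to batch noise O(sg^2/w), the squared outer steps and the drift in H_2.
    Finally alpha <= 3 rho / (4 l_F1) bounds kappa_g by a constant. *)

(** * Euclidean geometry and calculus relative to a convex set *)

(** Three obstacles shape the development. First, the estimate carries the factor [m / lg1], and [m]
    grows with [w], so no pathwise bound is uniform in [w]. Its pairings are at most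
    [lf0 (1 + m q^mtil)] times the displacement, with [q = 1 - mu / lg1]; as [mtil] is uniform, the
    mean of [m q^mtil] is a partial geometric sum, at most [kappa_g]. Second, no joint measurability
    is assumed and the iterates are selected minimisers. Sampled derivatives are measurable in the
    sample and continuous in the point, and the Bregman step is a Lipschitz function of a single
    vector; this makes the iterates measurable for the past draws. Conditional expectations become
    integrals over a second sample point [o'], justified by independence of disjoint groups of
    draws. Third, sampled and mean objectives come with separate derivatives, which are matched
    through second-order remainders uniform in the sample. Neumann factors are controlled as
    Jacobians of a contractive gradient step, without eigenvalues. *)

Section Euclidean.
Context (R : realType).

Section Vectors.
Context (n : nat).
Implicit Types (u v w : 'cV[R]_n) (a : R).

Lemma dotvE u v : dotv u v = (u^T *m v) 0 0.
Proof. by rewrite mxE; apply: eq_bigr => i _; rewrite mxE. Qed.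

Lemma dotvC u v : dotv u v = dotv v u.
Proof. by apply: eq_bigr => i _; rewrite mulrC. Qed.

Lemma dotvDl u v w : dotv (u + v) w = dotv u w + dotv v w.
Proof. by rewrite -big_split; apply: eq_bigr => i _; rewrite mxE mulrDl. Qed.

Lemma dotvZl a u v : dotv (a *: u) v = a * dotv u v.
Proof. by rewrite big_distrr; apply: eq_bigr => i _; rewrite mxE /= mulrA. Qed.

Lemma dotvDr u v w : dotv w (u + v) = dotv w u + dotv w v.
Proof. by rewrite !(dotvC w) dotvDl. Qed.

Lemma dotvZr a u v : dotv u (a *: v) = a * dotv u v.
Proof. by rewrite !(dotvC u) dotvZl. Qed.

Lemma dotvNl u v : dotv (- u) v = - dotv u v.
Proof. by rewrite -scaleN1r dotvZl mulN1r. Qed.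

Lemma dotvNr u v : dotv u (- v) = - dotv u v.
Proof. by rewrite !(dotvC u) dotvNl. Qed.

Lemma dotvBl u v w : dotv (u - v) w = dotv u w - dotv v w.
Proof. by rewrite dotvDl dotvNl. Qed.

Lemma dotvBr u v w : dotv w (u - v) = dotv w u - dotv w v.
Proof. by rewrite dotvDr dotvNr. Qed.

Lemma dotv0l u : dotv 0 u = 0.
Proof. by rewrite -(scale0r 0) dotvZl mul0r. Qed.

Lemma dotv0r u : dotv u 0 = 0.
Proof. by rewrite dotvC dotv0l. Qed.

Lemma dotv_suml (I : Type) (r : seq I) (Q : pred I) (F : I -> 'cV[R]_n) u :
  dotv (\sum_(i <- r | Q i) F i) u = \sum_(i <- r | Q i) dotv (F i) u.
Proof. by elim/big_rec2: _ => [|i x y _ <-]; rewrite ?dotv0l ?dotvDl. Qed.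

Lemma dotv_sumr (I : Type) (r : seq I) (Q : pred I) (F : I -> 'cV[R]_n) u :
  dotv u (\sum_(i <- r | Q i) F i) = \sum_(i <- r | Q i) dotv u (F i).
Proof. by rewrite dotvC dotv_suml; apply: eq_bigr => i _; rewrite dotvC. Qed.

Lemma dotv_delta u i : dotv u (delta_mx i 0) = u i 0.
Proof.
rewrite /dotv (bigD1 i)//= big1 ?addr0 => [|j /negPf ji]; first by rewrite mxE !eqxx mulr1.
by rewrite mxE ji mulr0.
Qed.

Lemma dotv_ge0 u : 0 <= dotv u u.
Proof. by apply: sumr_ge0 => i _; rewrite -expr2 sqr_ge0. Qed.

Lemma l2norm_ge0 u : 0 <= l2norm u.
Proof. exact: sqrtr_ge0. Qed.

Lemma l2norm_sqr u : l2norm u ^+ 2 = dotv u u.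
Proof. by rewrite sqr_sqrtr// dotv_ge0. Qed.

Lemma l2norm0 : l2norm (0 : 'cV[R]_n) = 0.
Proof. by rewrite /l2norm dotv0l sqrtr0. Qed.

Lemma l2normZ a u : l2norm (a *: u) = `|a| * l2norm u.
Proof.
by rewrite /l2norm dotvZl dotvZr mulrA -expr2 sqrtrM ?sqr_ge0// sqrtr_sqr.
Qed.

Lemma l2normN u : l2norm (- u) = l2norm u.
Proof. by rewrite -scaleN1r l2normZ normrN1 mul1r. Qed.

Lemma l2norm_distC u v : l2norm (u - v) = l2norm (v - u).
Proof. by rewrite -l2normN opprB. Qed.

Lemma normr_coord_le u i : `|u i 0| <= l2norm u.
Proof.
rewrite -sqrtr_sqr ler_wsqrtr// /dotv (bigD1 i)//= -expr2 lerDl.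
by apply: sumr_ge0 => j _; rewrite -expr2 sqr_ge0.
Qed.

Lemma l2norm_sqr_le u a : l2norm u <= a -> l2norm u ^+ 2 <= a ^+ 2.
Proof.
move=> ua; have a0 := le_trans (l2norm_ge0 u) ua.
by rewrite ler_pXn2r ?nnegrE ?l2norm_ge0.
Qed.

Lemma l2norm_eq0 u : l2norm u = 0 -> u = 0.
Proof.
move=> u0; apply/matrixP => i j; rewrite ord1 mxE; apply/eqP.
by rewrite -normr_le0 (le_trans (normr_coord_le u i))// u0.
Qed.

Lemma l2norm_gt0 u : u != 0 -> 0 < l2norm u.
Proof.
by move=> u0; rewrite lt_def l2norm_ge0 andbT; apply: contra u0 => /eqP/l2norm_eq0/eqP.
Qed.

(** Expanding the square of [|v| u - |u| v] gives [2 |u| |v| (|u| |v| - <u, v>) >= 0]. *)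
Lemma dotv_le u v : dotv u v <= l2norm u * l2norm v.
Proof.
have [->|v0] := eqVneq v 0; first by rewrite dotv0r l2norm0 mulr0.
have [->|u0] := eqVneq u 0; first by rewrite dotv0l l2norm0 mul0r.
have := dotv_ge0 (l2norm v *: u - l2norm u *: v).
rewrite dotvBl !dotvBr !dotvZl !dotvZr (dotvC v u) -!l2norm_sqr.
have := mulr_gt0 (l2norm_gt0 u0) (l2norm_gt0 v0).
set a := l2norm u; set b := l2norm v; set c := dotv u v => ab0 H.
rewrite -subr_ge0 -(pmulr_lge0 _ ab0) -(pmulr_lge0 _ (ltr0n R 2)).
by apply: le_trans H _; rewrite le_eqVlt; apply/orP; left; apply/eqP; ring.
Qed.

Lemma dotv_abs_le u v : `|dotv u v| <= l2norm u * l2norm v.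
Proof.
by rewrite ler_norml dotv_le lerNl -dotvNl -(l2normN u) dotv_le.
Qed.

Lemma ler_l2normD u v : l2norm (u + v) <= l2norm u + l2norm v.
Proof.
rewrite -(ler_pXn2r (ltn0Sn 1)) ?nnegrE ?addr_ge0 ?l2norm_ge0//.
rewrite sqrrD !l2norm_sqr dotvDl !dotvDr (dotvC v u).
have := dotv_le u v; lra.
Qed.

Lemma ler_l2normB u v : l2norm (u - v) <= l2norm u + l2norm v.
Proof. by rewrite -(l2normN v) ler_l2normD. Qed.

Lemma l2norm_triangle w u v : l2norm (u - v) <= l2norm (u - w) + l2norm (w - v).
Proof. by rewrite (le_trans _ (ler_l2normD _ _))// addrA subrK. Qed.

Lemma l2norm_sqrD_le u v : l2norm (u + v) ^+ 2 <= 2 * l2norm u ^+ 2 + 2 * l2norm v ^+ 2.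
Proof.
rewrite !l2norm_sqr dotvDl !dotvDr (dotvC v u).
have := dotv_ge0 (u - v); rewrite dotvBl !dotvBr (dotvC v u); lra.
Qed.

(* The norm of [u] is attained by pairing with [u] itself. *)
Lemma l2norm_le_dual u a : 0 <= a ->
  (forall v, dotv u v <= a * l2norm v) -> l2norm u <= a.
Proof.
move=> a0 /(_ u); rewrite -l2norm_sqr expr2.
have [->|u0] := eqVneq u 0; first by rewrite l2norm0.
by rewrite ler_pM2r// l2norm_gt0.
Qed.

Lemma l2norm_le_sum u : l2norm u <= \sum_i `|u i 0|.
Proof.
rewrite -(ler_pXn2r (ltn0Sn 1)) ?nnegrE ?l2norm_ge0 ?sumr_ge0// l2norm_sqr expr2.
rewrite {1}/dotv big_distrl; apply: ler_sum => i _ /=.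
rewrite (le_trans (ler_norm _))// normrM ler_wpM2l//.
by rewrite (bigD1 i)//= lerDl sumr_ge0.
Qed.

End Vectors.

Lemma l2norm_dim0 n (u : 'cV[R]_n) : n = 0%N -> l2norm u = 0.
Proof. by case: n u => // u _; rewrite /l2norm /dotv big_ord0 sqrtr0. Qed.

Lemma dotv_trmx m n (A : 'M[R]_(m, n)) (u : 'cV[R]_m) (v : 'cV[R]_n) :
  dotv u (A *m v) = dotv (A^T *m u) v.
Proof. by rewrite !dotvE trmx_mul trmxK mulmxA. Qed.

Lemma dotv_trmxl m n (A : 'M[R]_(m, n)) (u : 'cV[R]_m) (v : 'cV[R]_n) :
  dotv (A *m v) u = dotv v (A^T *m u).
Proof. by rewrite dotvC dotv_trmx dotvC. Qed.

Lemma dotv_col_mx m n (u u' : 'cV[R]_m) (v v' : 'cV[R]_n) :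
  dotv (col_mx u v) (col_mx u' v') = dotv u u' + dotv v v'.
Proof.
by rewrite /dotv big_split_ord; congr (_ + _); apply: eq_bigr => i _;
  rewrite ?col_mxEu ?col_mxEd.
Qed.

Lemma l2norm_col_mx_sqr m n (u : 'cV[R]_m) (v : 'cV[R]_n) :
  l2norm (col_mx u v) ^+ 2 = l2norm u ^+ 2 + l2norm v ^+ 2.
Proof. by rewrite !l2norm_sqr dotv_col_mx. Qed.

Lemma l2norm_col_mx_u m n (u : 'cV[R]_m) (v : 'cV[R]_n) :
  l2norm u <= l2norm (col_mx u v).
Proof.
rewrite -(ler_pXn2r (ltn0Sn 1)) ?nnegrE ?l2norm_ge0//.
by rewrite l2norm_col_mx_sqr lerDl sqr_ge0.
Qed.

Lemma l2norm_col_mx_d m n (u : 'cV[R]_m) (v : 'cV[R]_n) :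
  l2norm v <= l2norm (col_mx u v).
Proof.
rewrite -(ler_pXn2r (ltn0Sn 1)) ?nnegrE ?l2norm_ge0//.
by rewrite l2norm_col_mx_sqr lerDr sqr_ge0.
Qed.

Lemma l2norm_col_mx0 m n (u : 'cV[R]_m) :
  l2norm (col_mx u (0 : 'cV_n)) = l2norm u.
Proof. by rewrite /l2norm dotv_col_mx dotv0l addr0. Qed.

Lemma l2norm_col_0mx m n (v : 'cV[R]_n) :
  l2norm (col_mx (0 : 'cV_m) v) = l2norm v.
Proof. by rewrite /l2norm dotv_col_mx dotv0l add0r. Qed.

Section Opnorm.
Context (m n : nat).
Implicit Types M : 'M[R]_(m, n).

Lemma mulmx_bounded M : exists2 c, 0 <= c & forall v, l2norm (M *m v) <= c * l2norm v.
Proof.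
exists (\sum_i \sum_j `|M i j|).
  by apply: sumr_ge0 => i _; apply: sumr_ge0.
move=> v; rewrite (le_trans (l2norm_le_sum _))// big_distrl; apply: ler_sum => i _ /=.
rewrite mxE (le_trans (ler_norm_sum _ _ _))// big_distrl; apply: ler_sum => j _ /=.
by rewrite normrM ler_wpM2l// normr_coord_le.
Qed.

Lemma has_sup_opnorm M :
  has_sup [set l2norm (M *m v) | v in [set v : 'cV[R]_n | l2norm v <= 1]].
Proof.
split; first by exists (l2norm (M *m 0)); exists 0 => //=; rewrite l2norm0.
have [c c0 Mc] := mulmx_bounded M; exists c => _ [v /= v1 <-].
by rewrite (le_trans (Mc v))// ler_piMr.
Qed.

Lemma opnorm_ge0 M : 0 <= opnorm M.
Proof.
apply: ub_le_sup; first by case: (has_sup_opnorm M).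
by exists 0; rewrite /= ?mulmx0 l2norm0.
Qed.

Lemma opnorm_le M v : l2norm (M *m v) <= opnorm M * l2norm v.
Proof.
have [->|v0] := eqVneq v 0; first by rewrite mulmx0 !l2norm0 mulr0.
have nv := l2norm_gt0 v0.
rewrite -ler_pdivrMr//; apply: ub_le_sup; first by case: (has_sup_opnorm M).
exists ((l2norm v)^-1 *: v) => /=.
  by rewrite l2normZ ger0_norm ?invr_ge0 ?l2norm_ge0// mulVf// gt_eqF.
by rewrite -scalemxAr l2normZ ger0_norm ?invr_ge0 ?l2norm_ge0// mulrC.
Qed.

Lemma normr_entry_le M i j : `|M i j| <= opnorm M.
Proof.
have := opnorm_le M (delta_mx j 0).
have -> : l2norm (delta_mx j 0 : 'cV[R]_n) = 1.
  by rewrite /l2norm dotv_delta mxE !eqxx sqrtr1.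
rewrite mulr1; apply: le_trans.
by rewrite -colE (le_trans _ (normr_coord_le _ i))// mxE.
Qed.

Lemma opnorm_tr_le M v : l2norm (M^T *m v) <= opnorm M * l2norm v.
Proof.
apply: l2norm_le_dual => [|u]; first by rewrite mulr_ge0 ?opnorm_ge0 ?l2norm_ge0.
rewrite -dotv_trmx (le_trans (dotv_le _ _))// mulrAC [X in X <= _]mulrC.
by rewrite ler_wpM2r ?l2norm_ge0// opnorm_le.
Qed.

End Opnorm.
End Euclidean.

Section Calculus.
Context (R : realType).

(** Closes first-order arguments along a segment: [e] serves both as precision and as bound on the
    step length, hence [e <= 1]. *)
Lemma le_of_scaled_error (a b c : R) : 0 <= c ->
  (forall e, 0 < e -> e <= 1 -> a <= b + e * c) -> a <= b.
Proof.
move=> c0 H; apply/ler_addgt0Pr => e e0.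
have c1 : 0 < 1 + c by rewrite ltr_pwDl.
have ec0 : 0 < e / (1 + c) by rewrite divr_gt0.
have m0 : 0 < Num.min 1 (e / (1 + c)) by rewrite lt_min ltr01 ec0.
rewrite (le_trans (H _ m0 _)) ?ge_min ?lexx// lerD2l.
rewrite (@le_trans _ _ (e / (1 + c) * c))// ?ler_wpM2r// ?ge_min ?lexx ?orbT//.
rewrite mulrAC ler_pdivrMr// ler_wpM2l ?(ltW e0)// lerDr//.
Qed.

(** The hypothesis is differentiability relative to [[0, 1]], one-sided at the end points. It yields
    true derivatives inside and continuity up to the ends, as the mean value theorem requires. *)
Lemma line_MVT (f df : R -> R) :
  (forall s, 0 <= s <= 1 -> forall e, 0 < e -> exists2 d, 0 < d &
     forall s', 0 <= s' <= 1 -> `|s' - s| < d ->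
       `|f s' - f s - df s * (s' - s)| <= e * `|s' - s|) ->
  exists2 c, 0 <= c <= 1 & f 1 - f 0 = df c.
Proof.
move=> H.
have cvg s : 0 <= s <= 1 -> forall e, 0 < e -> exists2 d, 0 < d &
     forall s', 0 <= s' <= 1 -> `|s' - s| < d -> `|f s - f s'| < e.
  move=> s01 e e0; have [d d0 Hd] := H s s01 _ ltr01.
  have k0 : 0 < 1 + `|df s| + 1 by have := normr_ge0 (df s); lra.
  exists (Num.min d (e / (1 + `|df s| + 1))); first by rewrite lt_min d0 divr_gt0.
  move=> s' s'01; rewrite lt_min => /andP[/(Hd _ s'01) {}Hd].
  rewrite ltr_pdivlMr// => /le_lt_trans; apply.
  rewrite distrC -[f s' - f s](subrK (df s * (s' - s))).
  rewrite (le_trans (ler_normD _ _))// normrM.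
  move: Hd; rewrite mul1r; have := normr_ge0 (s' - s); lra.
have [|s s01||c c01] := @MVT _ f df 0 1.
- exact: ltr01.
- move: s01; rewrite in_itv /= => /andP[s0 s1].
  suff quot : h^-1 *: ((f \o shift s) (h *: (1 : R)) - f s) @[h --> 0^'] --> df s.
    by apply: DeriveDef; [apply/cvg_ex; exists (df s)|exact/cvg_lim].
  apply/cvgrPdist_le => /= e e0.
  have [|d d0 Hd] := H s _ e e0; first by rewrite !ltW.
  near=> h.
  have h0 : h != 0 by near: h; exact: nbhs_dnbhs_neq.
  have -> : h *: 1 = h :> R by rewrite -[LHS]/(h * 1) mulr1.
  have -> : df s - h^-1 *: (f (h + s) - f s) =
      - (h^-1 * (f (h + s) - f s - df s * (h + s - s))).
    by rewrite -[_ *: _]/(h^-1 * _); field.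
  rewrite normrN normrM normfV mulrC ler_pdivrMr ?normr_gt0//.
  have hs : h + s - s = h by rewrite addrK.
  rewrite -[in X in _ <= _ * `|X|]hs; apply: Hd; last first.
    by rewrite hs; near: h; exact: dnbhs0_lt.
  suff : `|h| < Num.min s (1 - s) by rewrite lt_min !ltr_norml; lra.
  by near: h; apply: dnbhs0_lt; rewrite lt_min; lra.
- apply/continuous_within_itvP; first exact: ltr01; split.
  + move=> s; rewrite in_itv /= => /andP[s0 s1].
    apply/cvgrPdist_lt => /= e e0.
    have [|d d0 Hd] := cvg s _ e e0; first by rewrite !ltW.
    exists (Num.min d (Num.min s (1 - s))) => /=.
      by rewrite !lt_min d0 s0 subr_gt0.
    move=> s' /=; rewrite !lt_min => /and3P[]; rewrite distrC => h1 h2 h3.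
    by apply: Hd => //; move: h2 h3; rewrite !ltr_norml; lra.
  + apply/cvgrPdist_lt => /= e e0.
    have [|d d0 Hd] := cvg 0 _ e e0; first by rewrite lexx ler01.
    near=> s; apply: Hd.
      apply/andP; split; first by near: s; exact: nbhs_right_ge.
      by near: s; exact/nbhs_right_le/ltr01.
    rewrite subr0 ger0_norm; last by near: s; exact: nbhs_right_ge.
    by near: s; exact: nbhs_right_lt.
  + apply/cvgrPdist_lt => /= e e0.
    have [|d d0 Hd] := cvg 1 _ e e0; first by rewrite lexx ler01.
    near=> s; apply: Hd.
      apply/andP; split; first by near: s; exact/nbhs_left_ge/ltr01.
      by near: s; exact: nbhs_left_le.
    rewrite distrC ger0_norm; last by rewrite subr_ge0; near: s; exact: nbhs_left_le.
    rewrite ltrBlDl -ltrBlDr.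
    by near: s; apply: nbhs_left_gt; lra.
- rewrite subr0 mulr1 => E; exists c => //.
  by move: c01; rewrite in_itv/= => /andP[? ?]; rewrite !ltW.
Unshelve. all: by end_near.
Qed.

End Calculus.

(** * Relative gradients of scalar functions, smoothness and strong convexity *)

Section Gradients.
Context (R : realType).

Lemma addrKC (V : zmodType) (x y : V) : x + y - x = y.
Proof. by rewrite addrAC subrr add0r. Qed.

Lemma normr_cancel_scale (s z c : R) : 0 < s -> `|s * z| <= s * c -> `|z| <= c.
Proof. by move=> s0; rewrite normrM gtr0_norm// ler_pM2l. Qed.

(** Convexity in the form in which increments [y - x] occur; it passes directly to the product of
    [X] with the inner space. *)
Definition segment_closed n (A : set 'cV[R]_n) : Prop :=
  forall x y a, A x -> A y -> 0 <= a <= 1 -> A (x + a *: (y - x)).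

Lemma segment_mid n (x y : 'cV[R]_n) a : x + a *: (y - x) = a *: y + (1 - a) *: x.
Proof. by rewrite scalerBr scalerBl scale1r addrCA. Qed.

Lemma convex_set_segment n (A : set 'cV[R]_n) :
  @convex_set R 'cV[R]_n A -> segment_closed A.
Proof.
move=> cA x y a Ax Ay /andP[a0 a1].
by have := cA y x (@Itv01 R a a0 a1); rewrite !inE segment_mid; exact.
Qed.

Lemma segment_closedT n : segment_closed [set: 'cV[R]_n].
Proof. by []. Qed.

Section ScalarValued.
Context (n : nat) (A : set 'cV[R]_n).
Implicit Types (u : 'cV[R]_n -> R) (G : 'cV[R]_n -> 'cV[R]_n).

Lemma gradient_segment u x v y : segment_closed A -> gradient_at A u x v ->
  A x -> A y -> forall e, 0 < e -> exists2 d, 0 < d & forall s, 0 <= s <= 1 -> s < d ->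
    `|u (x + s *: (y - x)) - u x - s * dotv v (y - x)| <= s * e.
Proof.
move=> cA H Ax Ay e e0.
have c0 : 0 < 1 + l2norm (y - x) by rewrite ltr_pwDl ?l2norm_ge0.
have [d d0 Hd] := H (e / (1 + l2norm (y - x))) (divr_gt0 e0 c0).
exists (d / (1 + l2norm (y - x))); first exact: divr_gt0.
move=> s s01 sd; have s0 : 0 <= s by case/andP: s01.
have Ey : x + s *: (y - x) - x = s *: (y - x) by rewrite addrKC.
have := Hd (x + s *: (y - x)) (cA _ _ _ Ax Ay s01).
rewrite Ey dotvZr l2normZ ger0_norm// => /(_ _)/le_trans; apply.
  move: sd; rewrite ltr_pdivlMr//; have := l2norm_ge0 (y - x); nra.
rewrite mulrCA ler_wpM2l// mulrAC ler_pdivrMr// ler_wpM2l ?(ltW e0)//; lra.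
Qed.

Lemma gradient_unique u x v v' y : segment_closed A -> A x -> A y ->
  gradient_at A u x v -> gradient_at A u x v' -> dotv v (y - x) = dotv v' (y - x).
Proof.
move=> cA Ax Ay gv gv'; apply/eqP; rewrite -subr_eq0 -normr_le0.
apply: (@le_of_scaled_error _ _ _ 2) => // e e0 _; rewrite add0r.
have [d d0 Hd] := gradient_segment cA gv Ax Ay e0.
have [d' d'0 Hd'] := gradient_segment cA gv' Ax Ay e0.
pose s := Num.min 1 (Num.min (d / 2) (d' / 2)).
have s0 : 0 < s by rewrite !lt_min; lra.
have s1 : s <= 1 by rewrite ge_min lexx.
have sd : s < d by rewrite !gt_min; apply/orP; right; apply/orP; left; lra.
have sd' : s < d' by rewrite !gt_min; apply/orP; right; apply/orP; right; lra.
have s01 : 0 <= s <= 1 by rewrite s1 ltW.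
have := Hd s s01 sd; have := Hd' s s01 sd'.
move=> H H'; apply: (normr_cancel_scale s0); move: H H'.
rewrite !ler_norml; lra.
Qed.

Lemma gradient_MVT u G x y : segment_closed A ->
  (forall z, A z -> gradient_at A u z (G z)) -> A x -> A y ->
  exists2 c, 0 <= c <= 1 & u y - u x = dotv (G (x + c *: (y - x))) (y - x).
Proof.
move=> cA gu Ax Ay.
have [s s01 e e0|c c01 E] := @line_MVT R (fun s => u (x + s *: (y - x)))
    (fun s => dotv (G (x + s *: (y - x))) (y - x)).
  have c0 : 0 < 1 + l2norm (y - x) by rewrite ltr_pwDl ?l2norm_ge0.
  have [d d0 Hd] := gu _ (cA _ _ _ Ax Ay s01) (e / (1 + l2norm (y - x))) (divr_gt0 e0 c0).
  exists (d / (1 + l2norm (y - x))); first exact: divr_gt0.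
  move=> s' s'01 ss'.
  have Ey : x + s' *: (y - x) - (x + s *: (y - x)) = (s' - s) *: (y - x).
    by rewrite opprD addrACA subrr add0r scalerBl.
  have := Hd _ (cA _ _ _ Ax Ay s'01).
  rewrite Ey dotvZr l2normZ [dotv _ _ * _]mulrC => H; apply: le_trans (H _) _.
    move: ss'; rewrite ltr_pdivlMr//.
    by have := l2norm_ge0 (y - x); have := normr_ge0 (s' - s); nra.
  rewrite [_ * l2norm _]mulrC mulrA ler_wpM2r//.
  by rewrite mulrAC ler_pdivrMr// ler_wpM2l ?(ltW e0)//; lra.
exists c => //; rewrite -E scale1r scale0r addr0; congr (u _ - _).
by rewrite addrC subrK.
Qed.

(** The mean value theorem gives [L] in place of [L / 2], which is enough where only the order
    counts; [gradient_descent_bound] has the sharp constant. *)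
Lemma gradient_remainder u G L x y : segment_closed A ->
  (forall z, A z -> gradient_at A u z (G z)) ->
  (forall z z', A z -> A z' -> l2norm (G z - G z') <= L * l2norm (z - z')) ->
  A x -> A y -> `|u y - u x - dotv (G x) (y - x)| <= L * l2norm (y - x) ^+ 2.
Proof.
move=> cA gu lG Ax Ay; have [c c01 ->] := gradient_MVT cA gu Ax Ay.
rewrite -dotvBl (le_trans (dotv_abs_le _ _))// expr2 mulrA ler_wpM2r ?l2norm_ge0//.
apply: le_trans (lG _ _ (cA _ _ _ Ax Ay c01) Ax) _.
rewrite addrKC l2normZ; case/andP: c01 => c0 c1; rewrite ger0_norm//.
have := l2norm_ge0 (y - x) => n0.
(* The sign of [L] is not given; the Lipschitz bound forces [0 <= L] once [x] and [y] differ. *)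
have [->|n1] := eqVneq (l2norm (y - x)) 0; first by rewrite !mulr0.
have L0 : 0 <= L.
  have := le_trans (l2norm_ge0 _) (lG _ _ Ay Ax).
  by rewrite pmulr_lge0// lt_def n1.
by rewrite ler_wpM2l// ler_piMl.
Qed.

Lemma gradient_at_sub u u' x v v' : gradient_at A u x v -> gradient_at A u' x v' ->
  gradient_at A (fun y => u y - u' y) x (v - v').
Proof.
move=> gu gu' e e0; have e2 : 0 < e / 2 by lra.
have [d d0 Hd] := gu _ e2; have [d' d'0 Hd'] := gu' _ e2.
exists (Num.min d d') => [|y Ay]; first by rewrite lt_min d0.
rewrite lt_min dotvBl => /andP[/(Hd _ Ay) H /(Hd' _ Ay) H'].
rewrite [X in `|X|](_ : _ = (u y - u x - dotv v (y - x)) - (u' y - u' x - dotv v' (y - x))); last by ring.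
by rewrite (le_trans (ler_normB _ _))//; lra.
Qed.

Lemma gradient_at_sqdist a x0 x : 0 <= a ->
  gradient_at A (fun y => a / 2 * l2norm (y - x0) ^+ 2) x (a *: (x - x0)).
Proof.
move=> a0 e e0; exists (e / (1 + a)) => [|y _ H]; first by rewrite divr_gt0// ltr_pwDl.
have -> : a / 2 * l2norm (y - x0) ^+ 2 - a / 2 * l2norm (x - x0) ^+ 2
    - dotv (a *: (x - x0)) (y - x) = a / 2 * l2norm (y - x) ^+ 2.
  have -> : y - x0 = (y - x) + (x - x0) by rewrite addrA subrK.
  move: (y - x) (x - x0) => p q.
  by rewrite !l2norm_sqr dotvZl !dotvDl !dotvDr (dotvC p q); field.
rewrite ger0_norm; last by rewrite mulr_ge0 ?sqr_ge0// divr_ge0.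
rewrite expr2 mulrA ler_wpM2r ?l2norm_ge0//.
move: H; rewrite ltr_pdivlMr ?ltr_pwDl//; have := l2norm_ge0 (y - x); nra.
Qed.

(** The mean value theorem is applied to [u - L / 2 |. - x|^2], whose slope along [y - x] is
    nonpositive by the Lipschitz bound. This gives [L / 2] without integrating the gradient. *)
Lemma gradient_descent_bound u G L x y : segment_closed A -> 0 <= L ->
  (forall z, A z -> gradient_at A u z (G z)) ->
  (forall z z', A z -> A z' -> l2norm (G z - G z') <= L * l2norm (z - z')) ->
  A x -> A y -> u y <= u x + dotv (G x) (y - x) + L / 2 * l2norm (y - x) ^+ 2.
Proof.
move=> cA L0 gu lG Ax Ay.
have [z Az|c c01] := @gradient_MVT (fun z => u z - L / 2 * l2norm (z - x) ^+ 2)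
    (fun z => G z - L *: (z - x)) x y cA _ Ax Ay.
  by apply: gradient_at_sub; [exact: gu|exact: gradient_at_sqdist].
rewrite subrr l2norm0 expr0n mulr0 subr0 => E.
suff : dotv (G (x + c *: (y - x)) - G x - L *: (x + c *: (y - x) - x)) (y - x) <= 0.
  by rewrite addrAC dotvBl -E; lra.
case/andP: (c01) => c0 c1; rewrite dotvBl subr_le0.
apply: le_trans (dotv_le _ _) _.
rewrite addrKC !dotvZl -l2norm_sqr expr2 !mulrA ler_wpM2r ?l2norm_ge0//.
apply: le_trans (lG _ _ (cA _ _ _ Ax Ay c01) Ax) _.
by rewrite addrKC l2normZ ger0_norm// mulrA.
Qed.

Lemma gradient_feasible_bound u v L x y : segment_closed A ->
  gradient_at A u x v -> (forall z, A z -> `|u z - u x| <= L * l2norm (z - x)) ->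
  A x -> A y -> `|dotv v (y - x)| <= L * l2norm (y - x).
Proof.
move=> cA gu lu Ax Ay.
apply: (@le_of_scaled_error _ _ _ 1) => // e e0 _; rewrite mulr1.
have [d d0 Hd] := gradient_segment cA gu Ax Ay e0.
pose s := Num.min 1 (d / 2).
have s0 : 0 < s by rewrite !lt_min; lra.
have s1 : s <= 1 by rewrite ge_min lexx.
have sd : s < d by rewrite !gt_min; apply/orP; right; lra.
have s01 : 0 <= s <= 1 by rewrite s1 ltW.
have := Hd s s01 sd; have := lu _ (cA _ _ _ Ax Ay s01).
rewrite addrKC l2normZ (gtr0_norm s0).
move=> H H'; apply: (normr_cancel_scale s0); move: H H'.
rewrite !ler_norml; lra.
Qed.

(* At a boundary point [l] of [A] neither [x - y] nor its opposite need be a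
   feasible direction; both are at the nearby points [l + th ((x + y) / 2 - l)]. *)
Lemma gradient_bound u G L M l x y : segment_closed A -> 0 <= M ->
  (forall z, A z -> gradient_at A u z (G z)) ->
  (forall z z', A z -> A z' -> `|u z - u z'| <= L * l2norm (z - z')) ->
  (forall z z', A z -> A z' -> l2norm (G z - G z') <= M * l2norm (z - z')) ->
  A l -> A x -> A y -> `|dotv (G l) (x - y)| <= L * l2norm (x - y).
Proof.
move=> cA M0 gu lu lG Al Ax Ay.
pose c := y + 2^-1 *: (x - y).
have half : 0 <= (2^-1 : R) <= 1 by apply/andP; split; lra.
have Ac : A c by exact: cA.
apply: (@le_of_scaled_error _ _ _ (M * l2norm (c - l) * l2norm (x - y))).
  by rewrite !mulr_ge0 ?l2norm_ge0.
move=> th th0 th1; pose z := l + th *: (c - l).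
have th01 : 0 <= th <= 1 by rewrite th1 ltW.
have Az : A z by exact: cA.
have Azx : A (l + th *: (x - l)) by exact: cA.
have dzx : l + th *: (x - l) - z = (th / 2) *: (x - y).
  rewrite /z /c opprD addrACA subrr add0r -scalerBr opprB addrA subrK opprD addrA.
  rewrite -[X in X - _ *: _]scale1r -scalerBl scalerA; by congr (_ *: _); field.
have := gradient_feasible_bound cA (gu _ Az) (fun z' Az' => lu z' z Az' Az) Az Azx.
rewrite dzx.
have th2 : 0 < th / 2 by lra.
rewrite dotvZr l2normZ normrM gtr0_norm// mulrCA ler_pM2l// => H.
rewrite -[G l](subrK (G z)) dotvDl (le_trans (ler_normD _ _))// addrC lerD//.
rewrite (le_trans (dotv_abs_le _ _))// mulrA ler_wpM2r ?l2norm_ge0//.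
apply: le_trans (lG _ _ Al Az) _.
by rewrite l2norm_distC addrKC l2normZ gtr0_norm// mulrCA.
Qed.

(** Strong convexity at [x + s (y - x)], divided by [s], leaves the factor [1 - s] on the quadratic
    term. With [s <= e] this loss joins the error; the absolute value is there because [mu] has no
    sign. *)
Lemma strongly_convex_lower u v mu x y : segment_closed A ->
  strongly_convex A mu u -> gradient_at A u x v -> A x -> A y ->
  u x + dotv v (y - x) + mu / 2 * l2norm (y - x) ^+ 2 <= u y.
Proof.
move=> cA su gu Ax Ay.
apply: (@le_of_scaled_error _ _ _ (1 + `|mu / 2 * l2norm (y - x) ^+ 2|)).
  by rewrite addr_ge0.
move=> e e0 e1; have [d d0 Hd] := gradient_segment cA gu Ax Ay e0.
pose s := Num.min e (d / 2).
have s0 : 0 < s by rewrite !lt_min; lra.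
have se : s <= e by rewrite ge_min lexx.
have s1 : s <= 1 by lra.
have sd : s < d by rewrite !gt_min; apply/orP; right; lra.
have s01 : 0 <= s <= 1 by rewrite s1 ltW.
have := Hd s s01 sd; have := su y x s Ay Ax s01.
rewrite segment_mid ler_norml => H /andP[H' _].
rewrite -(ler_pM2l s0).
have : s * (s * (mu / 2 * l2norm (y - x) ^+ 2)) <= s * (e * `|mu / 2 * l2norm (y - x) ^+ 2|).
  rewrite ler_pM2l//; apply: le_trans (ler_norm _) _.
  by rewrite normrM gtr0_norm// ler_wpM2r.
move: H H'; set N := l2norm (y - x) ^+ 2; set Z := `|_|; lra.
Qed.

(** Composite optimality condition: [x] is compared with [x + s (y - x)], where [u] is expanded to
    first order and the nonsmooth [h] is only bounded by convexity. *)
Lemma argmin_variational (u h : 'cV[R]_n -> R) v x y : segment_closed A ->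
  (forall a b s, A a -> A b -> 0 <= s <= 1 ->
     h (a + s *: (b - a)) <= h a + s * (h b - h a)) ->
  is_argmin A (fun z => u z + h z) x -> gradient_at A u x v -> A y ->
  0 <= dotv v (y - x) + (h y - h x).
Proof.
move=> cA ch [Ax xmin] gu Ay.
apply: (@le_of_scaled_error _ _ _ 1) => // e e0 e1.
have [d d0 Hd] := gradient_segment cA gu Ax Ay e0.
pose s := Num.min 1 (d / 2).
have s0 : 0 < s by rewrite !lt_min; lra.
have s1 : s <= 1 by rewrite ge_min lexx.
have sd : s < d by rewrite !gt_min; apply/orP; right; lra.
have s01 : 0 <= s <= 1 by rewrite s1 ltW.
have := Hd s s01 sd; have := ch _ _ _ Ax Ay s01; have := xmin _ (cA _ _ _ Ax Ay s01).
rewrite ler_norml => Hx Hh /andP[_ Hu].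
rewrite -(ler_pM2l s0) mulr0; lra.
Qed.

End ScalarValued.

Lemma argminT_gradient n (u : 'cV[R]_n -> R) v x :
  is_argmin setT u x -> gradient_at setT u x v -> v = 0.
Proof.
move=> mx gu; apply: l2norm_eq0; apply/eqP; rewrite -sqrf_eq0 l2norm_sqr.
rewrite eq_le dotv_ge0 andbT.
have mx0 : is_argmin setT (fun z => u z + 0) x.
  by rewrite (_ : (fun z => u z + 0) = u)//; apply/funext => z; rewrite addr0.
have h0 (a b : 'cV[R]_n) s : setT a -> setT b -> 0 <= s <= 1 -> (0 : R) <= 0 + s * (0 - 0).
  by rewrite subrr mulr0 addr0.
(* The test point [x - v] gives [- |v|^2 >= 0]. *)
have := argmin_variational (@segment_closedT n) h0 mx0 gu (I : setT (x - v)).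
by rewrite subrr addr0 addrAC subrr sub0r dotvNr oppr_ge0.
Qed.

Section Contraction.
Context (n : nat) (u : 'cV[R]_n -> R) (G : 'cV[R]_n -> 'cV[R]_n) (mu L : R).
Hypothesis mu_gt0 : 0 < mu.
Hypothesis muL : mu <= L.
Hypothesis gu : forall z, gradient_at setT u z (G z).
Hypothesis lG : forall z z', l2norm (G z - G z') <= L * l2norm (z - z').
Hypothesis su : strongly_convex setT mu u.

Let L0 : 0 <= L. Proof. exact: le_trans (ltW mu_gt0) muL. Qed.

Lemma strongly_monotone x y : mu * l2norm (x - y) ^+ 2 <= dotv (G x - G y) (x - y).
Proof.
have := strongly_convex_lower (@segment_closedT n) su (gu x) (I : setT x) (I : setT y).
have := strongly_convex_lower (@segment_closedT n) su (gu y) (I : setT y) (I : setT x).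
rewrite dotvBl (l2norm_distC y x) -(opprB x y) !dotvNr; lra.
Qed.

(** Cocoercivity of the gradient of [u - mu / 2 |.|^2]. Tangent lower bounds and quadratic upper
    bounds at [y + p] and [x - p] add up to [key], for every [p]; the best choice is
    [p = (D - mu d) / (L - mu)]. For [L = mu] there is no best [p], but then the Lipschitz bound
    makes the right side of [key] nonpositive. *)
Lemma cocoercive x y : l2norm (G x - G y - mu *: (x - y)) ^+ 2 <=
  (L - mu) * (dotv (G x - G y) (x - y) - mu * l2norm (x - y) ^+ 2).
Proof.
set d := x - y; set D := G x - G y.
have key p : 2 * dotv (D - mu *: d) p - (L - mu) * l2norm p ^+ 2 <=
    dotv D d - mu * l2norm d ^+ 2.
  have Tz (z : 'cV[R]_n) : setT z by [].
  have sl a b := strongly_convex_lower (@segment_closedT n) su (gu a) (Tz a) (Tz b).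
  have up a b := @gradient_descent_bound n setT u G L a b (@segment_closedT n) L0
     (fun z _ => gu z) (fun z z' _ _ => lG z z') (Tz a) (Tz b).
  have := le_trans (sl x (y + p)) (up y (y + p)).
  have := le_trans (sl y (x - p)) (up x (x - p)).
  have -> : x - p - y = d - p by rewrite addrAC.
  have -> : y + p - x = p - d by rewrite /d opprB addrA [p + y]addrC.
  rewrite [x - p - x]addrAC subrr sub0r [y + p - y]addrAC subrr add0r l2normN.
  clearbody d.
  rewrite (l2norm_distC d p) /D !l2norm_sqr !(dotvBl, dotvBr, dotvZl, dotvNr) (dotvC p d).
  lra.
have [eL|neL] := eqVneq L mu.
  have := key (D - mu *: d); rewrite eL subrr !mul0r subr0 -l2norm_sqr.
  have : dotv D d <= L * l2norm d ^+ 2.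
    rewrite (le_trans (dotv_le _ _))// expr2 mulrA ler_wpM2r ?l2norm_ge0//; exact: lG.
  rewrite eL; lra.
have Lm : 0 < L - mu by rewrite subr_gt0 lt_def neL.
have := key ((L - mu)^-1 *: (D - mu *: d)).
rewrite dotvZr l2normZ exprMn ger0_norm ?invr_ge0 ?(ltW Lm)// -l2norm_sqr.
set a := l2norm _ ^+ 2 => H.
rewrite -ler_pdivrMl//; apply: le_trans H; rewrite le_eqVlt; apply/orP; left.
by apply/eqP; field; rewrite gt_eqF.
Qed.

(** Cocoercivity weighted by [eta^2] is added to strong monotonicity weighted by
    [eta (2 - eta (L + mu))]. The step bound is exactly what makes the second weight nonnegative. *)
Lemma gradient_step_contraction eta x y : 0 < eta -> eta <= 2 / (L + mu) ->
  l2norm (x - y - eta *: (G x - G y)) <= (1 - eta * mu) * l2norm (x - y).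
Proof.
have mu0 := mu_gt0; have muL' := muL.
move=> eta0; rewrite ler_pdivlMr; last by lra.
move=> etaL.
have em : eta * mu <= 1 by nra.
rewrite -(ler_pXn2r (ltn0Sn 1)) ?nnegrE ?mulr_ge0 ?subr_ge0 ?l2norm_ge0//.
have := cocoercive x y; have := strongly_monotone x y.
move: (x - y) (G x - G y) => d D.
rewrite exprMn !l2norm_sqr !(dotvBl, dotvBr, dotvZl, dotvZr) (dotvC d D).
move: (dotv D d) (dotv D D) (dotv d d) => p q N Hp Hq.
have : 0 <= eta * (2 - eta * (L + mu)) * (p - mu * N).
  by rewrite !mulr_ge0 ?(ltW eta0) ?subr_ge0.
have : eta ^+ 2 * (q - mu * p - mu * (p - mu * N)) <= eta ^+ 2 * ((L - mu) * (p - mu * N)).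
  by rewrite ler_wpM2l ?sqr_ge0.
rewrite !expr2; lra.
Qed.

End Contraction.

(* In dimension 0 every function is strongly convex with every modulus. *)
Lemma strongly_convex_le_lipschitz n (u : 'cV[R]_n -> R) G mu L : (0 < n)%N ->
  (forall z, gradient_at setT u z (G z)) ->
  (forall z z', l2norm (G z - G z') <= L * l2norm (z - z')) ->
  strongly_convex setT mu u -> mu <= L.
Proof.
case: n u G => // n u G _ gu lG su.
pose d : 'cV[R]_n.+1 := delta_mx 0 0.
have dd : l2norm d = 1 by rewrite /l2norm dotv_delta mxE !eqxx sqrtr1.
have := strongly_monotone gu su d 0; have := lG d 0.
rewrite !subr0 dd mulr1 expr1n mulr1 => H1 H2.
by rewrite (le_trans H2)// (le_trans (dotv_le _ _))// dd mulr1.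
Qed.

End Gradients.

(** * Vector-valued maps, symmetry of Hessians, existence of minimisers *)

Section Jacobians.
Context (R : realType).

Lemma opnorm_le_bound m n (M : 'M[R]_(m, n)) a : 0 <= a ->
  (forall v, l2norm (M *m v) <= a * l2norm v) -> opnorm M <= a.
Proof.
move=> a0 H; apply: ge_sup; first by case: (has_sup_opnorm M).
by move=> _ [v /= v1 <-]; rewrite (le_trans (H v))// ler_piMr.
Qed.

Lemma opnorm_tr m n (M : 'M[R]_(m, n)) : opnorm M^T <= opnorm M.
Proof. by apply: opnorm_le_bound; [exact: opnorm_ge0|exact: opnorm_tr_le]. Qed.

Lemma le0_of_quadratic (a c : R) : 0 <= c ->
  (forall s, 0 < s -> s <= 1 -> s * a <= c * s ^+ 2) -> a <= 0.
Proof.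
move=> c0 H; apply: (@le_of_scaled_error _ _ _ c) => // e e0 e1.
by have := H e e0 e1; rewrite expr2 mulrCA ler_pM2l// add0r mulrC.
Qed.

Section VectorValued.
Context (m n : nat) (A : set 'cV[R]_n) (V : 'cV[R]_n -> 'cV[R]_m).
Hypothesis cA : segment_closed A.

(** Pairing with a fixed [p] reduces statements on Jacobians to those on gradients; [l2norm_le_dual]
    then recovers the norm. *)
Lemma jacobian_dual_gradient x J p : jacobian_at A V x J ->
  gradient_at A (fun z => dotv p (V z)) x (J^T *m p).
Proof.
move=> jV e e0; have p0 : 0 < 1 + l2norm p by rewrite ltr_pwDl ?l2norm_ge0.
have [d d0 Hd] := jV (e / (1 + l2norm p)) (divr_gt0 e0 p0).
exists d => // y Ay yx; rewrite -!dotvBr -dotv_trmx -!dotvBr.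
rewrite (le_trans (dotv_abs_le _ _))//.
rewrite (le_trans (ler_wpM2l (l2norm_ge0 p) (Hd _ Ay yx)))// mulrA.
rewrite ler_wpM2r ?l2norm_ge0// mulrCA ler_piMr ?(ltW e0)//.
by rewrite ler_pdivrMr// mul1r lerDr.
Qed.

Lemma jacobian_feasible_bound J L x y : 0 <= L -> jacobian_at A V x J ->
  (forall z, A z -> l2norm (V z - V x) <= L * l2norm (z - x)) ->
  A x -> A y -> l2norm (J *m (y - x)) <= L * l2norm (y - x).
Proof.
move=> L0 jV lV Ax Ay; apply: l2norm_le_dual => [|p].
  by rewrite mulr_ge0 ?l2norm_ge0.
rewrite dotvC dotv_trmx (le_trans (ler_norm _))// mulrAC.
apply: (gradient_feasible_bound cA (jacobian_dual_gradient p jV)) => // z Az.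
rewrite -dotvBr (le_trans (dotv_abs_le _ _))// mulrAC [X in _ <= X]mulrC.
by rewrite ler_wpM2l ?l2norm_ge0// lV.
Qed.

Section Lipschitz_jacobian.
Context (J : 'cV[R]_n -> 'M[R]_(m, n)) (M : R).
Hypothesis jV : forall z, A z -> jacobian_at A V z (J z).
Hypothesis lJ : forall z z', A z -> A z' -> opnorm (J z - J z') <= M * l2norm (z - z').

Let lJp p z z' : A z -> A z' ->
  l2norm ((J z)^T *m p - (J z')^T *m p) <= (M * l2norm p) * l2norm (z - z').
Proof.
move=> Az Az'; rewrite -mulmxBl -linearB/=.
rewrite (le_trans (opnorm_tr_le _ _))// mulrAC ler_wpM2r ?l2norm_ge0// lJ//.
Qed.

Lemma jacobian_remainder x y : A x -> A y -> 0 <= M ->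
  l2norm (V y - V x - J x *m (y - x)) <= M * l2norm (y - x) ^+ 2.
Proof.
move=> Ax Ay M0; apply: l2norm_le_dual => [|p]; first by rewrite mulr_ge0 ?sqr_ge0.
have := gradient_remainder cA (fun z Az => jacobian_dual_gradient p (jV Az)) (lJp p) Ax Ay.
rewrite -dotvBr -dotv_trmx -dotvBr dotvC mulrAC; apply: le_trans; exact: ler_norm.
Qed.

Lemma jacobian_bound L l x y : 0 <= L -> 0 <= M ->
  (forall z z', A z -> A z' -> l2norm (V z - V z') <= L * l2norm (z - z')) ->
  A l -> A x -> A y -> l2norm (J l *m (x - y)) <= L * l2norm (x - y).
Proof.
move=> L0 M0 lV Al Ax Ay; apply: l2norm_le_dual => [|p].
  by rewrite mulr_ge0 ?l2norm_ge0.
rewrite dotvC dotv_trmx (le_trans (ler_norm _))// mulrAC.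
apply: (gradient_bound cA _ (fun z Az => jacobian_dual_gradient p (jV Az)) _ (lJp p)) => //.
  by rewrite mulr_ge0 ?l2norm_ge0.
move=> z z' Az Az'; rewrite -dotvBr (le_trans (dotv_abs_le _ _))// mulrAC.
by rewrite [X in _ <= X]mulrC ler_wpM2l ?l2norm_ge0// lV.
Qed.

End Lipschitz_jacobian.
End VectorValued.

Section Hessian.
Context (n : nat) (u : 'cV[R]_n -> R) (G : 'cV[R]_n -> 'cV[R]_n)
  (H : 'cV[R]_n -> 'M[R]_n) (M : R).
Hypothesis M0 : 0 <= M.
Hypothesis gu : forall z, gradient_at setT u z (G z).
Hypothesis jG : forall z, jacobian_at setT G z (H z).
Hypothesis lH : forall z z', opnorm (H z - H z') <= M * l2norm (z - z').

(** The second difference of [u] over a small parallelogram is [s^2 <H y, x>] up to order [s^3]. The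
    mean value theorem for [z |-> u (z + s y) - u z] leaves a difference of two values of [G], and
    both are expanded at [b], where the terms in [x] cancel. *)
Let mixed b x y : exists2 c, 0 <= c & forall s, 0 < s -> s <= 1 ->
  `|u (b + s *: x + s *: y) - u (b + s *: x) - (u (b + s *: y) - u b)
    - s ^+ 2 * dotv (H b *m y) x| <= c * s ^+ 3.
Proof.
exists (M * ((l2norm x + l2norm y) ^+ 2 + l2norm x ^+ 2) * l2norm x).
  by rewrite !mulr_ge0 ?addr_ge0 ?sqr_ge0 ?l2norm_ge0.
move=> s s0 s1.
pose psi z := u (z + s *: y) - u z.
have gpsi z : setT z -> gradient_at setT psi z (G (z + s *: y) - G z).
  move=> _; apply: gradient_at_sub => // e e0.
  have [d d0 Hd] := gu (z + s *: y) e0; exists d => // z' _ zz'.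
  have E : z' + s *: y - (z + s *: y) = z' - z by rewrite opprD addrACA subrr addr0.
  by have := Hd (z' + s *: y) I; rewrite E; exact.
have [c /andP[c0 c1]] := gradient_MVT (@segment_closedT R n) gpsi (I : setT b) (I : setT (b + s *: x)).
rewrite addrKC /psi => ->.
rewrite scalerA dotvZr expr2 -mulrA -mulrBr normrM gtr0_norm//.
have -> : c * s = s * c by rewrite mulrC.
have R1 z : l2norm (G (b + s *: z) - G b - s *: (H b *m z)) <= M * (s * l2norm z) ^+ 2.
  have := jacobian_remainder (@segment_closedT R n) (fun z _ => jG z)
    (fun z z' _ _ => lH z z') (I : setT b) (I : setT (b + s *: z)) M0.
  by rewrite addrKC -scalemxAr l2normZ gtr0_norm.
have := R1 (c *: x + y); have := R1 (c *: x).
rewrite !mulmxDr -!scalemxAr !scalerDr !scalerA addrA.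
set P := G (b + (s * c) *: x + s *: y); set Q := G (b + (s * c) *: x).
set W := (s * c) *: (H b *m x) => HQ HP.
have PQ : P - Q - s *: (H b *m y) = (P - G b - (W + s *: (H b *m y))) - (Q - G b - W).
  by rewrite !opprD !opprK; apply/matrixP => i j; rewrite !mxE; ring.
have cx : l2norm (c *: x) <= l2norm x.
  by rewrite l2normZ ger0_norm// ler_piMl ?l2norm_ge0.
have N : l2norm (P - Q - s *: (H b *m y)) <=
    M * ((l2norm x + l2norm y) ^+ 2 + l2norm x ^+ 2) * s ^+ 2.
  rewrite PQ (le_trans (ler_l2normB _ _))// (le_trans (lerD HP HQ))//.
  rewrite -mulrDr -mulrA ler_wpM2l// !exprMn -mulrDr mulrC ler_wpM2r ?sqr_ge0//.
  rewrite lerD// ler_pXn2r ?nnegrE ?addr_ge0 ?l2norm_ge0//.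
  by rewrite (le_trans (ler_l2normD _ _))// lerD2r.
rewrite -dotvZl -dotvBl.
have -> : s ^+ 3 = s * s ^+ 2 by rewrite exprS.
rewrite [X in _ <= X]mulrCA ler_pM2l// mulrAC.
rewrite (le_trans (dotv_abs_le _ _))// ler_wpM2r ?l2norm_ge0//.
Qed.

(** The second difference does not change when [x] and [y] are exchanged, so dividing the two
    expansions by [s^2] leaves an error of order [s]. *)
Lemma hessian_symmetric b x y : dotv (H b *m y) x = dotv (H b *m x) y.
Proof.
apply/eqP; rewrite -subr_eq0 -normr_le0.
have [c c0 Hc] := mixed b x y; have [c' c'0 Hc'] := mixed b y x.
apply: (@le0_of_quadratic _ (c + c')); first exact: addr_ge0.
move=> s s0 s1; have := Hc s s0 s1; have := Hc' s s0 s1.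
rewrite [b + s *: y + s *: x]addrAC; set U := u (b + s *: x + s *: y).
set Ux := u (b + s *: x); set Uy := u (b + s *: y).
set a := dotv _ x; set a' := dotv _ y => h h'.
have hh : `|s ^+ 2 * (a - a')| <= s * ((c + c') * s ^+ 2).
  have -> : s * ((c + c') * s ^+ 2) = c * s ^+ 3 + c' * s ^+ 3 by ring.
  by move: h h'; rewrite !ler_norml mulrBr; lra.
by rewrite -(ler_pM2l s0) mulrA -expr2 -[X in X * _]ger0_norm ?sqr_ge0// -normrM.
Qed.

End Hessian.

Lemma argmin_of_critical n (u : 'cV[R]_n -> R) mu x : 0 <= mu ->
  strongly_convex setT mu u -> gradient_at setT u x 0 -> is_argmin setT u x.
Proof.
move=> mu0 su gu; split=> // y _.
have := strongly_convex_lower (@segment_closedT R n) su gu (I : setT x) (I : setT y).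
rewrite dotv0l addr0; apply: le_trans; rewrite lerDl mulr_ge0 ?sqr_ge0//; lra.
Qed.

(* The gradient iteration [x - G x / L] is a contraction whose limit is critical. *)
Lemma strongly_convex_argmin n (u : 'cV[R]_n -> R) (G : 'cV[R]_n -> 'cV[R]_n) mu L :
  0 < mu -> mu <= L -> (forall z, gradient_at setT u z (G z)) ->
  (forall z z', l2norm (G z - G z') <= L * l2norm (z - z')) ->
  strongly_convex setT mu u -> exists x, is_argmin setT u x.
Proof.
move=> mu0 muL gu lG su.
have L0 : 0 < L by exact: lt_le_trans muL.
pose W z := z - L^-1 *: G z.
pose q := 1 - L^-1 * mu.
have q0 : 0 <= q by rewrite subr_ge0 mulrC ler_pdivrMr// mul1r.
have q1 : q < 1 by rewrite ltrBlDr ltrDl mulr_gt0// invr_gt0.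
have cW y z : l2norm (W y - W z) <= q * l2norm (y - z).
  have := @gradient_step_contraction R n u G mu L mu0 muL gu lG su L^-1 y z.
  have -> : W y - W z = y - z - L^-1 *: (G y - G z).
    by apply/matrixP => i j; rewrite !mxE; ring.
  apply; first by rewrite invr_gt0.
  rewrite ler_pdivlMr ?addr_gt0// mulrDr mulVf ?gt_eqF//.
  have : L^-1 * mu <= 1 by rewrite mulrC ler_pdivrMr// mul1r.
  lra.
pose x k := iter k W 0.
pose c := l2norm (x 1%N - x 0%N).
have dx k : l2norm (x k.+1 - x k) <= c * q ^+ k.
  elim: k => [|k IH]; first by rewrite expr0 mulr1.
  by rewrite exprS mulrCA (le_trans (cW _ _))// ler_wpM2l.
(* Each coordinate is a telescoping series dominated by a geometric one, so completeness of the
   reals suffices. *)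
have cvgx i : cvgn (fun k => x k i 0).
  have -> : (fun k => x k i 0) = (fun k => series (fun k => (x k.+1 - x k) i 0) k + x 0%N i 0).
    apply/funext => k; rewrite /series/=.
    under eq_bigr do rewrite mxE [X in _ + X]mxE.
    by rewrite telescope_sumr// subrK.
  apply: is_cvgD; last exact: is_cvg_cst.
  apply: normed_cvg; apply: (@series_le_cvg _ _ (geometric c q)) => [k|k|k|].
  - by rewrite normr_ge0.
  - by rewrite /geometric/= mulr_ge0 ?exprn_ge0// l2norm_ge0.
  - exact: le_trans (normr_coord_le _ _) (dx k).
  - by apply: is_cvg_geometric_series; rewrite ger0_norm.
pose xs : 'cV[R]_n := \col_i limn (fun k => x k i 0).
have xs_lim e : 0 < e -> exists k, l2norm (x k - xs) <= e /\ l2norm (x k.+1 - x k) <= e.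
  move=> e0.
  have H1 : \forall k \near \oo, forall i, `|xs i 0 - x k i 0| <= e / (1 + n%:R).
    apply: filter_forall => i.
    have /cvgrPdist_le := cvgx i; rewrite mxE; apply.
    by rewrite divr_gt0// ltr_pwDl.
  have H2 : \forall k \near \oo, c * q ^+ k <= e.
    have := @cvg_geometric R c q; rewrite ger0_norm// => /(_ q1)/cvgrPdist_le/(_ _ e0).
    apply: filterS => k; rewrite sub0r normrN; apply: le_trans; exact: ler_norm.
  near \oo => k; exists k; split; last first.
    by rewrite (le_trans (dx k))//; near: k.
  rewrite l2norm_distC (le_trans (l2norm_le_sum _))//.
  apply: (@le_trans _ _ (\sum_(i < n) (e / (1 + n%:R)))).
    apply: ler_sum => i _; rewrite mxE [X in _ + X]mxE.
    by move: (i); near: k.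
  rewrite sumr_const card_ord -[X in X <= _]mulr_natr mulrAC ler_pdivrMr ?ltr_pwDl//.
  by rewrite ler_wpM2l ?(ltW e0)// lerDr.
have Wxs : W xs = xs.
  apply/eqP; rewrite -subr_eq0; apply/eqP/l2norm_eq0/eqP.
  rewrite eq_le l2norm_ge0 andbT.
  apply: (@le_of_scaled_error _ _ _ 3) => // e e0 _; rewrite add0r.
  have [k [Hk Hk']] := xs_lim e e0.
  rewrite (le_trans (l2norm_triangle (W (x k)) _ _))//.
  have h1 : l2norm (W xs - W (x k)) <= e.
    rewrite (le_trans (cW _ _))// l2norm_distC (le_trans _ Hk)//.
    by rewrite ler_piMl ?l2norm_ge0// ltW.
  have h2 := l2norm_triangle (x k) (W (x k)) xs.
  rewrite -[W (x k)]/(x k.+1) in h1 h2 *; lra.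
exists xs; apply: argmin_of_critical (ltW mu0) su _.
suff <- : G xs = 0 by [].
move/eqP: Wxs; rewrite -subr_eq0 addrKC oppr_eq0 scaler_eq0 invr_eq0 gt_eqF//= => /eqP.
by [].
Unshelve. all: by end_near.
Qed.

End Jacobians.

(** * Bilevel sensitivity *)

Section Joint.
Context (R : realType) (d1 d2 : nat) (X : set 'cV[R]_d1).
Hypothesis cX : segment_closed X.
Implicit Types (l x y : 'cV[R]_d1) (b : 'cV[R]_d2).

Let joint : set 'cV[R]_(d1 + d2) := [set z | X (usubmx z)].

Lemma segment_closed_joint : segment_closed joint.
Proof.
move=> z z' a Xz Xz' a01.
by rewrite /joint/= !(linearD, linearN, linearZ)/=; exact: cX.
Qed.

Lemma col_mxB l l' b b' : col_mx l' b' - col_mx l b = col_mx (l' - l) (b' - b).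
Proof. by rewrite opp_col_mx add_col_mx. Qed.

Section FirstOrder.
Context (u : 'cV[R]_d1 -> 'cV[R]_d2 -> R) (ul : 'cV[R]_d1 -> 'cV[R]_d2 -> 'cV[R]_d1)
  (ub : 'cV[R]_d1 -> 'cV[R]_d2 -> 'cV[R]_d2) (L : R).
Hypothesis gu : is_gradient X u ul ub.
Hypothesis lG : lipschitz_joint X (@l2norm R (d1 + d2)) L (fun l b => col_mx (ul l b) (ub l b)).

Let uj z := u (usubmx z) (dsubmx z).
Let Gj z := col_mx (ul (usubmx z) (dsubmx z)) (ub (usubmx z) (dsubmx z)).

Let gj z : joint z -> gradient_at joint uj z (Gj z).
Proof. by move=> Xz; have := gu (dsubmx z) Xz; rewrite vsubmxK. Qed.

Let lGj z z' : joint z -> joint z' -> l2norm (Gj z - Gj z') <= L * l2norm (z - z').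
Proof.
move=> Xz Xz'; have := lG (dsubmx z) (dsubmx z') Xz Xz'.
by rewrite -col_mxB !vsubmxK.
Qed.

Let jointE l b : X l -> joint (col_mx l b).
Proof. by move=> Xl; rewrite /joint/= col_mxKu. Qed.

Lemma joint_remainder l l' b b' : X l -> X l' ->
  `|u l' b' - u l b - dotv (ul l b) (l' - l) - dotv (ub l b) (b' - b)|
    <= L * l2norm (col_mx (l' - l) (b' - b)) ^+ 2.
Proof.
move=> Xl Xl'.
have := gradient_remainder segment_closed_joint gj lGj (jointE b Xl) (jointE b' Xl').
by rewrite /uj /Gj !col_mxKu !col_mxKd col_mxB dotv_col_mx opprD addrA.
Qed.

Lemma partial_gradient l b : X l -> gradient_at setT (u l) b (ub l b).
Proof.
move=> Xl e e0; have [d d0 Hd] := gu b Xl e0; exists d => // b' _ bb'.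
have := Hd (col_mx l b') (jointE b' Xl).
rewrite !col_mxKu !col_mxKd col_mxB subrr dotv_col_mx dotv0r add0r l2norm_col_0mx.
exact.
Qed.

Lemma partial_gradient_lipschitz l l' b b' : X l -> X l' ->
  l2norm (ub l b - ub l' b') <= L * l2norm (col_mx (l - l') (b - b')).
Proof.
move=> Xl Xl'; apply: le_trans (lG _ _ Xl Xl').
by rewrite col_mxB l2norm_col_mx_d.
Qed.

Lemma partial_gradient_lipschitz_l l l' b b' : X l -> X l' ->
  l2norm (ul l b - ul l' b') <= L * l2norm (col_mx (l - l') (b - b')).
Proof.
move=> Xl Xl'; apply: le_trans (lG _ _ Xl Xl').
by rewrite col_mxB l2norm_col_mx_u.
Qed.

Lemma partial_gradient_lipschitz_b l b b' : X l ->
  l2norm (ub l b - ub l b') <= L * l2norm (b - b').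
Proof.
move=> Xl; apply: le_trans (partial_gradient_lipschitz _ _ Xl Xl) _.
by rewrite subrr l2norm_col_0mx.
Qed.

Lemma outer_gradient_bound L0 l x y b : 0 <= L ->
  lipschitz_joint X (fun x : R => `|x|) L0 u -> X l -> X x -> X y ->
  `|dotv (ul l b) (x - y)| <= L0 * l2norm (x - y).
Proof.
move=> L_ge0 lu Xl Xx Xy.
have := @gradient_bound R _ joint uj Gj L0 L (col_mx l b) (col_mx x b) (col_mx y b)
  segment_closed_joint L_ge0 gj _ lGj (jointE b Xl) (jointE b Xx) (jointE b Xy).
rewrite /Gj col_mxKu col_mxKd col_mxB subrr dotv_col_mx dotv0r addr0 l2norm_col_mx0.
apply=> z z' Xz Xz'; have := lu _ _ (dsubmx z) (dsubmx z') Xz Xz'.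
by rewrite -col_mxB !vsubmxK.
Qed.

Lemma inner_gradient_bound L0 l b : 0 <= L0 ->
  lipschitz_joint X (fun x : R => `|x|) L0 u -> X l -> l2norm (ub l b) <= L0.
Proof.
move=> L_ge0 lu Xl; apply: l2norm_le_dual => // v.
have := @gradient_feasible_bound R _ setT (u l) (ub l b) L0 b (b + v)
  (@segment_closedT R d2) (partial_gradient b Xl) _ I I.
rewrite addrKC => H; rewrite (le_trans (ler_norm _))//; apply: H => z _.
by have := lu _ _ z b Xl Xl; rewrite subrr l2norm_col_0mx.
Qed.

End FirstOrder.

Section Inner.
Context (g : 'cV[R]_d1 -> 'cV[R]_d2 -> R) (gl : 'cV[R]_d1 -> 'cV[R]_d2 -> 'cV[R]_d1)
  (gb : 'cV[R]_d1 -> 'cV[R]_d2 -> 'cV[R]_d2)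
  (glb : 'cV[R]_d1 -> 'cV[R]_d2 -> 'M[R]_(d1, d2))
  (gbb : 'cV[R]_d1 -> 'cV[R]_d2 -> 'M[R]_d2) (L M mu : R).
Hypothesis L_gt0 : 0 < L.
Hypothesis M_ge0 : 0 <= M.
Hypothesis sg : smooth_inner X L M g gl gb glb gbb.

Let gg : is_gradient X g gl gb. Proof. by case: sg. Qed.
Let hg : is_hessian X gb glb gbb. Proof. by case: sg. Qed.
Let lg : lipschitz_joint X (@l2norm R (d1 + d2)) L (fun l b => col_mx (gl l b) (gb l b)).
Proof. by case: sg. Qed.
Let lgj l l' b b' : X l -> X l' ->
  l2norm (gb l b - gb l' b') <= L * l2norm (col_mx (l - l') (b - b')).
Proof. exact: (partial_gradient_lipschitz (ul := gl) (ub := gb) lg). Qed.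
Let lgb l b b' : X l -> l2norm (gb l b - gb l b') <= L * l2norm (b - b').
Proof. exact: (partial_gradient_lipschitz_b (ul := gl) (ub := gb) lg). Qed.
Let llb : lipschitz_joint X (@opnorm R d1 d2) M glb. Proof. by case: sg. Qed.
Let lbb : lipschitz_joint X (@opnorm R d2 d2) M gbb. Proof. by case: sg. Qed.

Let lbb_b l b b' : X l -> opnorm (gbb l b - gbb l b') <= M * l2norm (b - b').
Proof. by move=> Xl; have := lbb b b' Xl Xl; rewrite subrr l2norm_col_0mx. Qed.

Let llb_l l l' b : X l -> X l' -> opnorm ((glb l b)^T - (glb l' b)^T) <= M * l2norm (l - l').
Proof.
move=> Xl Xl'; rewrite -linearB/= (le_trans (opnorm_tr _))//.
by have := llb b b Xl Xl'; rewrite subrr l2norm_col_mx0.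
Qed.

Lemma cross_remainder l l' b : X l -> X l' ->
  l2norm (gb l' b - gb l b - (glb l b)^T *m (l' - l)) <= M * l2norm (l' - l) ^+ 2.
Proof.
move=> Xl Xl'.
exact: (jacobian_remainder cX (fun z Xz => (hg b Xz).1)
  (fun z z' Xz Xz' => llb_l b Xz Xz') Xl Xl' M_ge0).
Qed.

Lemma hessian_remainder l b b' : X l ->
  l2norm (gb l b' - gb l b - gbb l b *m (b' - b)) <= M * l2norm (b' - b) ^+ 2.
Proof.
move=> Xl.
exact: (jacobian_remainder (@segment_closedT R d2) (fun z _ => (hg z Xl).2)
  (fun z z' _ _ => lbb_b z z' Xl) I I M_ge0).
Qed.

Lemma cross_bound l x y b : X l -> X x -> X y ->
  l2norm ((glb l b)^T *m (x - y)) <= L * l2norm (x - y).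
Proof.
move=> Xl Xx Xy.
apply: (jacobian_bound cX (fun z Xz => (hg b Xz).1)
  (fun z z' Xz Xz' => llb_l b Xz Xz') (ltW L_gt0) M_ge0) => // z z' Xz Xz'.
rewrite (le_trans (lgj b b Xz Xz'))//.
by rewrite subrr l2norm_col_mx0.
Qed.

Lemma hessian_sym l b : X l -> (gbb l b)^T = gbb l b.
Proof.
move=> Xl; apply/matrixP => i j; rewrite mxE.
have := @hessian_symmetric R d2 (g l) (gb l) (gbb l) M M_ge0
  (fun z => partial_gradient gg z Xl) (fun z => (hg z Xl).2)
  (fun z z' => lbb_b z z' Xl) b (delta_mx j 0) (delta_mx i 0).
by rewrite !dotv_delta -!colE !mxE.
Qed.

Hypothesis mu_gt0 : 0 < mu.
Hypothesis muL : mu <= L.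

Lemma inner_contraction l b b' eta : strongly_convex setT mu (g l) -> X l ->
  0 < eta -> eta <= 2 / (L + mu) ->
  l2norm (b - b' - eta *: (gb l b - gb l b')) <= (1 - eta * mu) * l2norm (b - b').
Proof.
move=> scg Xl; apply: (gradient_step_contraction mu_gt0 muL
  (fun z => partial_gradient gg z Xl)) => //.
move=> z z'; exact: lgb.
Qed.

Lemma inv_smoothness_le : L^-1 <= 2 / (L + mu).
Proof.
have mu0 := mu_gt0; have L0 := L_gt0; have muL' := muL.
rewrite ler_pdivlMr ?addr_gt0// mulrDr mulVf ?gt_eqF//.
have : L^-1 * mu <= 1 by rewrite mulrC ler_pdivrMr// mul1r.
lra.
Qed.

(** The matrix is the Jacobian of the gradient step of length [1 / L], which contracts by
    [1 - mu / L]; a Lipschitz constant of a map bounds its Jacobian. *)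
Lemma neumann_factor_bound l b d : strongly_convex setT mu (g l) -> X l ->
  l2norm ((1%:M - L^-1 *: gbb l b) *m d) <= (1 - mu / L) * l2norm d.
Proof.
move=> scg Xl.
have q0 : 0 <= 1 - mu / L by rewrite subr_ge0 ler_pdivrMr// mul1r.
have jW : jacobian_at setT (fun b => b - L^-1 *: gb l b) b (1%:M - L^-1 *: gbb l b).
  move=> e e0; have Le : 0 < L * e by rewrite mulr_gt0.
  have [r r0 Hr] := (hg b Xl).2 _ Le; exists r => // y _ yb.
  rewrite (_ : _ - _ = (- L^-1) *: (gb l y - gb l b - gbb l b *m (y - b))).
    rewrite l2normZ normrN gtr0_norm ?invr_gt0//.
    by rewrite -(ler_pM2l L_gt0) !mulrA mulfV ?gt_eqF// mul1r Hr.
  rewrite mulmxBl mul1mx -scalemxAl.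
  by apply/matrixP => i j; rewrite !mxE; ring.
have := jacobian_feasible_bound (@segment_closedT R d2) q0 jW _ (I : setT b) (I : setT (b + d)).
rewrite addrKC; apply => z _.
rewrite (_ : _ - _ = z - b - L^-1 *: (gb l z - gb l b)).
  by rewrite [mu / L]mulrC inner_contraction// ?invr_gt0// inv_smoothness_le.
by apply/matrixP => i j; rewrite !mxE; ring.
Qed.

(** Triangle inequality for [d = (1 - H / L) d + H d / L], where the first term has length at most
    [(1 - mu / L) |d|]. *)
Lemma hessian_lower_bound l b d : strongly_convex setT mu (g l) -> X l ->
  mu * l2norm d <= l2norm (gbb l b *m d).
Proof.
move=> scg Xl; have := neumann_factor_bound b d scg Xl.
have := ler_l2normD ((1%:M - L^-1 *: gbb l b) *m d) (L^-1 *: (gbb l b *m d)).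
have {1}-> : (1%:M - L^-1 *: gbb l b) *m d + L^-1 *: (gbb l b *m d) = d.
  by rewrite mulmxBl mul1mx -scalemxAl subrK.
rewrite l2normZ gtr0_norm ?invr_gt0// => H1 H2.
have H3 := le_trans H1 (lerD H2 (lexx _)).
have : mu / L * l2norm d <= L^-1 * l2norm (gbb l b *m d) by lra.
by rewrite mulrAC mulrC ler_pM2l ?invr_gt0.
Qed.

Lemma hessian_unit l b : strongly_convex setT mu (g l) -> X l -> gbb l b \in unitmx.
Proof.
move=> scg Xl; rewrite -unitmx_tr -row_free_unit; apply: inj_row_free => v Hv.
have Hv0 : gbb l b *m v^T = 0 by rewrite -[gbb l b]trmxK -trmx_mul Hv trmx0.
apply: trmx_inj; rewrite trmx0; apply: l2norm_eq0; apply/eqP.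
have := hessian_lower_bound b v^T scg Xl; rewrite Hv0 l2norm0.
by rewrite pmulr_rle0// eq_le l2norm_ge0 andbT.
Qed.

End Inner.
End Joint.

(** * Implicit differentiation and truncated Neumann series *)

Section Bilevel.
Context (R : realType) (d1 d2 : nat) (X : set 'cV[R]_d1).
Hypothesis cX : segment_closed X.
Context (f : 'cV[R]_d1 -> 'cV[R]_d2 -> R) (fl : 'cV[R]_d1 -> 'cV[R]_d2 -> 'cV[R]_d1)
  (fb : 'cV[R]_d1 -> 'cV[R]_d2 -> 'cV[R]_d2)
  (g : 'cV[R]_d1 -> 'cV[R]_d2 -> R) (gl : 'cV[R]_d1 -> 'cV[R]_d2 -> 'cV[R]_d1)
  (gb : 'cV[R]_d1 -> 'cV[R]_d2 -> 'cV[R]_d2)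
  (glb : 'cV[R]_d1 -> 'cV[R]_d2 -> 'M[R]_(d1, d2))
  (gbb : 'cV[R]_d1 -> 'cV[R]_d2 -> 'M[R]_d2) (lf0 lf1 L M mu : R)
  (bh : 'cV[R]_d1 -> 'cV[R]_d2).
Hypothesis lf0_ge0 : 0 <= lf0.
Hypothesis lf1_ge0 : 0 <= lf1.
Hypothesis L_gt0 : 0 < L.
Hypothesis M_ge0 : 0 <= M.
Hypothesis mu_gt0 : 0 < mu.
Hypothesis muL : mu <= L.
Hypothesis sf : smooth_outer X lf0 lf1 f fl fb.
Hypothesis sg : smooth_inner X L M g gl gb glb gbb.
Hypothesis scg : forall l, X l -> strongly_convex setT mu (g l).
Hypothesis bh_critical : forall l, X l -> gb l (bh l) = 0.

Let gg : is_gradient X g gl gb. Proof. by case: sg. Qed.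
Let gf : is_gradient X f fl fb. Proof. by case: sf. Qed.
Let lipf : lipschitz_joint X (fun x : R => `|x|) lf0 f. Proof. by case: sf. Qed.
Let lgf : lipschitz_joint X (@l2norm R (d1 + d2)) lf1 (fun l b => col_mx (fl l b) (fb l b)).
Proof. by case: sf. Qed.
Let lgj l l' b b' : X l -> X l' ->
  l2norm (gb l b - gb l' b') <= L * l2norm (col_mx (l - l') (b - b')).
Proof. by case: sg => _ _ H _ _; exact: (partial_gradient_lipschitz (ul := gl) (ub := gb) H). Qed.
Let lgb l b b' : X l -> l2norm (gb l b - gb l b') <= L * l2norm (b - b').
Proof. by move=> Xl; have := lgj b b' Xl Xl; rewrite subrr l2norm_col_0mx. Qed.
Let llb l b b' : X l -> opnorm (glb l b - glb l b') <= M * l2norm (b - b').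
Proof.
by case: sg => _ _ _ H _ Xl; have := H _ _ b b' Xl Xl; rewrite subrr l2norm_col_0mx.
Qed.
Let lbb l l' b b' : X l -> X l' ->
  opnorm (gbb l b - gbb l' b') <= M * l2norm (col_mx (l - l') (b - b')).
Proof. by case: sg => _ _ _ _ H; exact: H. Qed.

Local Notation kg := (L / mu).

Let kg_ge0 : 0 <= kg. Proof. by rewrite divr_ge0 ?ltW. Qed.

(** Strong monotonicity of [gb l] at the two minimisers. As [gb l (bh l)] and [gb l' (bh l')] both
    vanish, one may replace the other, which leaves a pure variation in [l]. *)
Lemma betahat_lipschitz l l' : X l -> X l' ->
  l2norm (bh l - bh l') <= kg * l2norm (l - l').
Proof.
move=> Xl Xl'; have [d0|dn0] := eqVneq (l2norm (bh l - bh l')) 0.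
  by rewrite d0 mulr_ge0 ?l2norm_ge0.
have dgt0 : 0 < l2norm (bh l - bh l') by rewrite lt_def dn0 l2norm_ge0.
have := @strongly_monotone R d2 (g l) (gb l) mu (fun z => partial_gradient gg z Xl)
  (scg Xl) (bh l) (bh l').
rewrite (bh_critical Xl) -[X in dotv (X - _)](bh_critical Xl').
move=> /le_trans /(_ (dotv_le _ _)).
rewrite expr2 mulrA ler_pM2r// => H.
rewrite mulrAC ler_pdivlMr// mulrC (le_trans H)//.
by have := lgj (bh l') (bh l') Xl' Xl; rewrite subrr l2norm_col_mx0 (l2norm_distC l').
Qed.

(** The linearised equation for the derivative of [bh], with a quadratic error and without
    differentiating [bh]. The summands [kg ^+ 2], [kg] and [1] come from the remainder in [b], the
    change of the Hessian with [l], and the remainder in [l]. *)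
Lemma betahat_remainder l y : X l -> X y ->
  l2norm (gbb l (bh l) *m (bh y - bh l) + (glb l (bh l))^T *m (y - l))
    <= M * (kg ^+ 2 + kg + 1) * l2norm (y - l) ^+ 2.
Proof.
move=> Xl Xy; set d := bh y - bh l; set z := y - l; set b := bh l.
have -> : gbb l b *m d + (glb l b)^T *m z =
    - ((gb y (bh y) - gb y b - gbb y b *m d) + (gbb y b - gbb l b) *m d
       + (gb y b - gb l b - (glb l b)^T *m z)).
  rewrite (bh_critical Xl) (bh_critical Xy) mulmxBl.
  by apply/matrixP => i j; rewrite !mxE; ring.
rewrite l2normN (le_trans (ler_l2normD _ _))//.
have dz : l2norm d <= kg * l2norm z := betahat_lipschitz Xy Xl.
have h1 : l2norm (gb y (bh y) - gb y b - gbb y b *m d) <= M * (kg * l2norm z) ^+ 2.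
  rewrite (le_trans (hessian_remainder M_ge0 sg _ _ Xy))// ler_wpM2l//.
  exact: l2norm_sqr_le.
have h2 : l2norm ((gbb y b - gbb l b) *m d) <= M * l2norm z * (kg * l2norm z).
  rewrite (le_trans (opnorm_le _ _))// ler_pM ?opnorm_ge0 ?l2norm_ge0//.
  by have := lbb b b Xy Xl; rewrite subrr l2norm_col_mx0.
have h3 := cross_remainder cX M_ge0 sg b Xl Xy.
have := ler_l2normD (gb y (bh y) - gb y b - gbb y b *m d) ((gbb y b - gbb l b) *m d).
move: h1 h2 h3; rewrite -/z; lra.
Qed.

Lemma gradient_at_quadratic n (A : set 'cV[R]_n) u x v c : 0 <= c ->
  (forall y, A y -> `|u y - u x - dotv v (y - x)| <= c * l2norm (y - x) ^+ 2) ->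
  gradient_at A u x v.
Proof.
move=> c0 H e e0; exists (e / (1 + c)) => [|y Ay yx]; first by rewrite divr_gt0// ltr_pwDl.
rewrite (le_trans (H y Ay))// expr2 mulrA ler_wpM2r ?l2norm_ge0//.
by move: yx; rewrite ltr_pdivlMr ?ltr_pwDl//; have := l2norm_ge0 (y - x); nra.
Qed.

(** The implicit-function formula: [- H^-1 glb^T] stands for the derivative of [bh], with [H] the
    inner Hessian. *)
Definition hypergradient l : 'cV[R]_d1 :=
  fl l (bh l) - glb l (bh l) *m (invmx (gbb l (bh l)) *m fb l (bh l)).

Let F l := f l (bh l).

Lemma hypergradientP l : X l -> gradient_at X F l (hypergradient l).
Proof.
move=> Xl; set b := bh l; set H := gbb l b; set p := invmx H *m fb l b.
have uH : H \in unitmx := hessian_unit L_gt0 sg mu_gt0 muL b (scg Xl) Xl.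
have Hp : H *m p = fb l b by rewrite mulmxA mulmxV// mul1mx.
apply: (@gradient_at_quadratic _ _ _ _ _
    (lf1 * (1 + kg ^+ 2) + l2norm p * (M * (kg ^+ 2 + kg + 1)))).
  have k2 := sqr_ge0 kg; have k1 := kg_ge0; have M1 := M_ge0; have l1 := lf1_ge0.
  apply: addr_ge0; first by apply: mulr_ge0 => //; lra.
  by apply: mulr_ge0; [exact: l2norm_ge0|apply: mulr_ge0 => //; lra].
move=> y Xy; set z := y - l; set d := bh y - b.
have dz : l2norm d <= kg * l2norm z := betahat_lipschitz Xy Xl.
(* The adjoint vector [p = H^-1 fb] turns [<fb, d>] into [<p, H d>], so [d] enters only through the
   combination that [betahat_remainder] bounds. *)
have E : F y - F l - dotv (hypergradient l) z =
    (f y (bh y) - f l b - dotv (fl l b) z - dotv (fb l b) d)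
    + dotv p (H *m d + (glb l b)^T *m z).
  rewrite /hypergradient -/b -/H -/p dotvBl (dotvDr (H *m d)) (dotv_trmxl (glb l b)) (dotv_trmx H).
  by rewrite [H^T](hessian_sym M_ge0 sg b Xl) -/H Hp /F -/b; ring.
rewrite E (le_trans (ler_normD _ _))// [X in _ <= X]mulrDl lerD//.
  rewrite (le_trans (joint_remainder cX gf lgf _ _ Xl Xy))// -mulrA ler_wpM2l//.
  rewrite l2norm_col_mx_sqr mulrDl mul1r lerD2l -exprMn.
  exact: l2norm_sqr_le.
rewrite (le_trans (dotv_abs_le _ _))// -mulrA ler_wpM2l ?l2norm_ge0//.
exact: betahat_remainder.
Qed.

(** [grad_on] chooses some relative gradient, so agreement is claimed only on differences of points
    of [X]; each is a difference of two feasible directions at [l]. *)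
Lemma grad_on_hypergradient l x y : X l -> X x -> X y ->
  dotv (grad_on X F l) (x - y) = dotv (hypergradient l) (x - y).
Proof.
move=> Xl Xx Xy.
have gG : gradient_at X F l (grad_on X F l).
  by apply: (@getPex _ [set v | gradient_at X F l v]); exists (hypergradient l); exact: hypergradientP.
have -> : x - y = (x - l) - (y - l) by rewrite opprB addrA subrK.
by rewrite !(dotvBr _ (y - l)) !(gradient_unique cX Xl _ gG (hypergradientP Xl)).
Qed.

Section Neumann.
Context (l : 'cV[R]_d1) (b : 'cV[R]_d2).
Hypothesis Xl : X l.

Let H := gbb l b.
Let Rf := 1%:M - L^-1 *: H.
Let q := 1 - mu / L.

Let q_ge0 : 0 <= q. Proof. by rewrite subr_ge0 ler_pdivrMr// mul1r. Qed.

Lemma neumann_power_bound k v : l2norm (Rf ^+ k *m v) <= q ^+ k * l2norm v.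
Proof.
elim: k v => [|k IH] v; first by rewrite !expr0 mul1mx mul1r.
rewrite exprS -mulmxA (le_trans (neumann_factor_bound L_gt0 sg mu_gt0 muL b _ (scg Xl) Xl))//.
by rewrite exprS -mulrA ler_wpM2l.
Qed.

Lemma neumann_sum k : H *m (L^-1 *: \sum_(i < k) Rf ^+ i) = 1%:M - Rf ^+ k.
Proof.
have -> : 1%:M - Rf ^+ k = - (Rf ^+ k - 1) by rewrite opprB.
rewrite subrX1 -mulNr -scalemxAr scalemxAl; congr (_ *m _).
by rewrite opprB -[1]/(1%:M : 'M[R]_d2) /Rf opprB addrCA subrr addr0.
Qed.

Let w (v : 'cV[R]_d1) := invmx H *m ((glb l b)^T *m v).

Let Hw v : H *m w v = (glb l b)^T *m v.
Proof.
by rewrite mulmxA mulmxV ?mul1mx//; exact: (hessian_unit L_gt0 sg mu_gt0 muL b (scg Xl) Xl).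
Qed.

(** With [H] symmetric, the truncated sum paired with [H w] is [<w, fb> - <w, Rf^k fb>]. The whole
    error is thus one power of a contraction, and [|w| <= kg |x - y|]. *)
Lemma neumann_truncation k x y : X x -> X y ->
  `|dotv ((glb l b)^T *m (x - y)) ((L^-1 *: \sum_(i < k) Rf ^+ i) *m fb l b)
    - dotv (w (x - y)) (fb l b)| <= kg * lf0 * q ^+ k * l2norm (x - y).
Proof.
move=> Xx Xy; rewrite -Hw.
rewrite -[H in H *m w _](hessian_sym M_ge0 sg b Xl) -dotv_trmx mulmxA neumann_sum.
rewrite mulmxBl mul1mx dotvBr addrAC subrr sub0r normrN.
rewrite (le_trans (dotv_abs_le _ _))//.
have wb : l2norm (w (x - y)) <= kg * l2norm (x - y).
  rewrite mulrAC ler_pdivlMr// mulrC.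
  rewrite (le_trans (hessian_lower_bound L_gt0 sg mu_gt0 muL b _ (scg Xl) Xl))// Hw.
  exact: (cross_bound cX L_gt0 M_ge0 sg).
have rb : l2norm (Rf ^+ k *m fb l b) <= q ^+ k * lf0.
  rewrite (le_trans (neumann_power_bound _ _))// ler_wpM2l ?exprn_ge0//.
  exact: (inner_gradient_bound gf).
have -> : kg * lf0 * q ^+ k * l2norm (x - y) = kg * l2norm (x - y) * (q ^+ k * lf0).
  by ring.
by rewrite ler_pM ?l2norm_ge0.
Qed.

End Neumann.

(** The error splits into the changes of [fl], of the solved cross derivative [w] and of [fb]
    between [b] and [bh l], which sum to [M_f], and the truncation error. *)
Lemma hypergradient_bias k l b x y : X l -> X x -> X y ->
  `|dotv (fl l b) (x - y)
    - dotv ((glb l b)^T *m (x - y))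
        ((L^-1 *: \sum_(i < k) (1%:M - L^-1 *: gbb l b) ^+ i) *m fb l b)
    - dotv (grad_on X F l) (x - y)|
  <= (M_f lf0 lf1 L M mu * l2norm (b - bh l) + kg * lf0 * (1 - mu / L) ^+ k)
     * l2norm (x - y).
Proof.
move=> Xl Xx Xy; rewrite grad_on_hypergradient//.
set v := x - y; set c := bh l; set H := gbb l b; set Hc := gbb l c.
set N := _ *: \sum_(i < k) _.
pose w := invmx H *m ((glb l b)^T *m v); pose wc := invmx Hc *m ((glb l c)^T *m v).
have uH b' : gbb l b' \in unitmx := hessian_unit L_gt0 sg mu_gt0 muL b' (scg Xl) Xl.
have Hw : H *m w = (glb l b)^T *m v by rewrite mulmxA (mulmxV (uH _)) mul1mx.
have Hwc : Hc *m wc = (glb l c)^T *m v by rewrite mulmxA (mulmxV (uH _)) mul1mx.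
have hyp : dotv (hypergradient l) v = dotv (fl l c) v - dotv wc (fb l c).
  rewrite /hypergradient -/c -/Hc dotvBl (dotv_trmxl (glb l c)) -Hwc; congr (_ - _).
  rewrite (dotv_trmx Hc) [Hc^T](hessian_sym M_ge0 sg c Xl) -/Hc.
  by rewrite mulmxA (mulmxV (uH _)) mul1mx dotvC.
have v0 : 0 <= l2norm v := l2norm_ge0 _.
have e0 : 0 <= l2norm (b - c) := l2norm_ge0 _.
have wcb : l2norm wc <= kg * l2norm v.
  rewrite mulrAC ler_pdivlMr// mulrC.
  rewrite (le_trans (hessian_lower_bound L_gt0 sg mu_gt0 muL c _ (scg Xl) Xl))// Hwc.
  exact: (cross_bound cX L_gt0 M_ge0 sg).
(* The inverses are compared by applying [H] to [w - wc], which leaves only differences of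
   derivatives at [b] and [c]; the lower bound [mu] on [H] does the rest. *)
have dw : mu * l2norm (w - wc) <= M * (1 + kg) * l2norm (b - c) * l2norm v.
  rewrite (le_trans (hessian_lower_bound L_gt0 sg mu_gt0 muL b _ (scg Xl) Xl))//.
  have -> : gbb l b *m (w - wc) = (glb l b - glb l c)^T *m v + (Hc - H) *m wc.
    have trB : (glb l b - glb l c)^T = (glb l b)^T - (glb l c)^T by rewrite linearB.
    by rewrite -/H mulmxBr Hw trB !mulmxBl Hwc addrA subrK.
  rewrite (le_trans (ler_l2normD _ _))//.
  have h1 : l2norm ((glb l b - glb l c)^T *m v) <= M * l2norm (b - c) * l2norm v.
    by rewrite (le_trans (opnorm_tr_le _ _))// ler_wpM2r// llb.
  have h2 : l2norm ((Hc - H) *m wc) <= M * l2norm (b - c) * (kg * l2norm v).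
    rewrite (le_trans (opnorm_le _ _))// ler_pM ?opnorm_ge0 ?l2norm_ge0//.
    by have := lbb c b Xl Xl; rewrite subrr l2norm_col_0mx (l2norm_distC c).
  by move: h1 h2; lra.
have fb0 b' : l2norm (fb l b') <= lf0 := inner_gradient_bound gf _ lf0_ge0 lipf Xl.
have E : dotv (fl l b) v - dotv ((glb l b)^T *m v) (N *m fb l b) - dotv (hypergradient l) v
   = dotv (fl l b - fl l c) v
     - (dotv ((glb l b)^T *m v) (N *m fb l b) - dotv w (fb l b))
     - dotv (w - wc) (fb l b) - dotv wc (fb l b - fb l c).
  by rewrite hyp !dotvBl !dotvBr; ring.
have t1 : `|dotv (fl l b - fl l c) v| <= lf1 * l2norm (b - c) * l2norm v.
  rewrite (le_trans (dotv_abs_le _ _))// ler_wpM2r//.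
  have := partial_gradient_lipschitz_l (ul := fl) (ub := fb) lgf b c Xl Xl.
  by rewrite subrr l2norm_col_0mx.
have t2 := neumann_truncation b Xl k Xx Xy.
have t3 : `|dotv (w - wc) (fb l b)| <= M / mu * (1 + kg) * l2norm (b - c) * l2norm v * lf0.
  rewrite (le_trans (dotv_abs_le _ _))// ler_pM ?l2norm_ge0//.
  by rewrite -(ler_pM2l mu_gt0) (le_trans dw)// le_eqVlt; apply/orP; left; apply/eqP; field; rewrite gt_eqF.
have t4 : `|dotv wc (fb l b - fb l c)| <= kg * l2norm v * (lf1 * l2norm (b - c)).
  rewrite (le_trans (dotv_abs_le _ _))// ler_pM ?l2norm_ge0//.
  exact: (partial_gradient_lipschitz_b (ul := fl) (ub := fb) lgf).
rewrite E /M_f /kappa_g.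
move: t1 t2 t3 t4; rewrite -/v; set T1 := dotv _ v; set T2 := dotv _ (N *m _) - _.
set T3 := dotv (w - _) _; set T4 := dotv wc _.
have -> : (lf1 + lf1 * kg + lf0 * M / mu * (1 + kg)) * l2norm (b - c) = 
  lf1 * l2norm (b - c) + kg * lf1 * l2norm (b - c) + M / mu * (1 + kg) * l2norm (b - c) * lf0.
  by field; rewrite gt_eqF.
rewrite !ler_norml; lra.
Qed.

End Bilevel.

(** * Measurability and independence *)

Section Measurability.
Context (R : realType) d (T : measurableType d).

Definition vmeasurable n (v : T -> 'cV[R]_n) : Prop :=
  forall i, measurable_fun setT (fun x => v x i 0).

(** Measurability is asked only at attained indices, since the others contribute the empty set. For
    [mtil] this restricts attention to values below [m]. *)
Lemma measurable_select d' (U : measurableType d') (K : countType) (k : T -> K) (F : K -> T -> U) :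
  (forall c, measurable [set x | k x = c]) ->
  (forall x, measurable_fun setT (F (k x))) ->
  measurable_fun setT (fun x => F (k x) x).
Proof.
move=> mk mF _ B mB; rewrite setTI.
pose G c := if `[< range k c >] then [set x | k x = c] `&` F c @^-1` B else set0.
have -> : (fun x => F (k x) x) @^-1` B = \bigcup_c G c.
  apply/seteqP; split=> [x Bx|x [c _]].
    by exists (k x) => //; rewrite /G asboolT//; exists x.
  by rewrite /G; case: asboolP => // -[y _ <-] [/= <-].
apply: countable_bigcupT_measurable; first exact: countableP.
move=> c; rewrite /G; case: asboolP => [[y _ <-]|_]; last exact: measurable0.
by apply: measurableI => //; rewrite -[X in measurable X]setTI; exact: mF.
Qed.

Lemma vmeasurableD n (u v : T -> 'cV[R]_n) :
  vmeasurable u -> vmeasurable v -> vmeasurable (fun x => u x + v x).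
Proof. by move=> mu mv i; under eq_fun do rewrite mxE; exact: measurable_funD. Qed.

Lemma vmeasurableB n (u v : T -> 'cV[R]_n) :
  vmeasurable u -> vmeasurable v -> vmeasurable (fun x => u x - v x).
Proof.
move=> mu mv i; under eq_fun do rewrite mxE [X in _ + X]mxE; exact: measurable_funB.
Qed.

Lemma vmeasurableZ n (a : R) (u : T -> 'cV[R]_n) :
  vmeasurable u -> vmeasurable (fun x => a *: u x).
Proof.
by move=> mu i; under eq_fun do rewrite mxE; apply: measurable_funM => //; exact: measurable_cst.
Qed.

Lemma vmeasurable_cst n (c : 'cV[R]_n) : vmeasurable (fun _ => c).
Proof. by move=> i; exact: measurable_cst. Qed.

Lemma vmeasurable_sum n (I : Type) (r : seq I) (Q : pred I) (u : I -> T -> 'cV[R]_n) :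
  (forall i, Q i -> vmeasurable (u i)) -> vmeasurable (fun x => \sum_(i <- r | Q i) u i x).
Proof.
move=> mu; elim: r => [|a r IH].
  by under eq_fun do rewrite big_nil; exact: vmeasurable_cst.
case Qa: (Q a); under eq_fun do rewrite big_cons Qa; last exact: IH.
exact: vmeasurableD (mu _ Qa) IH.
Qed.

Lemma measurable_big_sum (I : Type) (r : seq I) (Q : pred I) (u : I -> T -> R) :
  (forall i, Q i -> measurable_fun setT (u i)) ->
  measurable_fun setT (fun x => \sum_(i <- r | Q i) u i x).
Proof.
move=> mu; elim: r => [|a r IH].
  by under eq_fun do rewrite big_nil; exact: measurable_cst.
case Qa: (Q a); under eq_fun do rewrite big_cons Qa; last exact: IH.
exact: measurable_funD (mu _ Qa) IH.
Qed.

Lemma measurable_dotv n (u v : T -> 'cV[R]_n) :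
  vmeasurable u -> vmeasurable v -> measurable_fun setT (fun x => dotv (u x) (v x)).
Proof. by move=> mu mv; apply: measurable_big_sum => i _; exact: measurable_funM. Qed.

Lemma measurable_l2norm_sqr n (u : T -> 'cV[R]_n) :
  vmeasurable u -> measurable_fun setT (fun x => l2norm (u x) ^+ 2).
Proof. by move=> mu; under eq_fun do rewrite l2norm_sqr; exact: measurable_dotv. Qed.

Lemma vmeasurable_col_mx n m (u : T -> 'cV[R]_n) (v : T -> 'cV[R]_m) :
  vmeasurable u -> vmeasurable v -> vmeasurable (fun x => col_mx (u x) (v x)).
Proof.
move=> mu mv i; case: (split_ordP i) => j ->.
  by under eq_fun do rewrite col_mxEu; exact: mu.
by under eq_fun do rewrite col_mxEd; exact: mv.
Qed.

Definition mmeasurable m n (M : T -> 'M[R]_(m, n)) : Prop :=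
  forall i j, measurable_fun setT (fun x => M x i j).

Lemma mmeasurable_mul m n p (M : T -> 'M[R]_(m, n)) (N : T -> 'M[R]_(n, p)) :
  mmeasurable M -> mmeasurable N -> mmeasurable (fun x => M x *m N x).
Proof.
move=> mM mN i j; under eq_fun do rewrite mxE.
by apply: measurable_big_sum => k _; exact: measurable_funM.
Qed.

Lemma mmeasurable_cst m n (M : 'M[R]_(m, n)) : mmeasurable (fun _ => M).
Proof. by move=> i j; exact: measurable_cst. Qed.

Lemma mmeasurableB m n (M N : T -> 'M[R]_(m, n)) :
  mmeasurable M -> mmeasurable N -> mmeasurable (fun x => M x - N x).
Proof.
move=> mM mN i j; under eq_fun do rewrite mxE [X in _ + X]mxE; exact: measurable_funB.
Qed.

Lemma mmeasurableZ m n (a : R) (M : T -> 'M[R]_(m, n)) :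
  mmeasurable M -> mmeasurable (fun x => a *: M x).
Proof.
by move=> mM i j; under eq_fun do rewrite mxE; apply: measurable_funM => //; exact: measurable_cst.
Qed.

(* [v] is approximated by maps with countably many values in [A], one for each
   cell of a grid of mesh [1 / (m + 1)] meeting [A]. *)
Lemma measurable_caratheodory n (A : set 'cV[R]_n) (F : 'cV[R]_n -> T -> R) (v : T -> 'cV[R]_n) :
  vmeasurable v -> (forall x, A (v x)) ->
  (forall a, A a -> measurable_fun setT (F a)) ->
  (forall x a, A a -> forall e, 0 < e -> exists2 r, 0 < r &
     forall b, A b -> l2norm (b - a) < r -> `|F b x - F a x| <= e) ->
  measurable_fun setT (fun x => F (v x) x).
Proof.
move=> mv Av mF cF.
pose cell (m : nat) (y : 'cV[R]_n) : {ffun 'I_n -> int} :=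
  [ffun i => Num.floor (m.+1%:R * y i 0)].
pose rep m c : 'cV[R]_n := get [set a | A a /\ cell m a = c].
have repP m x : A (rep m (cell m (v x))) /\ cell m (rep m (cell m (v x))) = cell m (v x).
  by apply: (@getPex _ [set a | A a /\ cell m a = cell m (v x)]); exists (v x).
apply: (@measurable_fun_cvg _ _ _ _ (fun m x => F (rep m (cell m (v x))) x)) => [m|x _].
  apply: (@measurable_select _ _ _ (fun x => cell m (v x)) (fun c => F (rep m c))).
  - move=> c.
    have -> : [set x | cell m (v x) = c] =
        \bigcap_(i in [set: 'I_n]) [set x | Num.floor (m.+1%:R * v x i 0) = c i].
      apply/seteqP; split=> x /=; first by move=> <- i _ /=; rewrite ffunE.
      by move=> H; apply/ffunP => i; rewrite ffunE; exact: H.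
    apply: fin_bigcap_measurable => // i _.
    have mg : measurable_fun setT (fun x => m.+1%:R * v x i 0).
      by apply: measurable_funM => //; exact: measurable_cst.
    have -> : [set x | Num.floor (m.+1%:R * v x i 0) = c i] =
        (fun x => m.+1%:R * v x i 0) @^-1` `[(c i)%:~R, (c i + 1)%:~R[.
      apply/seteqP; split=> x /=; rewrite in_itv/=.
        by move=> <-; rewrite floor_le// floorD1_gt.
      by move=> H; apply: floor_def.
    by rewrite -[X in measurable X]setTI; apply: mg.
  - by move=> x; apply: mF; exact: (repP m x).1.
apply/cvgrPdist_le => /= e e0.
have [r r0 Hr] := cF x (v x) (Av x) e e0.
have H : \forall m \near \oo, n%:R / r < m.+1%:R.
  near=> m; apply: (@lt_le_trans _ _ m%:R); last by rewrite ler_nat.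
  near: m; exact: nbhs_infty_gtr.
apply: filterS H => m Hm; rewrite distrC.
have [Arep crep] := repP m x; apply: Hr => //.
rewrite (le_lt_trans (l2norm_le_sum _))//.
have m0 : 0 < m.+1%:R :> R by rewrite ltr0n.
apply: (@le_lt_trans _ _ (\sum_(i < n) m.+1%:R^-1)).
  apply: ler_sum => i _; rewrite mxE [X in _ + X]mxE.
  have /ffunP/(_ i) := crep; rewrite !ffunE => E.
  rewrite -(ler_pM2l m0) mulfV ?gt_eqF// -[X in X * _](gtr0_norm m0) -normrM mulrBr.
  have := floor_le (m.+1%:R * v x i 0); have := floorD1_gt (m.+1%:R * v x i 0).
  have := floor_le (m.+1%:R * rep m (cell m (v x)) i 0).
  have := floorD1_gt (m.+1%:R * rep m (cell m (v x)) i 0).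
  rewrite E !intrD ler_norml; lra.
rewrite sumr_const card_ord -[X in X < _]mulr_natr mulrC ltr_pdivrMr// mulrC.
by rewrite -ltr_pdivrMr.
Unshelve. all: by end_near.
Qed.

End Measurability.

(** * Decoupling of independent groups of draws *)

Section Decoupling.
Context (R : realType) d (Om : measurableType d) (P : probability Om R) (G1 G2 : set (set Om)).
Hypothesis mG1 : G1 `<=` measurable.
Hypothesis mG2 : G2 `<=` measurable.
Hypothesis indep : forall A B, <<s G1 >> A -> <<s G2 >> B -> (P (A `&` B) = P A * P B)%E.

Local Open Scope ereal_scope.

Let O1 := g_sigma_algebraType G1.
Let O2 := g_sigma_algebraType G2.

Lemma sigma_sub_measurable (G : set (set Om)) : G `<=` measurable -> <<s G >> `<=` measurable.
Proof. exact: (smallest_sub (@sigma_algebra_measurable _ Om)). Qed.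

Let id1 : Om -> O1 := fun o => o.
Let id2 : Om -> O2 := fun o => o.
Let mid1 : measurable_fun setT id1.
Proof. by move=> _ A mA; rewrite setTI; exact: (sigma_sub_measurable mG1). Qed.
Let mid2 : measurable_fun setT id2.
Proof. by move=> _ A mA; rewrite setTI; exact: (sigma_sub_measurable mG2). Qed.
Let X1 : {mfun Om >-> O1} := HB.pack id1 (isMeasurableFun.Build _ _ _ _ _ mid1).
Let X2 : {mfun Om >-> O2} := HB.pack id2 (isMeasurableFun.Build _ _ _ _ _ mid2).
Let diag : Om -> (O1 * O2)%type := fun o => (id1 o, id2 o).
Let mdiag : measurable_fun setT diag.
Proof. exact/measurable_fun_pair. Qed.
Let X12 : {mfun Om >-> (O1 * O2)%type} := HB.pack diag (isMeasurableFun.Build _ _ _ _ _ mdiag).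

(** Independence of the two groups says that the diagonal map, into the square of [Om] with the
    generated sigma-algebras, has the product of its marginals as law. *)
Let diag_law A : measurable A -> (distribution P X1 \x distribution P X2) A = distribution P X12 A.
Proof.
apply: product_measure_unique => B C mB mC.
by rewrite -indep.
Qed.

Lemma decoupled_measurable (phi : (O1 * O2)%type -> \bar R) :
  measurable_fun setT phi -> (forall z, 0 <= phi z) ->
  measurable_fun setT (fun o : O1 => \int[P]_o' phi (o, o')).
Proof.
move=> mphi phi0.
have := measurable_fun_fubini_tonelli_F (m2 := distribution P X2) phi mphi phi0.
apply: eq_measurable_fun => o _; rewrite /fubini_F.
rewrite (@ge0_integral_pushforward _ _ Om O2 R id2 mid2 P setT)//.
by apply: measurableT_comp => //; exact: measurable_pair1.
Qed.

(** Stands in for conditioning: the first group is frozen at [o] and the second is integrated over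
    an independent copy [o'], by Tonelli under the product law. *)
Lemma decoupling (phi : (O1 * O2)%type -> \bar R) :
  measurable_fun setT phi -> (forall z, 0 <= phi z) ->
  \int[P]_o phi (o, o) = \int[P]_o \int[P]_o' phi (o, o').
Proof.
move=> mphi phi0.
transitivity (\int[distribution P X12]_z phi z).
  by rewrite (@ge0_integral_pushforward _ _ Om _ R diag mdiag P setT phi).
transitivity (\int[distribution P X1 \x distribution P X2]_z phi z).
  by apply: eq_measure_integral => A mA _; exact/esym/diag_law.
rewrite fubini_tonelli1//.
rewrite (@ge0_integral_pushforward _ _ Om _ R id1 mid1 P setT)//.
- apply: eq_integral => o _ /=; rewrite /fubini_F.
  rewrite (@ge0_integral_pushforward _ _ Om O2 R id2 mid2 P setT)//.
  by apply: measurableT_comp => //; exact: measurable_pair1.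
- exact: measurable_fun_fubini_tonelli_F.
- by move=> o _; apply: integral_ge0.
Qed.

End Decoupling.

Definition generators (Om I : Type) (ev : I -> set (set Om)) (S : set I) : set (set Om) :=
  [set B | exists2 i, S i & ev i B].

Section Grouping.
Context (R : realType) d (Om : measurableType d) (P : probability Om R).

(** Uniqueness of measures on a pi-system, applied to the restriction of [P] to [B] and to the
    multiple of [P] by [P B]. *)
Lemma product_rule_extension (G : set (set Om)) (B : set Om) :
  G `<=` measurable -> setI_closed G -> G setT -> measurable B ->
  (forall A, G A -> P (A `&` B) = P A * P B)%E ->
  forall A, <<s G >> A -> (P (A `&` B) = P A * P B)%E.
Proof.
move=> mG GI GT mB H A sA.
have b0 : 0 <= fine (P B) by rewrite fine_ge0.
pose m2 := mscale (NngNum b0) P.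
have m2E C : m2 C = (P C * P B)%E.
  by rewrite /m2 /mscale/= fineK ?fin_num_measure// muleC.
have cover : \bigcup_(k in [set: nat]) [set: Om] = setT by rewrite bigcup_const//; exists 0%N.
rewrite -m2E; apply: (@g_sigma_algebra_measure_unique _ R Om G mG (fun _ => setT) (fun _ => GT)
  cover (mrestr P mB) m2 GI _ _ A sA) => [C GC|_].
  by rewrite [RHS]m2E; exact: H.
by rewrite /= /mrestr (le_lt_trans (probability_le1 _ _)) ?ltry//; exact: measurableI.
Qed.

Context (I : choiceType) (ev : I -> set (set Om)) (act : set I).
Hypothesis evT : forall i, ev i setT.
Hypothesis evI : forall i A B, ev i A -> ev i B -> ev i (A `&` B).
Hypothesis ev_measurable : forall i, act i -> ev i `<=` measurable.
Hypothesis indep : mutually_independent P act ev.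

Local Notation generators := (generators ev).

Lemma generators_measurable S : S `<=` act -> generators S `<=` measurable.
Proof. by move=> Sact B [i Si evB]; exact: ev_measurable (Sact _ Si) _ evB. Qed.

Let cylinder (s : seq I) (A : I -> set Om) : set Om := \bigcap_(i in [set` s]) A i.

(** Finite intersections turn the generators into a pi-system whose sigma-algebra contains all of
    theirs. *)
Let cylinders (S : set I) : set (set Om) := [set B | exists (s : seq I) A,
  [/\ uniq s, forall i, i \in s -> S i, forall i, ev i (A i) & B = cylinder s A]].

Let cylindersI S : setI_closed (cylinders S).
Proof.
move=> _ _ [s [A [us sS sA ->]]] [s' [A' [us' s'S sA' ->]]].
pose cut (r : seq I) (C : I -> set Om) i := if i \in r then C i else setT.
exists (undup (s ++ s')), (fun i => cut s A i `&` cut s' A' i); split.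
- exact: undup_uniq.
- by move=> i; rewrite mem_undup mem_cat => /orP[/sS|/s'S].
- by move=> i; apply: evI; rewrite /cut; case: ifP.
- apply/seteqP; split=> x /=.
    move=> [H H'] i; rewrite /= mem_undup mem_cat /cut => _.
    by split; case: ifP => // ri; [exact: H|exact: H'].
  move=> H; split=> i /= ri; have := H i; rewrite /= mem_undup mem_cat ri ?orbT /cut ri.
    by move=> /(_ isT)[].
  by move=> /(_ isT)[].
Qed.

Let cylindersT S : cylinders S setT.
Proof.
exists [::], (fun=> setT); split => //.
by apply/seteqP; split.
Qed.

Let cylinders_measurable S : S `<=` act -> cylinders S `<=` measurable.
Proof.
move=> Sact _ [s [A [us sS sA ->]]]; apply: fin_bigcap_measurable => [|i /= si].
  exact: finite_seq.
by apply: ev_measurable (sA i); exact/Sact/sS.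
Qed.

Let cylinder_law S s A : S `<=` act -> uniq s -> (forall i, i \in s -> S i) ->
  (forall i, ev i (A i)) -> P (cylinder s A) = (\prod_(i <- s) P (A i))%E.
Proof.
move=> Sact us sS sA.
pose k2i (k : 'I_(size s)) := tnth (in_tuple s) k.
have inj : injective k2i by exact/tuple_uniqP.
have actk k : act (k2i k) by apply/Sact/sS; exact: mem_tnth.
have := indep (A := fun k => A (k2i k)) inj actk (fun k => sA (k2i k)).
move=> E; rewrite big_tnth -E; congr (P _); apply/seteqP; split=> x /=.
  by move=> H k _; apply: H => /=; exact: mem_tnth.
move=> H i /= /(tnthP (in_tuple s))[k ->]; exact: H.
Qed.

(** The product rule holds for two cylinders by mutual independence; it is extended first in one
    argument with the other a cylinder, then in the other. *)
Lemma generators_independent S S' : S `<=` act -> S' `<=` act -> S `&` S' = set0 ->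
  forall A B, <<s generators S >> A -> <<s generators S' >> B -> (P (A `&` B) = P A * P B)%E.
Proof.
move=> Sact S'act SS' A B.
have sub Q : <<s generators Q >> `<=` <<s cylinders Q >>.
  apply: smallest_sub; first exact: smallest_sigma_algebra.
  move=> C [i Qi evC]; apply: sub_sigma_algebra.
  exists [:: i], (fun j => if j == i then C else setT); split => //.
  - by move=> j; rewrite inE => /eqP ->.
  - by move=> j; case: eqP => // ->.
  - apply/seteqP; split=> x /=.
      by move=> Cx j /=; rewrite inE => ->.
    by move=> /(_ i); rewrite /= inE eqxx; exact.
move=> /sub sA /sub sB.
have mcyl Q : Q `<=` act -> <<s cylinders Q >> `<=` measurable.
  by move=> Qact; exact: (smallest_sub (@sigma_algebra_measurable _ Om)) (cylinders_measurable Qact).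
have step C : cylinders S C -> (P (C `&` B) = P C * P B)%E.
  move=> cC; rewrite setIC muleC.
  have mC := cylinders_measurable Sact cC.
  apply: (@product_rule_extension (cylinders S')) => // [|D].
    exact: cylinders_measurable.
  move: cC => [s [a [us sS sa ->]]] [s' [a' [us' s'S' sa' ->]]].
  (* As the index sets are disjoint, the two families merge into one and mutual independence applies
     to the concatenation. *)
  pose c i := if i \in s then a i else a' i.
  have disj i : i \in s -> i \in s' -> False.
    by move=> /sS Si /s'S' S'i; have : (S `&` S') i by []; rewrite SS'.
  have cs : cylinder s c = cylinder s a.
    by apply: eq_bigcapr => i /= si; rewrite /c si.
  have cs' : cylinder s' c = cylinder s' a'.
    by apply: eq_bigcapr => i /= si; rewrite /c; case: ifP => // /disj/(_ si).
  have uss' : uniq (s ++ s').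
    rewrite cat_uniq us us' andbT /=; apply/hasPn => i s'i; apply/negP => si.
    exact: disj si s'i.
  have -> : cylinder s' a' `&` cylinder s a = cylinder (s ++ s') c.
    rewrite -cs -cs'; apply/seteqP; split=> x /=.
      by move=> [H H'] i /=; rewrite mem_cat => /orP[]; [exact: H'|exact: H].
    by move=> H; split=> i /= si; apply: H; rewrite /= mem_cat si ?orbT.
  have SS'act : S `|` S' `<=` act by move=> i [/Sact|/S'act].
  have evc i : ev i (c i) by rewrite /c; case: ifP.
  rewrite (cylinder_law SS'act) // => [|i]; last first.
    by rewrite mem_cat => /orP[/sS|/s'S']; [left|right].
  rewrite big_cat/= -cs -cs' (cylinder_law Sact us sS evc) (cylinder_law S'act us' s'S' evc).
  by rewrite muleC.
apply: (@product_rule_extension (cylinders S)) => //.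
- exact: cylinders_measurable.
- exact: mcyl S'act _ sB.
Qed.

End Grouping.

Section VectorIntegrals.
Context (R : realType) d (Om : measurableType d) (P : probability Om R).

(* For a non-measurable nonnegative function the integral is the lower integral. *)
Lemma ge0_lower_integral_le (f g : Om -> \bar R) :
  (forall x, 0 <= f x)%E -> (forall x, f x <= g x)%E ->
  (\int[P]_x f x <= \int[P]_x g x)%E.
Proof.
move=> f0 fg; have g0 x : (0 <= g x)%E by exact: le_trans (f0 x) (fg x).
rewrite !ge0_integralTE//; apply: le_ereal_sup => _ [h hf <-].
by exists h => // x; exact: le_trans (hf x) (fg x).
Qed.

Lemma integrable_bounded (u : Om -> R) c : measurable_fun setT u ->
  (forall x, `|u x| <= c) -> P.-integrable setT (EFin \o u).
Proof.
move=> mu uc; apply: (@le_integrable _ _ _ P setT _ _ (EFin \o cst c)) => //.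
- exact/measurable_EFinP.
- by move=> x _; rewrite /= lee_fin (le_trans (uc x))// ler_norm.
- exact: finite_measure_integrable_cst.
Qed.

Definition vintegrable n (V : Om -> 'cV[R]_n) : Prop :=
  forall i, P.-integrable setT (EFin \o (fun x => V x i 0)).

Lemma integrable_big_sum (I : Type) (r : seq I) (F : I -> Om -> R) :
  (forall i, P.-integrable setT (EFin \o F i)) ->
  P.-integrable setT (EFin \o (fun x => \sum_(i <- r) F i x)).
Proof.
move=> iF; rewrite (_ : _ \o _ = fun x => (\sum_(i <- r) (F i x)%:E)%E).
  by apply: integrable_sum => // i _; exact: iF.
by apply/funext => x /=; rewrite sumEFin.
Qed.

Lemma Rintegral_big_sum (I : Type) (r : seq I) (F : I -> Om -> R) :
  (forall i, P.-integrable setT (EFin \o F i)) ->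
  \int[P]_x (\sum_(i <- r) F i x) = \sum_(i <- r) \int[P]_x F i x.
Proof.
move=> iF; elim: r => [|a r IH].
  by under eq_Rintegral do rewrite big_nil; rewrite big_nil Rintegral_cst ?mul0r.
under eq_Rintegral do rewrite big_cons.
by rewrite big_cons RintegralD ?IH//; exact: integrable_big_sum.
Qed.

Lemma integrable_scale (a : R) (u : Om -> R) :
  P.-integrable setT (EFin \o u) -> P.-integrable setT (EFin \o (fun x => a * u x)).
Proof.
move=> iu; rewrite (_ : _ \o _ = fun x => (a%:E * (EFin \o u) x)%E); first exact: integrableZl.
by apply/funext => x /=; rewrite EFinM.
Qed.

Lemma integrable_add (u v : Om -> R) :
  P.-integrable setT (EFin \o u) -> P.-integrable setT (EFin \o v) ->
  P.-integrable setT (EFin \o (fun x => u x + v x)).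
Proof.
by move=> iu iv; rewrite (_ : _ \o _ = (EFin \o u) \+ (EFin \o v))//; exact: integrableD.
Qed.

Lemma integrable_const (c : R) : P.-integrable setT (EFin \o (fun _ : Om => c)).
Proof. exact: finite_measure_integrable_cst. Qed.

Lemma Rintegral_const (c : R) : \int[P]_x (fun _ : Om => c) x = c.
Proof. by rewrite Rintegral_cst//= [X in fine X]probability_setT/= mulr1. Qed.

Lemma integrable_dotv n (V : Om -> 'cV[R]_n) (a : 'cV[R]_n) :
  vintegrable V -> P.-integrable setT (EFin \o (fun x => dotv a (V x))).
Proof. by move=> iV; apply: integrable_big_sum => i; exact: integrable_scale. Qed.

Lemma Rintegral_dotv n (V : Om -> 'cV[R]_n) (a : 'cV[R]_n) :
  vintegrable V -> \int[P]_x dotv a (V x) = dotv a (vmean P V).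
Proof.
move=> iV; rewrite Rintegral_big_sum => [|i]; last exact: integrable_scale.
by apply: eq_bigr => i _; rewrite RintegralZl// mxE.
Qed.

Lemma integral_EFin (u : Om -> R) : P.-integrable setT (EFin \o u) ->
  (\int[P]_x (u x)%:E = (\int[P]_x u x)%:E)%E.
Proof.
move=> iu; rewrite /Rintegral fineK//; exact: (integrable_fin_num measurableT iu).
Qed.

Lemma vintegrable_of_variance n (V : Om -> 'cV[R]_n) (c : 'cV[R]_n) (s : R) :
  vmeasurable V ->
  (\int[P]_x (l2norm (V x - c) ^+ 2)%:E <= s%:E)%E ->
  vintegrable V /\ P.-integrable setT (EFin \o (fun x => l2norm (V x - c) ^+ 2)).
Proof.
move=> mV Vs.
have mD : vmeasurable (fun x => V x - c) by apply: vmeasurableB => //; exact: vmeasurable_cst.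
have i2 : P.-integrable setT (EFin \o (fun x => l2norm (V x - c) ^+ 2)).
  apply/integrableP; split; first exact/measurable_EFinP/measurable_l2norm_sqr.
  under eq_integral do rewrite /= ger0_norm ?sqr_ge0//.
  exact: le_lt_trans Vs (ltry _).
(* Domination by [a <= 1 + a^2] with [a] the norm of the deviation from [c]. *)
split=> // i; apply: (@le_integrable _ _ _ P setT _ _
    (EFin \o (fun x => (`|c i 0| + 1) + l2norm (V x - c) ^+ 2))) => //.
- exact/measurable_EFinP/mV.
- move=> x _; rewrite /= lee_fin [leRHS]ger0_norm ?addr_ge0 ?sqr_ge0//.
  have := normr_coord_le (V x - c) i; rewrite mxE [X in _ + X]mxE => H.
  have := ler_normD (V x i 0 - c i 0) (c i 0); rewrite subrK.
  have := sqr_ge0 (l2norm (V x - c) - 1); rewrite sqrrB1 expr2.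
  have := l2norm_ge0 (V x - c); nra.
- by apply: integrable_add => //; exact: integrable_const.
Qed.

Lemma vmean_sub n (V : Om -> 'cV[R]_n) (c : 'cV[R]_n) :
  vintegrable V -> vmean P (fun x => V x - c) = vmean P V - c.
Proof.
move=> iV; apply/matrixP => i j; rewrite ord1 !mxE.
under eq_Rintegral do rewrite mxE [X in _ + X]mxE.
rewrite RintegralB//; last exact: integrable_const.
by rewrite Rintegral_const.
Qed.

Lemma vintegrable_sub n (V : Om -> 'cV[R]_n) (c : 'cV[R]_n) :
  vintegrable V -> vintegrable (fun x => V x - c).
Proof.
move=> iV i; rewrite (_ : _ \o _ = EFin \o (fun x => V x i 0 + - c i 0)).
  by apply: integrable_add; [exact: iV|exact: integrable_const].
by apply/funext => x /=; rewrite mxE [X in _ + X]mxE.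
Qed.

(** The cross term has mean zero because the deviation is centred. *)
Lemma centered_second_moment n (V : Om -> 'cV[R]_n) (a : 'cV[R]_n) (c s : R) :
  vmeasurable V ->
  (\int[P]_x (l2norm (V x - vmean P V) ^+ 2)%:E <= s%:E)%E ->
  (\int[P]_x (l2norm (a + c *: (V x - vmean P V)) ^+ 2)%:E <=
    (l2norm a ^+ 2 + c ^+ 2 * s)%:E)%E.
Proof.
move=> mV Vs; have [iV i2] := vintegrable_of_variance mV Vs.
set e := vmean P V in Vs i2 *.
have iD := vintegrable_sub e iV.
pose f x := l2norm a ^+ 2 + (2 * c) * dotv a (V x - e).
have if_ : P.-integrable setT (EFin \o f).
  apply: integrable_add; first exact: integrable_const.
  exact/integrable_scale/integrable_dotv.
have ig : P.-integrable setT (EFin \o (fun x => c ^+ 2 * l2norm (V x - e) ^+ 2)).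
  exact: integrable_scale.
have E x : l2norm (a + c *: (V x - e)) ^+ 2 = f x + c ^+ 2 * l2norm (V x - e) ^+ 2.
  rewrite /f !l2norm_sqr; move: (V x - e) => D.
  by rewrite dotvDl !dotvDr !dotvZl !dotvZr (dotvC D a); ring.
under eq_integral do rewrite E.
rewrite integral_EFin; last exact: integrable_add.
rewrite RintegralD// lee_fin lerD//.
  rewrite RintegralD//; last 2 first.
  - exact: integrable_const.
  - exact/integrable_scale/integrable_dotv.
  rewrite Rintegral_const RintegralZl//; last exact: integrable_dotv.
  by rewrite Rintegral_dotv// vmean_sub// subrr dotv0r mulr0 addr0.
rewrite RintegralZl// ler_wpM2l ?sqr_ge0//.
by move: Vs; rewrite integral_EFin// lee_fin.
Qed.

End VectorIntegrals.

Section Draws.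
Context (R : realType) (d1 d2 : nat) (dE dZ dO : measure_display)
  (E : measurableType dE) (Z : measurableType dZ) (Omega : measurableType dO)
  (P : probability Omega R) (pb : problem R d1 d2 E Z) (smp : samples Omega E Z)
  (T K s m : nat).
Hypothesis draws_indep : independent_draws pb P smp T K s m.

(* A map measurable on [info S] is a function of the draws in [S]. *)
Definition info (S : set draw) : measurableType _ :=
  g_sigma_algebraType (generators (draw_events smp) S).

Local Notation "S .-known" := (measurable_fun (setT : set (info S)))
  (at level 2, format "S .-known").

Let evT i : draw_events smp i setT.
Proof. by case: i => *; exists setT; rewrite ?preimage_setT. Qed.

Let evI i A B : draw_events smp i A -> draw_events smp i B -> draw_events smp i (A `&` B).
Proof.
by case: i => [t|t j|t|t k j] [A' mA' <-] [B' mB' <-]; exists (A' `&` B');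
  rewrite ?preimage_setI//; exact: measurableI.
Qed.

Let ev_measurable i : drawn T K s m i -> draw_events smp i `<=` measurable.
Proof.
have pre dU (U : measurableType dU) (x : Omega -> U) A :
    measurable_fun setT x -> measurable A -> measurable (x @^-1` A).
  by move=> mx mA; rewrite -[X in measurable X]setTI; exact: mx.
case: draws_indep => hE hZ hM hB _ Di B.
case: i Di => [t|t j|t|t k j] Di [A mA <-]; apply: pre => //.
- by have [] := hE _ Di.
- by have [] := hZ _ _ Di.
- by have [] := hM _ Di.
- by have [] := hB _ _ _ Di.
Qed.

Lemma known_mono dU (U : measurableType dU) S S' (f : Omega -> U) :
  S `<=` S' -> S.-known f -> S'.-known f.
Proof.
move=> SS' mf _ B mB; have := mf measurableT B mB; rewrite !setTI.
apply: smallest_sub; first exact: smallest_sigma_algebra.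
by move=> A [i Si evA]; apply: sub_sigma_algebra; exists i => //; exact: SS'.
Qed.

Let gen_measurable S : S `<=` drawn T K s m ->
  generators (draw_events smp) S `<=` measurable.
Proof. exact: (generators_measurable (I := {classic draw}) ev_measurable). Qed.

Lemma known_measurable dU (U : measurableType dU) S (f : Omega -> U) :
  S `<=` drawn T K s m -> S.-known f -> measurable_fun setT f.
Proof.
move=> SD mf _ B mB; have := mf measurableT B mB; rewrite !setTI.
exact: (sigma_sub_measurable (gen_measurable SD)).
Qed.

Let known_draw dU (U : measurableType dU) S i (x : Omega -> U) :
  S i -> draw_events smp i = [set x @^-1` A | A in measurable] -> S.-known x.
Proof.
move=> Si evi _ B mB; rewrite setTI; apply: sub_sigma_algebra.
by exists i => //; rewrite evi; exists B.
Qed.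

Lemma known_eps (S : set draw) t : S (DrawEps t) -> S.-known (eps smp t).
Proof. by move=> H; exact: (known_draw H). Qed.

Lemma known_zeta (S : set draw) t j : S (DrawZeta t j) -> S.-known (zeta smp t j).
Proof. by move=> H; exact: (known_draw H). Qed.

Lemma known_mtil (S : set draw) t : S (DrawM t) -> S.-known (mtil smp t).
Proof. by move=> H; exact: (known_draw H). Qed.

Lemma known_batch (S : set draw) t k j : S (DrawBatch t k j) -> S.-known (batch smp t k j).
Proof. by move=> H; exact: (known_draw H). Qed.

Section TwoGroups.
Context (S S' : set draw).
Hypothesis SD : S `<=` drawn T K s m.
Hypothesis S'D : S' `<=` drawn T K s m.
Hypothesis SS' : S `&` S' = set0.

Let indepSS' A B : <<s generators (draw_events smp) S >> A ->
  <<s generators (draw_events smp) S' >> B -> (P (A `&` B) = P A * P B)%E.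
Proof.
case: draws_indep => _ _ _ _ mi.
exact: (generators_independent (I := {classic draw}) evT evI ev_measurable mi SD S'D SS').
Qed.

Local Notation joint_known := (measurable_fun (setT : set (info S * info S')%type)).

Lemma draws_decoupling (phi : Omega * Omega -> \bar R) :
  joint_known phi -> (forall z, 0 <= phi z)%E ->
  (\int[P]_o phi (o, o) = \int[P]_o \int[P]_o' phi (o, o'))%E.
Proof. exact: (decoupling (gen_measurable SD) (gen_measurable S'D) indepSS'). Qed.

Lemma draws_decoupled_known (phi : Omega * Omega -> \bar R) :
  joint_known phi -> (forall z, 0 <= phi z)%E ->
  S.-known (fun o => (\int[P]_o' phi (o, o'))%E).
Proof. exact: (decoupled_measurable P (gen_measurable S'D)). Qed.

Lemma joint_known_section dU (U : measurableType dU) (phi : Omega * Omega -> U) o :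
  joint_known phi -> measurable_fun setT (fun o' : Omega => phi (o, o')).
Proof.
move=> mphi; apply: (known_measurable S'D).
exact: (measurableT_comp mphi (measurable_pair1 (o : info S))).
Qed.

Lemma joint_known_l dU (U : measurableType dU) (f : Omega -> U) :
  S.-known f -> joint_known (fun z => f z.1).
Proof. by move=> mf; exact: (measurableT_comp mf measurable_fst). Qed.

Lemma joint_known_r dU (U : measurableType dU) (f : Omega -> U) :
  S'.-known f -> joint_known (fun z => f z.2).
Proof. by move=> mf; exact: (measurableT_comp mf measurable_snd). Qed.

(** Decoupling is available for nonnegative functions, so [u] and [v] are shifted by their bounds
    and the product is expanded afterwards. *)
Lemma product_expectation (u v : Omega -> R) c c' :
  S.-known u -> S'.-known v -> (forall o, `|u o| <= c) -> (forall o, `|v o| <= c') ->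
  \int[P]_o (u o * v o) = \int[P]_o u o * \int[P]_o v o.
Proof.
move=> ku kv uc vc'.
have mu := known_measurable SD ku; have mv := known_measurable S'D kv.
have iu := integrable_bounded P mu uc; have iv := integrable_bounded P mv vc'.
have u0 o : 0 <= u o + c by have := uc o; rewrite ler_norml; lra.
have v0 o : 0 <= v o + c' by have := vc' o; rewrite ler_norml; lra.
have iuv : P.-integrable setT (EFin \o (fun o => u o * v o)).
  apply: (@integrable_bounded _ _ _ _ _ (c * c')); first exact: measurable_funM.
  by move=> o; rewrite normrM ler_pM.
have iuc : P.-integrable setT (EFin \o (fun o => u o + c)).
  exact/integrable_add/integrable_const.
have ivc : P.-integrable setT (EFin \o (fun o => v o + c')).
  exact/integrable_add/integrable_const.
have iuvc : P.-integrable setT (EFin \o (fun o => (u o + c) * (v o + c'))).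
  rewrite (_ : (fun o => _) = (fun o => u o * v o + (c' * u o + (c * v o + c * c'))))//.
    by do ?[exact: integrable_const|exact: integrable_scale|apply: integrable_add].
  by apply/funext => o; ring.
pose phi (z : Omega * Omega) := ((u z.1 + c) * (v z.2 + c'))%:E.
have kphi : joint_known phi.
  apply/measurable_EFinP/measurable_funM.
    by apply: measurable_funD; [exact: joint_known_l|exact: measurable_cst].
  by apply: measurable_funD; [exact: joint_known_r|exact: measurable_cst].
have phi0 z : (0 <= phi z)%E by rewrite lee_fin mulr_ge0.
have inner o : (\int[P]_o' phi (o, o') =
    ((\int[P]_o' (v o' + c')) * (u o + c))%:E)%E.
  rewrite /phi/= integral_EFin; last exact: integrable_scale.
  by rewrite RintegralZl// mulrC.
have expand : \int[P]_o ((u o + c) * (v o + c')) =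
    \int[P]_o (u o * v o) + (c' * \int[P]_o u o + (c * \int[P]_o v o + c * c')).
  rewrite (_ : (fun o => (u o + c) * (v o + c')) =
    (fun o => u o * v o + (c' * u o + (c * v o + c * c')))); last by apply/funext => o; ring.
  have icv := integrable_scale c iv; have icc := integrable_const P (c * c').
  have icu := integrable_scale c' iu; have i2 := integrable_add icv icc.
  rewrite RintegralD//; last exact: integrable_add.
  by rewrite RintegralD// RintegralZl// RintegralD// RintegralZl// Rintegral_const.
have := draws_decoupling kphi phi0.
under [X in _ = X -> _]eq_integral do rewrite inner.
rewrite {1}/phi/= integral_EFin// integral_EFin; last exact: integrable_scale.
case; rewrite expand RintegralZl// !RintegralD//; try exact: integrable_const.
rewrite !Rintegral_const; lra.
Qed.

(** Parametrised integrals are measurable for nonnegative integrands; positive and negative parts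
    are treated separately. *)
Lemma known_mean n (U : Omega -> Omega -> 'cV[R]_n) :
  (forall i, joint_known (fun z => U z.1 z.2 i 0)) ->
  vmeasurable (T := info S) (fun o => vmean P (U o)).
Proof.
move=> mU i.
have mUe : joint_known (fun z => (U z.1 z.2 i 0)%:E) by exact/measurable_EFinP.
have -> : (fun o => vmean P (U o) i 0) = fun o => fine
    (\int[P]_o' (fun z : Omega * Omega => (U z.1 z.2 i 0)%:E)^\+ (o, o') -
     \int[P]_o' (fun z : Omega * Omega => (U z.1 z.2 i 0)%:E)^\- (o, o'))%E.
  apply/funext => o; rewrite mxE /Rintegral integralE.
  by congr (fine (_ - _)%E); apply: eq_integral => x _; rewrite ?funeposE ?funenegE.
apply: measurableT_comp; first exact: fine_measurable.
apply: emeasurable_funB; apply: draws_decoupled_known => //.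
  exact: measurable_funepos.
exact: measurable_funeneg.
Qed.

(** Orthogonality of martingale increments: with the past frozen at [o], the added term is centred.
    Iterated over a batch or a window, it sums variances without cross terms. *)
Lemma fresh_noise n (a : Omega -> 'cV[R]_n) (U : Omega -> Omega -> 'cV[R]_n) (c v : R) :
  0 <= v -> vmeasurable (T := info S) a ->
  (forall i, joint_known (fun z => U z.1 z.2 i 0)) ->
  (forall o, (\int[P]_o' (l2norm (U o o' - vmean P (U o)) ^+ 2)%:E <= v%:E)%E) ->
  (\int[P]_o (l2norm (a o + c *: (U o o - vmean P (U o))) ^+ 2)%:E
    <= \int[P]_o (l2norm (a o) ^+ 2)%:E + (c ^+ 2 * v)%:E)%E.
Proof.
move=> v0 ka mU Us.
have kU : vmeasurable (T := info S) (fun o => vmean P (U o)) := known_mean mU.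
pose phi (z : Omega * Omega) :=
  (l2norm (a z.1 + c *: (U z.1 z.2 - vmean P (U z.1))) ^+ 2)%:E.
have kphi : joint_known phi.
  apply/measurable_EFinP; apply: measurable_l2norm_sqr.
  apply: vmeasurableD => [i|]; first exact: joint_known_l (ka i).
  apply: vmeasurableZ; apply: vmeasurableB => // i; exact: joint_known_l (kU i).
have phi0 z : (0 <= phi z)%E by rewrite lee_fin sqr_ge0.
rewrite (draws_decoupling kphi phi0) /=.
have ma : measurable_fun setT (fun o : Omega => l2norm (a o) ^+ 2).
  by apply: measurable_l2norm_sqr => i; exact: known_measurable SD (ka i).
have -> : (\int[P]_o (l2norm (a o) ^+ 2)%:E + (c ^+ 2 * v)%:E
    = \int[P]_o ((l2norm (a o) ^+ 2)%:E + (c ^+ 2 * v)%:E))%E.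
  rewrite ge0_integralD//.
  - by rewrite integral_cst//= [X in (_ * X)%E]probability_setT mule1.
  - by move=> o _; rewrite lee_fin sqr_ge0.
  - exact/measurable_EFinP.
  - by move=> o _; rewrite lee_fin mulr_ge0// sqr_ge0.
apply: ge0_lower_integral_le => o; first by apply: integral_ge0.
have mUo : vmeasurable (U o) by move=> i; exact: (joint_known_section o (mU i)).
rewrite -EFinD; exact: (centered_second_moment (a o) c mUo (Us o)).
Qed.

End TwoGroups.
End Draws.

(** * Means of derivatives, windows and recursions *)

Section MeanDerivatives.
Context (R : realType).

(* Differentiation under the integral with a uniform second-order remainder. *)
Lemma mean_first_order d (T : measurableType d) (P : probability T R)
    (phi : R -> T -> R) (D : T -> R) (c c' a : R) :
  0 <= c -> 0 <= c' -> measurable_fun setT D ->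
  (forall s, 0 <= s -> s <= 1 -> P.-integrable setT (EFin \o phi s)) ->
  (forall s x, 0 <= s -> s <= 1 -> `|phi s x - phi 0 x - s * D x| <= c * s ^+ 2) ->
  (forall s, 0 < s -> s <= 1 ->
     `|\int[P]_x phi s x - \int[P]_x phi 0 x - s * a| <= c' * s ^+ 2) ->
  P.-integrable setT (EFin \o D) /\ \int[P]_x D x = a.
Proof.
move=> c0 c'0 mD iphi Hphi Ha.
(* The remainder bound at [s = 1] dominates [D] by integrable functions. *)
have iD : P.-integrable setT (EFin \o D).
  apply: (@le_integrable _ _ _ P setT _ _ (EFin \o (fun x => `|phi 1 x| + (`|phi 0 x| + c)))) => //.
  - exact/measurable_EFinP.
  - move=> x _; rewrite /= lee_fin [leRHS]ger0_norm ?addr_ge0//.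
    have := Hphi 1 x ler01 (lexx _); rewrite expr1n mulr1 mul1r distrC => H.
    rewrite -[D x](subrK (phi 1 x - phi 0 x)) addrC.
    rewrite (le_trans (ler_normD _ _))// addrA lerD// (le_trans (ler_normB _ _))//.
  - have i1 := integrable_norm (iphi 1 ler01 (lexx _)).
    have i0 := integrable_norm (iphi 0 (lexx _) ler01).
    by apply: integrable_add => //; apply: integrable_add => //; exact: integrable_const.
split=> //; apply/eqP; rewrite -subr_eq0 -normr_le0.
apply: (@le0_of_quadratic _ _ (c + c')); first exact: addr_ge0.
move=> s s0 s1.
have i1 := iphi s (ltW s0) s1; have i0 := iphi 0 (lexx _) ler01.
have isD := integrable_scale s iD.
have i10 : P.-integrable setT (EFin \o (fun x => phi s x - phi 0 x)).
  rewrite (_ : _ \o _ = EFin \o (fun x => phi s x + - 1 * phi 0 x)).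
    by apply: integrable_add => //; exact: integrable_scale.
  by apply/funext => x /=; rewrite mulN1r.
have irem : P.-integrable setT (EFin \o (fun x => phi s x - phi 0 x - s * D x)).
  rewrite (_ : _ \o _ = EFin \o (fun x => (phi s x - phi 0 x) + - 1 * (s * D x))).
    by apply: integrable_add => //; exact: integrable_scale.
  by apply/funext => x /=; rewrite mulN1r.
have rem : `|\int[P]_x (phi s x - phi 0 x - s * D x)| <= c * s ^+ 2.
  apply: le_trans (le_normr_Rintegral measurableT irem) _.
  rewrite -[leRHS](Rintegral_const P).
  apply: le_Rintegral => //; [exact: (integrable_norm irem)|exact: integrable_const|].
  by move=> x _; exact: Hphi (ltW s0) s1.
move: rem; rewrite RintegralB// RintegralB// RintegralZl// => rem.
have := Ha s s0 s1; move: rem.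
move: (\int[P]_x phi s x) (\int[P]_x phi 0 x) (\int[P]_x D x) => A B C h h'.
rewrite -[X in X * `|_|](gtr0_norm s0) -normrM mulrBr.
by move: h h'; rewrite !ler_norml; lra.
Qed.

End MeanDerivatives.

Section SegmentRemainders.
Context (R : realType) (d1 d2 : nat) (X : set 'cV[R]_d1).
Hypothesis cX : segment_closed X.

Lemma outer_remainder_l u ul ub L l x (b : 'cV[R]_d2) s : is_gradient X u ul ub ->
  lipschitz_joint X (@l2norm R (d1 + d2)) L (fun l b => col_mx (ul l b) (ub l b)) ->
  X l -> X x -> 0 <= s -> s <= 1 ->
  `|u (l + s *: (x - l)) b - u (l + 0 *: (x - l)) b - s * dotv (ul l b) (x - l)|
    <= L * l2norm (x - l) ^+ 2 * s ^+ 2.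
Proof.
move=> gu lu Xl Xx s0 s1; have Xs : X (l + s *: (x - l)) by apply: cX => //; rewrite s0.
have := joint_remainder cX gu lu b b Xl Xs.
rewrite addrKC subrr dotv0r subr0 dotvZr l2norm_col_mx0 l2normZ exprMn (ger0_norm s0).
by rewrite scale0r addr0 [s ^+ 2 * _]mulrC mulrA.
Qed.

Lemma outer_remainder_b u ul ub L l (b v : 'cV[R]_d2) s : is_gradient X u ul ub ->
  lipschitz_joint X (@l2norm R (d1 + d2)) L (fun l b => col_mx (ul l b) (ub l b)) ->
  X l -> 0 <= s -> s <= 1 ->
  `|u l (b + s *: v) - u l (b + 0 *: v) - s * dotv (ub l b) v|
    <= L * l2norm v ^+ 2 * s ^+ 2.
Proof.
move=> gu lu Xl s0 s1.
have := joint_remainder cX gu lu b (b + s *: v) Xl Xl.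
rewrite addrKC subrr dotv0r subr0 dotvZr l2norm_col_0mx l2normZ exprMn (ger0_norm s0).
by rewrite scale0r addr0 [s ^+ 2 * _]mulrC mulrA.
Qed.

Context (g : 'cV[R]_d1 -> 'cV[R]_d2 -> R) (gl : 'cV[R]_d1 -> 'cV[R]_d2 -> 'cV[R]_d1)
  (gb : 'cV[R]_d1 -> 'cV[R]_d2 -> 'cV[R]_d2)
  (glb : 'cV[R]_d1 -> 'cV[R]_d2 -> 'M[R]_(d1, d2))
  (gbb : 'cV[R]_d1 -> 'cV[R]_d2 -> 'M[R]_d2) (L M : R).
Hypothesis M_ge0 : 0 <= M.
Hypothesis sg : smooth_inner X L M g gl gb glb gbb.

Lemma inner_remainder_l l x b s i : X l -> X x -> 0 <= s -> s <= 1 ->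
  `|gb (l + s *: (x - l)) b i 0 - gb (l + 0 *: (x - l)) b i 0
     - s * ((glb l b)^T *m (x - l)) i 0| <= M * l2norm (x - l) ^+ 2 * s ^+ 2.
Proof.
move=> Xl Xx s0 s1; have Xs : X (l + s *: (x - l)) by apply: cX => //; rewrite s0.
have := le_trans (normr_coord_le _ i) (cross_remainder cX M_ge0 sg b Xl Xs).
rewrite addrKC l2normZ exprMn (ger0_norm s0) -scalemxAr scale0r addr0.
by rewrite !mxE [s ^+ 2 * _]mulrC mulrA.
Qed.

Lemma inner_remainder_b l (b v : 'cV[R]_d2) s i : X l -> 0 <= s -> s <= 1 ->
  `|gb l (b + s *: v) i 0 - gb l (b + 0 *: v) i 0
     - s * (gbb l b *m v) i 0| <= M * l2norm v ^+ 2 * s ^+ 2.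
Proof.
move=> Xl s0 s1.
have := le_trans (normr_coord_le _ i) (hessian_remainder M_ge0 sg b (b + s *: v) Xl).
rewrite addrKC l2normZ exprMn (ger0_norm s0) -scalemxAr scale0r addr0.
by rewrite !mxE [s ^+ 2 * _]mulrC mulrA.
Qed.

End SegmentRemainders.

Section Laws.
Context (R : realType) d d' (Om : measurableType d) (U : measurableType d')
  (P : probability Om R) (x : Om -> U) (nu : probability U R).
Hypothesis xlaw : has_law P x nu.

Let mx : measurable_fun setT x := xlaw.1.
Let Xm : {mfun Om >-> U} := HB.pack x (isMeasurableFun.Build _ _ _ _ _ mx).

Let law_integral_ge0 (h : U -> \bar R) : measurable_fun setT h -> (forall u, 0 <= h u)%E ->
  (\int[P]_o h (x o) = \int[nu]_u h u)%E.
Proof.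
move=> mh h0; transitivity (\int[distribution P Xm]_u h u)%E.
  by rewrite (@ge0_integral_pushforward _ _ Om _ R x mx P setT h).
by apply: eq_measure_integral => A mA _; exact: xlaw.2.
Qed.

Lemma law_integral (h : U -> \bar R) : measurable_fun setT h ->
  (\int[P]_o h (x o) = \int[nu]_u h u)%E.
Proof.
move=> mh; rewrite integralE [RHS]integralE -!law_integral_ge0//.
- by congr (_ - _)%E; apply: eq_integral => o _; rewrite ?funeposE ?funenegE.
- exact: measurable_funeneg.
- exact: measurable_funepos.
Qed.

Lemma law_integrable (h : U -> R) : nu.-integrable setT (EFin \o h) ->
  P.-integrable setT (EFin \o (fun o => h (x o))).
Proof.
move=> /integrableP[mh hoo]; apply/integrableP; split.
  exact: (measurableT_comp mh mx).
apply: le_lt_trans hoo; rewrite le_eqVlt -law_integral ?eqxx//.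
by apply: measurableT_comp.
Qed.

Lemma law_Rintegral (h : U -> R) : measurable_fun setT h ->
  \int[P]_o h (x o) = \int[nu]_u h u.
Proof. by move=> mh; congr fine; apply: law_integral; exact/measurable_EFinP. Qed.

End Laws.

Section Continuity.
Context (R : realType) (n : nat) (A : set 'cV[R]_n) (a : 'cV[R]_n).

(** The continuity hypothesis of [measurable_caratheodory] at one point, isolated so that it can be
    checked term by term. *)
Definition continuous_relative (F : 'cV[R]_n -> R) : Prop :=
  forall e, 0 < e -> exists2 r, 0 < r & forall b, A b -> l2norm (b - a) < r -> `|F b - F a| <= e.

Definition mcontinuous_relative p q (F : 'cV[R]_n -> 'M[R]_(p, q)) : Prop :=
  forall i j, continuous_relative (fun z => F z i j).

Lemma continuous_relative_lipschitz F L :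
  (forall b, A b -> `|F b - F a| <= L * l2norm (b - a)) -> continuous_relative F.
Proof.
move=> lF e e0; exists (e / (1 + `|L|)) => [|b Ab]; first by rewrite divr_gt0// ltr_pwDl.
rewrite ltr_pdivlMr ?ltr_pwDl// => H; rewrite (le_trans (lF b Ab))//.
have := ler_norm L; have := l2norm_ge0 (b - a); nra.
Qed.

Lemma continuous_relative_cst c : continuous_relative (fun=> c).
Proof. by move=> e e0; exists 1 => // b _ _; rewrite subrr normr0 ltW. Qed.

Lemma continuous_relativeD F G :
  continuous_relative F -> continuous_relative G -> continuous_relative (fun z => F z + G z).
Proof.
move=> cF cG e e0; have e2 : 0 < e / 2 by lra.
have [r r0 Hr] := cF _ e2; have [r' r'0 Hr'] := cG _ e2.
exists (Num.min r r') => [|b Ab]; first by rewrite lt_min r0.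
rewrite lt_min => /andP[/(Hr _ Ab) h /(Hr' _ Ab) h'].
by move: h h'; rewrite !ler_norml; lra.
Qed.

Lemma continuous_relativeM F G :
  continuous_relative F -> continuous_relative G -> continuous_relative (fun z => F z * G z).
Proof.
move=> cF cG e e0.
pose k := 1 + `|F a| + `|G a|.
have k0 : 0 < k by rewrite /k -addrA ltr_pwDl// addr_ge0.
have e1 : 0 < Num.min 1 (e / k) by rewrite lt_min ltr01 divr_gt0.
have [r r0 Hr] := cF _ e1; have [r' r'0 Hr'] := cG _ e1.
exists (Num.min r r') => [|b Ab]; first by rewrite lt_min r0.
rewrite lt_min => /andP[/(Hr _ Ab) + /(Hr' _ Ab)].
rewrite !le_min => /andP[_ h] /andP[h1 h'].
have -> : F b * G b - F a * G a = (F b - F a) * G b + F a * (G b - G a) by ring.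
rewrite (le_trans (ler_normD _ _))// !normrM.
have g1 : `|G b| <= 1 + `|G a|.
  by rewrite -[G b](subrK (G a)) (le_trans (ler_normD _ _))// lerD2r.
have p1 : `|F b - F a| * `|G b| <= e / k * (1 + `|G a|) by rewrite ler_pM.
have p2 : `|F a| * `|G b - G a| <= `|F a| * (e / k) by rewrite ler_wpM2l.
apply: le_trans (lerD p1 p2) _; rewrite le_eqVlt; apply/orP; left; apply/eqP.
by rewrite mulrC -mulrDl -[RHS](mulfVK (lt0r_neq0 k0)) mulrC /k; congr (_ * _); ring.
Qed.

Lemma continuous_relative_sum (I : Type) (r : seq I) (F : I -> 'cV[R]_n -> R) :
  (forall i, continuous_relative (F i)) -> continuous_relative (fun z => \sum_(i <- r) F i z).
Proof.
move=> cF; elim: r => [|i r IH].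
  by under eq_fun do rewrite big_nil; exact: continuous_relative_cst.
by under eq_fun do rewrite big_cons; exact: continuous_relativeD.
Qed.

Lemma mcontinuous_relative_cst p q (M : 'M[R]_(p, q)) : mcontinuous_relative (fun=> M).
Proof. by move=> i j; exact: continuous_relative_cst. Qed.

Lemma mcontinuous_relativeZ p q c (F : 'cV[R]_n -> 'M[R]_(p, q)) :
  mcontinuous_relative F -> mcontinuous_relative (fun z => c *: F z).
Proof.
move=> cF i j; under eq_fun do rewrite mxE.
by apply: continuous_relativeM => //; exact: continuous_relative_cst.
Qed.

Lemma mcontinuous_relativeB p q (F G : 'cV[R]_n -> 'M[R]_(p, q)) :
  mcontinuous_relative F -> mcontinuous_relative G -> mcontinuous_relative (fun z => F z - G z).
Proof.
move=> cF cG i j; under eq_fun do rewrite mxE -scaleN1r.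
by apply: continuous_relativeD => //; exact: (mcontinuous_relativeZ _ cG).
Qed.

Lemma mcontinuous_relative_mul p q s (F : 'cV[R]_n -> 'M[R]_(p, q)) (G : 'cV[R]_n -> 'M[R]_(q, s)) :
  mcontinuous_relative F -> mcontinuous_relative G -> mcontinuous_relative (fun z => F z *m G z).
Proof.
move=> cF cG i j; under eq_fun do rewrite mxE.
by apply: continuous_relative_sum => k; exact: continuous_relativeM.
Qed.

Lemma mcontinuous_relative_prod p (I : Type) (r : seq I) (F : I -> 'cV[R]_n -> 'M[R]_p) :
  (forall i, mcontinuous_relative (F i)) -> mcontinuous_relative (fun z => \prod_(i <- r) F i z).
Proof.
move=> cF; elim: r => [|i r IH].
  by under eq_fun do rewrite big_nil; exact: mcontinuous_relative_cst.
by under eq_fun do rewrite big_cons; exact: mcontinuous_relative_mul.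
Qed.

Lemma mcontinuous_relative_vlipschitz p (F : 'cV[R]_n -> 'cV[R]_p) L :
  (forall b, A b -> l2norm (F b - F a) <= L * l2norm (b - a)) -> mcontinuous_relative F.
Proof.
move=> lF i j; rewrite ord1; apply: (@continuous_relative_lipschitz _ L) => b Ab.
apply: le_trans (lF b Ab); rewrite (le_trans _ (normr_coord_le _ i))//.
by rewrite [X in _ <= `|X|]mxE [X in _ <= `|_ + X|]mxE.
Qed.

Lemma mcontinuous_relative_lipschitz p q (F : 'cV[R]_n -> 'M[R]_(p, q)) L :
  (forall b, A b -> opnorm (F b - F a) <= L * l2norm (b - a)) -> mcontinuous_relative F.
Proof.
move=> lF i j; apply: (@continuous_relative_lipschitz _ L) => b Ab.
apply: le_trans (lF b Ab); rewrite (le_trans _ (normr_entry_le _ i j))//.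
by rewrite [X in _ <= `|X|]mxE [X in _ <= `|_ + X|]mxE.
Qed.

End Continuity.

(** Lists the [minn w t] rounds of a window from the oldest on, the order in which the noise of a
    round is fresh for the sum of the earlier ones. *)
Lemma window_sum (V : nmodType) (F : nat -> V) w t :
  \sum_(i < w | (i < t)%N) F (t - i)%N = \sum_(i < minn w t) F ((t - minn w t).+1 + i)%N.
Proof.
rewrite -(big_mkord (fun i => i < t)%N (fun i => F (t - i)%N)).
rewrite -(big_mkord xpredT (fun i => F ((t - minn w t).+1 + i)%N)) [RHS]big_nat_rev/=.
rewrite [RHS](big_nat_widen _ _ _ _ _ (geq_minl w t)) big_nat_cond [RHS]big_nat_cond.
apply: eq_big => i; first by rewrite ltn_min; case: (i < w)%N.
case/andP => /andP[_ iw] it; congr F.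
have : (i < minn w t)%N by rewrite ltn_min iw.
have := geq_minr w t; move: (minn w t) => n nt ni.
by rewrite add0n addSn -addnS -subSn// subSS addnBA ?subnK// ltnW.
Qed.

(** Substitution [s = t - i]: round [s] meets the windows ending at [s, ..., s + w - 1], cut off at
    [n]. *)
Lemma swap_window_sum (V : nmodType) (F : nat -> nat -> V) w n :
  \sum_(1 <= t < n.+1) \sum_(i < w | (i < t)%N) F (t - i)%N t =
  \sum_(1 <= s < n.+1) \sum_(i < w | (s + i <= n)%N) F s (s + i)%N.
Proof.
rewrite (exchange_big_dep xpredT)//= [RHS](exchange_big_dep xpredT)//=.
apply: eq_bigr => i _.
transitivity (\sum_(1 + i <= t < n.+1) F (t - i)%N t).
  by rewrite [RHS](@big_nat_widenl _ _ _ _ 1).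
rewrite big_addn (big_nat_widen _ _ n.+1) ?leq_subr//.
apply: eq_big => s; first by rewrite ltn_subRL addnC ltnS.
by rewrite addnK.
Qed.

Lemma window_telescope (V : zmodType) (x : nat -> V) w s n : (s <= n.+1)%N ->
  \sum_(i < w | (s + i <= n)%N) (x (s + i)%N - x (s + i).+1) = x s - x (minn (s + w) n.+1).
Proof.
move=> sn; elim: w => [|w IH]; first by rewrite big_ord0 addn0 (minn_idPl sn) subrr.
rewrite big_mkcond big_ord_recr/= -big_mkcond IH addnS.
case: (leqP (s + w) n) => swn.
  by rewrite (minn_idPl (leqW swn)) (minn_idPl _)// subrKA.
by rewrite addr0 (minn_idPr _)// (minn_idPr _)// ltnW.
Qed.

(** * Calculus of bounds on means, and recursions *)

Section MeanBounds.
Context (R : realType) d (Om : measurableType d) (P : probability Om R).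

(** Bundles measurability and sign with a real bound, so that means are added and compared without
    separate finiteness arguments. *)
Definition mean_bound (f : Om -> R) (c : R) : Prop :=
  [/\ measurable_fun setT f, forall o, 0 <= f o & (\int[P]_o (f o)%:E <= c%:E)%E].

Lemma mean_boundD f g a b :
  mean_bound f a -> mean_bound g b -> mean_bound (fun o => f o + g o) (a + b).
Proof.
move=> [mf f0 fa] [mg g0 gb]; split=> [|o|]; [exact: measurable_funD|exact: addr_ge0|].
under eq_integral do rewrite EFinD.
rewrite ge0_integralD//; first by rewrite EFinD leeD.
all: try (by move=> o _; rewrite lee_fin).
all: exact/measurable_EFinP.
Qed.

Lemma mean_boundZ k f a : 0 <= k -> mean_bound f a -> mean_bound (fun o => k * f o) (k * a).
Proof.
move=> k0 [mf f0 fa]; split=> [|o|]; [exact: measurable_funM|exact: mulr_ge0|].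
under eq_integral do rewrite EFinM.
rewrite ge0_integralZl_EFin//; first by rewrite EFinM; apply: lee_wpmul2l.
  by move=> o _; rewrite lee_fin.
exact/measurable_EFinP.
Qed.

Lemma mean_bound_cst c : 0 <= c -> mean_bound (fun=> c) c.
Proof. by move=> c0; split=> //; rewrite integral_cst// [X in (_ * X <= _)%E]probability_setT mule1. Qed.

Lemma mean_bound_sum (I : eqType) (r : seq I) (F : I -> Om -> R) a :
  (forall i, i \in r -> mean_bound (F i) (a i)) ->
  mean_bound (fun o => \sum_(i <- r) F i o) (\sum_(i <- r) a i).
Proof.
elim: r => [|i r IH] H.
  rewrite big_nil (_ : (fun o => _) = cst 0); first exact: mean_bound_cst.
  by apply/funext => o; rewrite big_nil.
rewrite big_cons (_ : (fun o => _) = fun o => F i o + \sum_(j <- r) F j o); last first.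
  by apply/funext => o; rewrite big_cons.
apply: mean_boundD; first by apply: H; rewrite mem_head.
by apply: IH => j jr; apply: H; rewrite inE jr orbT.
Qed.

Lemma mean_bound_le (f g : Om -> R) a b : measurable_fun setT f -> (forall o, 0 <= f o) ->
  (forall o, f o <= g o) -> a <= b -> mean_bound g a -> mean_bound f b.
Proof.
move=> mf f0 fg ab [mg g0 ga]; split=> //; apply: le_trans (_ : (a%:E <= _)%E); last by rewrite lee_fin.
by apply: le_trans ga; apply: ge0_lower_integral_le => o; rewrite lee_fin.
Qed.

Lemma mean_bound_ge0 f a : mean_bound f a -> 0 <= a.
Proof.
move=> [_ f0 fa]; rewrite -lee_fin; apply: le_trans fa.
by apply: integral_ge0 => o _; rewrite lee_fin.
Qed.

(** The [a i] are the actual means, finite since nonnegative terms lie below their sum. A bound on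
    the total movement can thus be fed round by round into a recursion. *)
Lemma mean_bound_split (I : eqType) (r : seq I) (F : I -> Om -> R) c :
  (forall i, i \in r -> measurable_fun setT (F i)) ->
  (forall i o, i \in r -> 0 <= F i o) ->
  mean_bound (fun o => \sum_(i <- r) F i o) c ->
  exists2 a, forall i, i \in r -> mean_bound (F i) (a i) & \sum_(i <- r) a i <= c.
Proof.
move=> mF F0 Fc.
have fin i : i \in r -> (\int[P]_o (F i o)%:E \is a fin_num)%E.
  move=> ir; rewrite ge0_fin_numE; last by apply: integral_ge0 => o _; rewrite lee_fin F0.
  apply: (@le_lt_trans _ _ c%:E); last exact: ltry.
  have [_ _ +] := Fc; apply: le_trans; apply: ge0_lower_integral_le => o; rewrite lee_fin ?F0//.
  by rewrite (big_rem i ir)/= lerDl big_seq sumr_ge0// => j /mem_rem jr; exact: F0.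
exists (fun i => fine (\int[P]_o (F i o)%:E)%E) => [i ir|].
  split=> [|o|]; [exact: mF|exact: F0|by rewrite fineK// fin].
elim: r c mF F0 fin {Fc} (let: And3 _ _ h := Fc in h) => [|i r IH] c mF F0 fin Fc.
  by rewrite big_nil -lee_fin; apply: le_trans Fc; apply: integral_ge0 => o _; rewrite big_nil.
have sub j : j \in r -> j \in i :: r by rewrite inE orbC => ->.
rewrite big_cons -lerBrDl; apply: IH => [j /sub|j o /sub|j /sub|]; [exact: mF|exact: F0|exact: fin|].
have ir := mem_head i r.
rewrite EFinB fineK ?fin// leeBrDl ?fin//; apply: le_trans Fc.
under [leRHS]eq_integral do rewrite big_cons EFinD.
rewrite ge0_integralD//.
- by move=> o _; rewrite lee_fin F0.
- by apply/measurable_EFinP; exact: mF.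
- by move=> o _; rewrite lee_fin big_seq sumr_ge0// => j /sub; exact: F0.
- apply/measurable_EFinP; under eq_fun do rewrite big_seq.
  by apply: measurable_big_sum => j /sub; exact: mF.
Qed.

(** Jensen's inequality from [y^2 >= 2 a y - a^2]. The weight stays [1 / w] even if [Q] keeps fewer
    than [w] terms, as in the first windows. *)
Lemma square_mean_le w (Q : pred 'I_w) (x : 'I_w -> R) : (0 < w)%N ->
  (w%:R^-1 * \sum_(i < w | Q i) x i) ^+ 2 <= w%:R^-1 * \sum_(i < w | Q i) x i ^+ 2.
Proof.
move=> w0; have wR : (0 : R) < w%:R by rewrite ltr0n.
set a := w%:R^-1 * _.
have H : \sum_(i < w | Q i) (a * x i *+ 2 - a ^+ 2) <= \sum_(i < w | Q i) x i ^+ 2.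
  by apply: ler_sum => i _; rewrite -subr_ge0; have := sqr_ge0 (x i - a); rewrite sqrrB; lra.
rewrite ler_pdivlMl//; apply: le_trans H; rewrite sumrB sumrMnl -mulr_sumr sumr_const.
have -> : \sum_(i < w | Q i) x i = w%:R * a by rewrite /a mulrA mulfV ?gt_eqF// mul1r.
have Qw : (#|[pred i | Q i]| <= w)%N by rewrite -[leqRHS]card_ord max_card.
have : a ^+ 2 *+ #|[pred i | Q i]| <= w%:R * a ^+ 2.
  by rewrite -[leLHS]mulr_natl ler_wpM2r ?sqr_ge0// ler_nat.
by move: (a ^+ 2 *+ _) => c; rewrite -[a * _ *+ 2]mulr_natl; nra.
Qed.

Lemma square_sum_le (a b x : R) : 0 < x ->
  (a + b) ^+ 2 <= (1 + x) * a ^+ 2 + (1 + x^-1) * b ^+ 2.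
Proof.
move=> x0; have : 0 <= x^-1 * (x * a - b) ^+ 2 by rewrite mulr_ge0 ?sqr_ge0 ?invr_ge0 ?ltW.
suff -> : x^-1 * (x * a - b) ^+ 2 = (1 + x) * a ^+ 2 + (1 + x^-1) * b ^+ 2 - (a + b) ^+ 2.
  by rewrite subr_ge0.
by field; rewrite gt_eqF.
Qed.

(** The recursion is summed instead of solved: [x (p 0 + ... + p (n - 1)) + p n] equals [p 0] plus
    the sum of the inputs. *)
Lemma linear_recursion_sum (x : R) (p u : nat -> R) n : 0 < x -> x <= 1 ->
  0 <= p n -> (forall i, (i < n)%N -> p i.+1 = (1 - x) * p i + u i) ->
  \sum_(i < n.+1) p i <= x^-1 * (p 0 + \sum_(i < n) u i).
Proof.
move=> x0 x1 p0 pS.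
have H : x * \sum_(i < n) p i + p n = p 0 + \sum_(i < n) u i.
  elim: n pS {p0} => [|n IH] pS; first by rewrite !big_ord0 mulr0 addrC.
  rewrite !big_ord_recr/= addrA -IH; last by move=> i /leqW; exact: pS.
  by rewrite pS//; ring.
rewrite ler_pdivlMl// -H big_ord_recr/= mulrDr lerD2l.
by rewrite -[leRHS]mul1r ler_wpM2r.
Qed.

End MeanBounds.

(** * Truncation length and the constants of the rate *)

Section Rate.
Context (R : realType).

Lemma neumann_size_rate (lg1 mu : R) w : 0 < mu -> mu <= lg1 -> (0 < w)%N ->
  (1 - mu / lg1) ^+ neumann_size lg1 mu w <= w%:R^-1.
Proof.
move=> mu0 muL w0; have L0 : 0 < lg1 := lt_le_trans mu0 muL.
have wR : (0 : R) < w%:R by rewrite ltr0n.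
rewrite /neumann_size addn1; set n := `|_|%N.
(* For [mu = lg1] the base is [0], and the extra [+ 1] in the size makes the exponent positive, so
   the power vanishes. *)
have [Emu|mu_ne] := eqVneq mu lg1.
  by rewrite Emu mulfV ?gt_eqF// subrr exprS mul0r invr_ge0 ltW.
have q0 : 0 < 1 - mu / lg1 by rewrite subr_gt0 ltr_pdivrMr ?mul1r// lt_neqAle mu_ne.
have q1 : 1 - mu / lg1 < 1 by rewrite gtrBl divr_gt0.
move: q0 q1 @n; set q := 1 - _ => q0 q1 n.
have l0 : 0 < ln q^-1 by rewrite ln_gt0// invf_gt1.
have nle : ln w%:R / ln q^-1 <= n%:R.
  apply: le_trans (ceil_ge _) _; rewrite /n natr_absz.
  by rewrite ler_int ler_norm.
rewrite exprS; apply: (@le_trans _ _ (q ^+ n)).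
  by rewrite -[leRHS]mul1r ler_wpM2r ?exprn_ge0 ?ltW.
rewrite -ler_ln ?posrE ?exprn_gt0 ?invr_gt0// lnXn// lnV ?posrE//.
move: nle; rewrite ler_pdivrMr// lnV ?posrE// mulrN -mulr_natl; lra.
Qed.

Lemma sup_nonneg (A : set R) : (forall x, A x -> 0 <= x) -> 0 <= sup A.
Proof.
move=> A0; have [hA|nA] := pselect (has_sup A); last by rewrite sup_out.
have [[x Ax] ub] := hA; exact: le_trans (A0 x Ax) (ub_le_sup ub Ax).
Qed.

Context (lf0 lf1 lg1 lg2 rho S eta alpha : R) (K : nat).

(* Rules out arbitrarily small mu: alpha <= 3 rho / (4 l_F1) and lf1 kappa_g <= l_F1. *)
Definition kappa_max := Num.max 1 (3 * rho / (4 * alpha * lf1)).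

Lemma kappa_g_le mu : 0 <= lf0 -> 0 < lf1 -> 0 < lg1 -> 0 <= lg2 -> 0 < rho -> 0 < alpha ->
  0 < mu -> alpha <= alpha_max lf0 lf1 lg1 lg2 mu rho eta K -> lg1 / mu <= kappa_max.
Proof.
move=> f0 f1 L0 g2 r0 a0 mu0; rewrite /alpha_max le_min => /andP[+ _] => Ha.
rewrite le_max; apply/orP; right.
have kg0 : 0 < lg1 / mu by rewrite divr_gt0.
have c0 : 0 <= lf0 * lg2 / mu by rewrite divr_ge0 ?mulr_ge0 ?(ltW mu0).
have k1 : 0 <= 1 + lg1 / mu by rewrite addr_ge0 ?ltW.
have F1 : lf1 * (lg1 / mu) <= l_F1 lf0 lf1 lg1 lg2 mu.
  rewrite /l_F1 /M_f /kappa_g -addrA [leRHS]addrC.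
  have h1 : 0 <= lf0 * lg2 / mu * (1 + lg1 / mu) by exact: mulr_ge0.
  have h2 : 0 <= lf1 * (lg1 / mu) by exact: mulr_ge0 (ltW f1) (ltW kg0).
  have h3 : 0 <= (lf1 + lf1 * (lg1 / mu) + lf0 * lg2 / mu * (1 + lg1 / mu)) * (lg1 / mu).
    by rewrite mulr_ge0 ?(ltW kg0) ?addr_ge0 ?(ltW f1).
  by lra.
have F0 : 0 < l_F1 lf0 lf1 lg1 lg2 mu by apply: lt_le_trans F1; rewrite mulr_gt0.
move: Ha; rewrite ler_pdivlMr ?mulr_gt0// => Ha.
rewrite ler_pdivlMr ?mulr_gt0//; apply: le_trans Ha.
have := ler_wpM2l (ltW a0) F1; lra.
Qed.

Section Constants.
Context (gap_h gap_beta : R).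

(** This and the following majorants come from the budgets of the run, with [kappa_g] replaced by
    [kappa_max] and [T / w], the variances and [H2] factored out; hence they are free of [mu], [T]
    and [w]. *)
Definition movement_rate := 2 * alpha / rho * (lf0 * S * (1 + kappa_max) + gap_h).

(** Bounds [(eta mu)^-1 = kappa_g / (eta lg1)], the number of rounds over which a tracking error
    persists. *)
Definition memory_max := kappa_max / (eta * lg1).

Definition inner_rate := memory_max *
  (gap_beta ^+ 2 + 2 * (K%:R * eta ^+ 2) +
   2 * (1 + memory_max) * (kappa_max ^+ 2 * movement_rate + 1)) + K%:R * eta ^+ 2.

(** [M_f] with [lg2 / mu] rewritten as [lg2 kappa_g / lg1], so that [mu] enters through [kappa_g]
    alone. *)
Definition M_max := lf1 + lf1 * kappa_max + lf0 * lg2 * kappa_max / lg1 * (1 + kappa_max).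

Definition rate_constant := 2 / alpha ^+ 2 * movement_rate +
  2 / rho ^+ 2 * (2 + 2 * (2 * M_max ^+ 2 * inner_rate + 2 * (kappa_max * lf0) ^+ 2)).

End Constants.
End Rate.

(** * The run of the algorithm *)

(* [mu <= lg1] can only fail for d2 = 0; that case is covered by taking [mu := lg1] and
   [sg := 0], for which these hypotheses still hold. *)
Record run_setting (R : realType) (d1 d2 : nat) (dE dZ dO : measure_display)
    (E : measurableType dE) (Z : measurableType dZ) (Omega : measurableType dO)
    (P : probability Omega R) (pb : problem R d1 d2 E Z) (smp : samples Omega E Z)
    (T K w m : nat) (lf0 lf1 lg1 lg2 rho S eta alpha mu sf sg : R)
    (lam1 : 'cV[R]_d1) (beta1 : 'cV[R]_d2)
    (lam : nat -> Omega -> 'cV[R]_d1) (beta : nat -> Omega -> 'cV[R]_d2) : Prop :=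
  RunSetting {
    rs_lf0 : 0 <= lf0;
    rs_lf1 : 0 < lf1;
    rs_lg1 : 0 < lg1;
    rs_lg2 : 0 <= lg2;
    rs_rho : 0 < rho;
    rs_eta : 0 < eta;
    rs_alpha : 0 < alpha;
    rs_K : (1 <= K)%N;
    rs_mu : 0 < mu;
    rs_mu_le : mu <= lg1;
    rs_sf : 0 <= sf;
    rs_sg : 0 <= sg;
    rs_w : (1 <= w <= T)%N;
    rs_m : (0 < m)%N;
    rs_neumann : (1 - mu / lg1) ^+ m <= w%:R^-1;
    rs_random : random_objectives pb T;
    rs_reg : convex_regularizer pb;
    rs_steps : bregman_steps_exist pb T alpha;
    rs_A : assumptionA pb T lf0 lf1 lg1 lg2;
    rs_B : assumptionB pb T mu;
    rs_C : assumptionC pb P smp T m lg1 sf sg;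
    rs_D : assumptionD pb S;
    rs_F : assumptionF pb T rho;
    rs_step_size : eta <= 2 / (lg1 + mu);
    rs_indep : independent_draws pb P smp T K w m;
    rs_init : dom pb lam1;
    rs_run : sobbo pb smp T K w m w lg1 eta alpha lam1 beta1 lam beta }.

Section Run.
Context (R : realType) (d1 d2 : nat) (dE dZ dO : measure_display)
  (E : measurableType dE) (Z : measurableType dZ) (Omega : measurableType dO)
  (P : probability Omega R) (pb : problem R d1 d2 E Z) (smp : samples Omega E Z)
  (T K w m : nat) (lf0 lf1 lg1 lg2 rho S eta alpha mu sf sg : R)
  (lam1 : 'cV[R]_d1) (beta1 : 'cV[R]_d2)
  (lam : nat -> Omega -> 'cV[R]_d1) (beta : nat -> Omega -> 'cV[R]_d2).
Hypothesis HS : run_setting P pb smp T K w m lf0 lf1 lg1 lg2 rho S eta alpha mu sf sg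
  lam1 beta1 lam beta.
Local Notation X := (dom pb).

Lemma dom_segment_closed : segment_closed X.
Proof. by case: (rs_D HS) => _ cX _; exact: convex_set_segment. Qed.
Local Notation cX := dom_segment_closed.

Section Round.
Context (t : nat) (l : 'cV[R]_d1) (b : 'cV[R]_d2).
Hypothesis tT : (1 <= t <= T.+1)%N.
Hypothesis Xl : X l.

Lemma betahat_argmin : is_argmin setT (gmean pb t l) (betahat pb t l).
Proof.
have [_ _ _ [ul [ub [ulb [ubb sgm]]]]] := rs_A HS tT.
have [gg _ lg _ _] := sgm.
have [x argx] := @strongly_convex_argmin R d2 (gmean pb t l) (ub l) mu lg1 (rs_mu HS) (rs_mu_le HS)
  (fun z => partial_gradient gg z Xl)
  (fun z z' => partial_gradient_lipschitz_b (ul := ul) (ub := ub) lg z z' Xl) (rs_B HS tT Xl).1.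
by apply: (@getPex _ [set x | is_argmin setT (gmean pb t l) x]); exists x.
Qed.

Lemma betahat_critical ul ub ulb ubb : smooth_inner X lg1 lg2 (gmean pb t) ul ub ulb ubb ->
  ub l (betahat pb t l) = 0.
Proof.
by case=> gg _ _ _ _; exact: (argminT_gradient betahat_argmin (partial_gradient gg _ Xl)).
Qed.

Lemma grad_on_gmean ul ub ulb ubb : smooth_inner X lg1 lg2 (gmean pb t) ul ub ulb ubb ->
  grad_on setT (gmean pb t l) b = ub l b.
Proof.
case=> gg _ _ _ _; have gb := partial_gradient gg b Xl.
have gG : gradient_at setT (gmean pb t l) b (grad_on setT (gmean pb t l) b).
  by apply: (@getPex _ [set v | gradient_at setT (gmean pb t l) b v]); exists (ub l b).
apply/matrixP => i j; rewrite ord1.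
have := gradient_unique (@segment_closedT R d2) (I : setT b) (I : setT (b + delta_mx i 0)) gG gb.
by rewrite addrKC !dotv_delta.
Qed.

Lemma obj_f_integrable : (lawE pb).-integrable setT (EFin \o (fun e => obj_f pb t e l b)).
Proof. by case: (rs_random HS b tT Xl) => -[]. Qed.

End Round.

(** * Means of the sampled derivatives *)

Section MeanDifferentials.
Let lf1_ge0 : 0 <= lf1. Proof. exact: ltW (rs_lf1 HS). Qed.
Let lg2_ge0 : 0 <= lg2. Proof. exact: rs_lg2 HS. Qed.

Section Round.
Context (t : nat).
Hypothesis tT : (1 <= t <= T)%N.

Let tT1 : (1 <= t <= T.+1)%N.
Proof. by case/andP: tT => -> /leqW ->. Qed.

Let segm_in l x s : X l -> X x -> 0 <= s -> s <= 1 -> X (l + s *: (x - l)).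
Proof. by move=> Xl Xx s0 s1; apply: cX => //; rewrite s0. Qed.

Section Outer.
Context ul ub (so : smooth_outer X lf0 lf1 (fmean pb t) ul ub).

(** Only directions that stay in [X] can be differentiated, so [x - y] is written as the difference
    of [x - l] and [y - l]. *)
Lemma mean_outer_gradient_l l x y b : X l -> X x -> X y ->
  (lawE pb).-integrable setT (EFin \o (fun e => dotv (obj_fl pb t e l b) (x - y))) /\
  \int[lawE pb]_e dotv (obj_fl pb t e l b) (x - y) = dotv (ul l b) (x - y).
Proof.
move=> Xl Xx Xy.
have base z : X z ->
    (lawE pb).-integrable setT (EFin \o (fun e => dotv (obj_fl pb t e l b) (z - l))) /\
    \int[lawE pb]_e dotv (obj_fl pb t e l b) (z - l) = dotv (ul l b) (z - l).
  move=> Xz; have c0 : 0 <= lf1 * l2norm (z - l) ^+ 2 by rewrite mulr_ge0 ?sqr_ge0.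
  apply: (@mean_first_order R _ _ _ (fun s e => obj_f pb t e (l + s *: (z - l)) b)
    _ _ _ _ c0 c0).
  - apply: measurable_dotv; last exact: vmeasurable_cst.
    by case: (rs_random HS b tT1 Xl) => -[].
  - by move=> s s0 s1; apply: (obj_f_integrable b tT1); exact: segm_in.
  - move=> s e s0 s1; have [ho _ _ _] := rs_A HS tT1; have [g1 _ g2] := ho e.
    exact: (outer_remainder_l cX b g1 g2).
  - move=> s s0 s1; have [g1 _ g2] := so.
    exact: (outer_remainder_l cX b g1 g2 Xl Xz (ltW s0) s1).
have [ix ex] := base x Xx; have [iy ey] := base y Xy.
have split_dir e : dotv (obj_fl pb t e l b) (x - y) =
    dotv (obj_fl pb t e l b) (x - l) - dotv (obj_fl pb t e l b) (y - l).
  by rewrite -dotvBr opprB addrA subrK.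
have -> : (fun e => dotv (obj_fl pb t e l b) (x - y)) =
    fun e => dotv (obj_fl pb t e l b) (x - l) + - 1 * dotv (obj_fl pb t e l b) (y - l).
  by apply/funext => e; rewrite split_dir mulN1r.
split; first exact/integrable_add/integrable_scale.
rewrite RintegralD//; last exact: integrable_scale.
by rewrite RintegralZl// ex ey mulN1r -dotvBr opprB addrA subrK.
Qed.

Lemma mean_outer_gradient_b l b : X l ->
  vintegrable (lawE pb) (fun e => obj_fb pb t e l b) /\
  vmean (lawE pb) (fun e => obj_fb pb t e l b) = ub l b.
Proof.
move=> Xl.
have base i : (lawE pb).-integrable setT (EFin \o (fun e => obj_fb pb t e l b i 0)) /\
    \int[lawE pb]_e obj_fb pb t e l b i 0 = ub l b i 0.
  pose v : 'cV[R]_d2 := delta_mx i 0.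
  have -> : (fun e => obj_fb pb t e l b i 0) = fun e => dotv (obj_fb pb t e l b) v.
    by apply/funext => e; rewrite dotv_delta.
  rewrite -[ub l b i 0]dotv_delta -/v.
  have c0 : 0 <= lf1 * l2norm v ^+ 2 by rewrite mulr_ge0 ?sqr_ge0.
  apply: (@mean_first_order R _ _ _ (fun s e => obj_f pb t e l (b + s *: v))
    _ _ _ _ c0 c0).
  - apply: measurable_dotv; last exact: vmeasurable_cst.
    by case: (rs_random HS b tT1 Xl) => -[].
  - by move=> s s0 s1; exact: (obj_f_integrable _ tT1).
  - move=> s e s0 s1; have [ho _ _ _] := rs_A HS tT1; have [g1 _ g2] := ho e.
    exact: (outer_remainder_b cX b v g1 g2).
  - move=> s s0 s1; have [g1 _ g2] := so.
    exact: (outer_remainder_b cX b v g1 g2 Xl (ltW s0) s1).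
split=> [i|]; first by have [] := base i.
by apply/matrixP => i j; rewrite ord1 mxE (base i).2.
Qed.

End Outer.

Section Inner.
Context ul ub ulb ubb (si : smooth_inner X lg1 lg2 (gmean pb t) ul ub ulb ubb).

(** Here the mean is given by the unbiasedness assumption, and integrability follows from the finite
    variance. *)
Lemma mean_inner_gradient l b : X l ->
  vintegrable (lawZ pb) (fun z => obj_gb pb t z l b) /\
  vmean (lawZ pb) (fun z => obj_gb pb t z l b) = ub l b.
Proof.
move=> Xl; have [e v _] := rs_C HS b tT Xl.
rewrite -(grad_on_gmean b Xl si); split => //.
have mg : vmeasurable (fun z => obj_gb pb t z l b).
  by case: (rs_random HS b tT1 Xl) => _ [].
by have [] := vintegrable_of_variance mg v.
Qed.

(** Obtained by differentiating the mean of [obj_gb], known at every point of the segment, in place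
    of the objective itself. *)
Lemma mean_cross l x y b : X l -> X x -> X y ->
  vintegrable (lawZ pb) (fun z => (obj_glb pb t z l b)^T *m (x - y)) /\
  vmean (lawZ pb) (fun z => (obj_glb pb t z l b)^T *m (x - y)) = (ulb l b)^T *m (x - y).
Proof.
move=> Xl Xx Xy.
have base v i : X v -> (lawZ pb).-integrable setT
      (EFin \o (fun z => ((obj_glb pb t z l b)^T *m (v - l)) i 0)) /\
    \int[lawZ pb]_z ((obj_glb pb t z l b)^T *m (v - l)) i 0 = ((ulb l b)^T *m (v - l)) i 0.
  move=> Xv; have c0 : 0 <= lg2 * l2norm (v - l) ^+ 2 by rewrite mulr_ge0 ?sqr_ge0.
  apply: (@mean_first_order R _ _ _ (fun s z => obj_gb pb t z (l + s *: (v - l)) b i 0)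
    _ _ _ _ c0 c0).
  - have mg : mmeasurable (fun z => (obj_glb pb t z l b)^T).
      move=> a c; under eq_fun do rewrite mxE.
      by case: (rs_random HS b tT1 Xl) => _ [_ _ H _]; exact: H.
    exact: (mmeasurable_mul mg (mmeasurable_cst (v - l)) i 0).
  - by move=> s s0 s1; have [H _] := mean_inner_gradient b (segm_in Xl Xv s0 s1); exact: H.
  - move=> s z s0 s1; have [_ hi _ _] := rs_A HS tT1.
    exact: (inner_remainder_l cX lg2_ge0 (hi z)).
  - move=> s s0 s1; have := inner_remainder_l cX lg2_ge0 si b i Xl Xv (ltW s0) s1.
    have [_ <-] := mean_inner_gradient b (segm_in Xl Xv (ltW s0) s1).
    have [_ <-] := mean_inner_gradient b (segm_in Xl Xv (lexx 0) ler01).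
    by rewrite !mxE.
have split_dir z i : ((obj_glb pb t z l b)^T *m (x - y)) i 0 =
    ((obj_glb pb t z l b)^T *m (x - l)) i 0 + - 1 * ((obj_glb pb t z l b)^T *m (y - l)) i 0.
  have -> : x - y = (x - l) - (y - l) by rewrite opprB addrA subrK.
  by rewrite (mulmxBr _ (x - l)) mulN1r [LHS]mxE; congr (_ + _); rewrite [LHS]mxE.
have ii i : (lawZ pb).-integrable setT
    (EFin \o (fun z => ((obj_glb pb t z l b)^T *m (x - y)) i 0)) /\
    \int[lawZ pb]_z ((obj_glb pb t z l b)^T *m (x - y)) i 0 = ((ulb l b)^T *m (x - y)) i 0.
  have [ix ex] := base x i Xx; have [iy ey] := base y i Xy.
  under eq_fun do rewrite split_dir; split; first exact/integrable_add/integrable_scale.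
  rewrite RintegralD//; last exact: integrable_scale.
  rewrite RintegralZl// ex ey mulN1r.
  have -> : x - y = (x - l) - (y - l) by rewrite opprB addrA subrK.
  by rewrite (mulmxBr _ (x - l)) [RHS]mxE; congr (_ + _); rewrite [RHS]mxE.
split=> [i|]; first by have [] := ii i.
by apply/matrixP => i j; rewrite ord1 [LHS]mxE (ii i).2.
Qed.

Lemma mean_hessian l b i j : X l ->
  (lawZ pb).-integrable setT (EFin \o (fun z => obj_gbb pb t z l b i j)) /\
  \int[lawZ pb]_z obj_gbb pb t z l b i j = ubb l b i j.
Proof.
move=> Xl; pose v : 'cV[R]_d2 := delta_mx j 0.
have entryE (M : 'M[R]_d2) : M i j = (M *m v) i 0 by rewrite -colE mxE.
under eq_fun do rewrite entryE; rewrite entryE.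
have c0 : 0 <= lg2 * l2norm v ^+ 2 by rewrite mulr_ge0 ?sqr_ge0.
apply: (@mean_first_order R _ _ _ (fun s z => obj_gb pb t z l (b + s *: v) i 0)
    _ _ _ _ c0 c0).
- have mg : mmeasurable (fun z => obj_gbb pb t z l b).
    by case: (rs_random HS b tT1 Xl) => _ [].
  exact: (mmeasurable_mul mg (mmeasurable_cst v) i 0).
- by move=> s s0 s1; have [H _] := mean_inner_gradient (b + s *: v) Xl; exact: H.
- move=> s z s0 s1; have [_ hi _ _] := rs_A HS tT1.
  exact: (inner_remainder_b lg2_ge0 (hi z)).
- move=> s s0 s1; have := inner_remainder_b lg2_ge0 si b v i Xl (ltW s0) s1.
  have [_ <-] := mean_inner_gradient (b + s *: v) Xl.
  have [_ <-] := mean_inner_gradient (b + 0 *: v) Xl.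
  by rewrite !mxE.
Qed.

End Inner.
End Round.
End MeanDifferentials.

(** * Mean of the hypergradient estimate *)

Section EstimateMean.
Let lg2_ge0 : 0 <= lg2. Proof. exact: rs_lg2 HS. Qed.

Section Round.
Context (t : nat) (l : 'cV[R]_d1) (b : 'cV[R]_d2).
Hypothesis tT : (1 <= t <= T)%N.
Hypothesis Xl : X l.

Let tT1 : (1 <= t <= T.+1)%N.
Proof. by case/andP: tT => -> /leqW ->. Qed.

Let factor (z : Z) : 'M[R]_d2 := 1%:M - lg1^-1 *: obj_gbb pb t z l b.

Let smooth_g z : smooth_inner X lg1 lg2 (obj_g pb t z) (obj_gl pb t z) (obj_gb pb t z)
  (obj_glb pb t z) (obj_gbb pb t z).
Proof. by have [_ + _ _] := rs_A HS tT1. Qed.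

Let factor_sym z : (factor z)^T = factor z.
Proof.
rewrite /factor linearB/= linearZ/= tr_scalar_mx.
by rewrite (hessian_sym lg2_ge0 (smooth_g z) b Xl).
Qed.

Local Notation q := (1 - mu / lg1).

Let q_ge0 : 0 <= q.
Proof. by rewrite subr_ge0 ler_pdivrMr ?(rs_lg1 HS)// mul1r (rs_mu_le HS). Qed.

Let q_le1 : q <= 1.
Proof. by rewrite gerBl divr_ge0// ltW// ?(rs_mu HS)// (rs_lg1 HS). Qed.

Let factor_bound z d : l2norm (factor z *m d) <= q * l2norm d.
Proof.
apply: (neumann_factor_bound (rs_lg1 HS) (smooth_g z) (rs_mu HS) (rs_mu_le HS)) => //.
by have [_] := rs_B HS tT1 Xl; exact.
Qed.

Section Chain.
Context (x y : 'cV[R]_d1).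
Hypothesis Xx : X x.
Hypothesis Xy : X y.

(* The transposed Neumann product applied to the cross derivative, so that the
   estimate only enters through inner products of bounded vectors. *)
Definition neumann_chain k (z : nat -> Z) : 'cV[R]_d2 :=
  (\prod_(1 <= j < k.+1) factor (z j))^T *m ((obj_glb pb t (z 0%N) l b)^T *m (x - y)).

Lemma neumann_chain0 z : neumann_chain 0 z = (obj_glb pb t (z 0%N) l b)^T *m (x - y).
Proof. by rewrite /neumann_chain big_geq// [X in X *m _]trmx1 mul1mx. Qed.

(** The transposition puts the newest factor outermost, so each new sample multiplies a vector that
    is independent of it. *)
Lemma neumann_chainS k z : neumann_chain k.+1 z = factor (z k.+1) *m neumann_chain k z.
Proof. by rewrite /neumann_chain big_nat_recr//= trmx_mul factor_sym !mulmxA. Qed.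

Lemma neumann_chain_bound k z : l2norm (neumann_chain k z) <= q ^+ k * (lg1 * l2norm (x - y)).
Proof.
elim: k => [|k IH].
  rewrite neumann_chain0 expr0 mul1r.
  exact: (cross_bound cX (rs_lg1 HS) lg2_ge0 (smooth_g _)).
by rewrite neumann_chainS (le_trans (factor_bound _ _))// exprS -mulrA ler_wpM2l.
Qed.

Lemma hypergrad_pairing e z k : dotv (hypergrad pb lg1 m t l b e z k) (x - y) =
  dotv (obj_fl pb t e l b) (x - y) -
  m%:R / lg1 * dotv (neumann_chain k z) (obj_fb pb t e l b).
Proof.
rewrite /hypergrad dotvBl; congr (_ - _).
rewrite -mulmxA dotv_trmxl -scalemxAl dotvZl dotv_trmxl.
by rewrite dotvC.
Qed.

(** The factor [m] is kept next to [q ^+ k]: alone it grows with [w], but the mean of the product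
    over the uniform index is at most [lg1 / mu]. *)
Lemma hypergrad_pairing_bound e z k :
  `|dotv (hypergrad pb lg1 m t l b e z k) (x - y)| <=
    lf0 * (1 + m%:R * q ^+ k) * l2norm (x - y).
Proof.
have [ho _ _ _] := rs_A HS tT1; have [g1 g2 g3] := ho e.
have L0 := rs_lg1 HS; have f0 := rs_lf0 HS.
rewrite hypergrad_pairing (le_trans (ler_normB _ _))// mulrDr mulrDl mulr1 lerD//.
  by apply: (outer_gradient_bound cX g1 g3) => //; exact: ltW (rs_lf1 HS).
rewrite normrM ger0_norm; last by rewrite divr_ge0 ?ler0n ?ltW.
have H1 := neumann_chain_bound k z.
have H2 : l2norm (obj_fb pb t e l b) <= lf0 by exact: (inner_gradient_bound g1).
have H : `|dotv (neumann_chain k z) (obj_fb pb t e l b)| <=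
    q ^+ k * (lg1 * l2norm (x - y)) * lf0.
  by rewrite (le_trans (dotv_abs_le _ _))// ler_pM ?l2norm_ge0.
apply: le_trans (ler_wpM2l _ H) _; first by rewrite divr_ge0 ?ler0n ?ltW.
rewrite le_eqVlt; apply/orP; left; apply/eqP; field; exact: lt0r_neq0.
Qed.

Section Expectation.
Context ul ub (so : smooth_outer X lf0 lf1 (fmean pb t) ul ub).
Context gl gb ulb ubb (si : smooth_inner X lg1 lg2 (gmean pb t) gl gb ulb ubb).

Let chainP k o := neumann_chain k (fun j => zeta smp t j o).
Let zetas k : set draw := [set d | exists2 j, (j <= k)%N & d = DrawZeta t j].

Let zetas_drawn k : (k < m)%N -> zetas k `<=` drawn T K w m.
Proof. by move=> km _ [j jk ->] /=; split=> //; exact: leq_ltn_trans km. Qed.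

Let zeta_law j : (j < m)%N -> has_law P (zeta smp t j) (lawZ pb).
Proof. by move=> jm; case: (rs_indep HS) => _ H _ _ _; apply: H; split. Qed.

Let eps_law : has_law P (eps smp t) (lawE pb).
Proof. by case: (rs_indep HS) => H _ _ _ _; exact: H. Qed.

Let chain_le k z i : `|neumann_chain k z i 0| <= lg1 * l2norm (x - y).
Proof.
rewrite (le_trans (normr_coord_le _ _))// (le_trans (neumann_chain_bound _ _))//.
by rewrite ler_piMl ?exprn_ile1// mulr_ge0 ?l2norm_ge0 ?ltW ?(rs_lg1 HS).
Qed.

Let factor_le z i j : `|factor z i j| <= q.
Proof.
have -> : factor z i j = (factor z *m (delta_mx j 0 : 'cV[R]_d2)) i 0 by rewrite -colE [RHS]mxE.
rewrite (le_trans (normr_coord_le _ _))// (le_trans (factor_bound _ _))//.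
by rewrite /l2norm dotv_delta mxE !eqxx sqrtr1 mulr1.
Qed.

Let measurable_factor : mmeasurable (fun z => factor z).
Proof.
apply: mmeasurableB; first exact: mmeasurable_cst.
by apply: mmeasurableZ; case: (rs_random HS b tT1 Xl) => _ [].
Qed.

Let known_chain k : vmeasurable (T := info smp (zetas k)) (chainP k).
Proof.
elim: k => [|k IH] i.
  rewrite /chainP; under eq_fun do rewrite neumann_chain0.
  have mg : mmeasurable (fun z => (obj_glb pb t z l b)^T).
    move=> a c; under eq_fun do rewrite mxE.
    by case: (rs_random HS b tT1 Xl) => _ [_ _ H _]; exact: H.
  apply: (measurableT_comp (mmeasurable_mul mg (mmeasurable_cst (x - y)) i 0)).
  by apply: known_zeta; exists 0%N.
rewrite /chainP; under eq_fun do rewrite neumann_chainS.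
have kf : mmeasurable (T := info smp (zetas k.+1)) (fun o => factor (zeta smp t k.+1 o)).
  move=> a c; apply: (measurableT_comp (measurable_factor a c)).
  by apply: known_zeta; exists k.+1.
apply: (mmeasurable_mul kf) => a c; rewrite ord1.
apply: known_mono (IH a) => _ [j jk ->]; exists j => //; exact: leqW.
Qed.

Let mean_factor j : (j < m)%N -> forall a c,
  \int[P]_o factor (zeta smp t j o) a c = (1%:M - lg1^-1 *: ubb l b) a c.
Proof.
move=> jm a c; rewrite (law_Rintegral (zeta_law jm) (measurable_factor a c)).
have [ih eh] := mean_hessian tT si b a c Xl.
have -> : (fun z => factor z a c) = fun z => (1%:M : 'M[R]_d2) a c + - lg1^-1 * obj_gbb pb t z l b a c.
  by apply/funext => z; rewrite !mxE mulNr.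
rewrite RintegralD//; [|exact: integrable_const|exact: integrable_scale].
by rewrite Rintegral_const RintegralZl// eh !mxE mulNr.
Qed.

(** Sample [k.+1] is not among samples [0, ..., k], so entrywise means multiply and each factor
    contributes its mean. *)
Lemma mean_neumann_chain k : (k < m)%N ->
  vmean P (chainP k) = (1%:M - lg1^-1 *: ubb l b) ^+ k *m ((ulb l b)^T *m (x - y)).
Proof.
elim: k => [|k IH] km.
  rewrite expr0 mul1mx -(mean_cross tT si b Xl Xx Xy).2.
  apply/matrixP => i j; rewrite ord1 !mxE /chainP.
  under eq_Rintegral do rewrite neumann_chain0.
  have mg : mmeasurable (fun z => (obj_glb pb t z l b)^T).
    move=> a c; under eq_fun do rewrite mxE.
    by case: (rs_random HS b tT1 Xl) => _ [_ _ H _]; exact: H.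
  exact: (law_Rintegral (zeta_law km) (mmeasurable_mul mg (mmeasurable_cst (x - y)) i 0)).
have km' := ltnW km.
rewrite exprS -mulmxA -IH//; apply/matrixP => i j; rewrite ord1 !mxE.
rewrite /chainP; under eq_Rintegral do rewrite neumann_chainS mxE.
have kf a c : measurable_fun (setT : set (info smp [set DrawZeta t k.+1]))
    (fun o => factor (zeta smp t k.+1 o) a c).
  by apply: (measurableT_comp (measurable_factor a c)); exact: known_zeta.
have dk : [set DrawZeta t k.+1] `<=` drawn T K w m by move=> _ ->; split.
have disj : [set DrawZeta t k.+1] `&` zetas k = set0.
  by apply/seteqP; split=> // _ [-> [j' j'k [jE]]]; rewrite -jE ltnn in j'k.
have mf a c : measurable_fun setT (fun o => factor (zeta smp t k.+1 o) a c).
  exact: (known_measurable (rs_indep HS) dk (kf a c)).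
have mc a : measurable_fun setT (fun o => chainP k o a 0).
  exact: (known_measurable (rs_indep HS) (zetas_drawn km') (@known_chain k a)).
rewrite Rintegral_big_sum => [|c].
  apply: eq_bigr => c _.
  rewrite (product_expectation (rs_indep HS) dk (zetas_drawn km') disj (kf i c)
    (@known_chain k c) (fun o => factor_le _ i c) (fun o => chain_le k _ c)).
  by rewrite mean_factor//; congr (_ * _); rewrite [RHS]mxE.
apply: (@integrable_bounded _ _ _ _ _ (q * (lg1 * l2norm (x - y)))).
  exact: measurable_funM.
by move=> o; rewrite normrM ler_pM.
Qed.

Let indic_m k (o : Omega) : R := (mtil smp t o == k)%:R.

Let known_indic k : measurable_fun (setT : set (info smp [set DrawM t])) (indic_m k).
Proof.
have mf : measurable_fun [set: nat] (fun n : nat => (n == k)%:R : R) by [].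
by apply: (measurableT_comp mf); exact: known_mtil.
Qed.

Lemma mtil_law : [/\ measurable_fun setT (mtil smp t), forall o, (mtil smp t o < m)%N
  & forall k, (k < m)%N -> P (mtil smp t @^-1` [set k]) = (m%:R^-1)%:E].
Proof. by case: (rs_indep HS) => _ _ H _ _; exact: H. Qed.

Lemma mean_mtil_indicator k : (k < m)%N -> \int[P]_o ((mtil smp t o == k)%:R : R) = m%:R^-1.
Proof.
move=> km; have [mm _ H] := mtil_law.
have -> : (fun o => (mtil smp t o == k)%:R : R) = \1_(mtil smp t @^-1` [set k]).
  apply/funext => o; rewrite indicE; congr (nat_of_bool _)%:R.
  by apply/eqP/idP; rewrite inE.
rewrite /Rintegral integral_indic//; last first.
  by rewrite -[X in measurable X]setTI; exact: mm.
by rewrite setIT [X in fine X]H.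
Qed.

Let known_fb i : measurable_fun (setT : set (info smp [set DrawEps t]))
  (fun o => obj_fb pb t (eps smp t o) l b i 0).
Proof.
have mf : measurable_fun setT (fun e => obj_fb pb t e l b i 0).
  by case: (rs_random HS b tT1 Xl) => -[].
by apply: (measurableT_comp mf); exact: known_eps.
Qed.

Let fb_le e i : `|obj_fb pb t e l b i 0| <= lf0.
Proof.
have [ho _ _ _] := rs_A HS tT1; have [g1 g2 g3] := ho e.
rewrite (le_trans (normr_coord_le _ _))//.
by apply: (inner_gradient_bound g1) => //; exact: rs_lf0 HS.
Qed.

(** Resolves the random number of factors into the events [mtil = k]; each term is then a product
    over three disjoint groups of draws. *)
Let summand k i o := indic_m k o * (chainP k o i 0 * obj_fb pb t (eps smp t o) l b i 0).

Let mean_summand k i : (k < m)%N ->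
  P.-integrable setT (EFin \o summand k i) /\
  \int[P]_o summand k i o = m%:R^-1 *
    (((1%:M - lg1^-1 *: ubb l b) ^+ k *m ((ulb l b)^T *m (x - y))) i 0 * ub l b i 0).
Proof.
move=> km; have Hd := rs_indep HS.
have dM : [set DrawM t] `<=` drawn T K w m by move=> _ ->.
have dE' : [set DrawEps t] `<=` drawn T K w m by move=> _ ->.
have dZ' := zetas_drawn km.
have dZE : zetas k `|` [set DrawEps t] `<=` drawn T K w m by move=> d [/dZ'|/dE'].
have disj1 : zetas k `&` [set DrawEps t] = set0.
  by apply/seteqP; split=> // d [[j _ ->]].
have disj2 : [set DrawM t] `&` (zetas k `|` [set DrawEps t]) = set0.
  by apply/seteqP; split=> // d [-> [[j _]|]].
have kc := @known_chain k i.
have kprod : measurable_fun (setT : set (info smp (zetas k `|` [set DrawEps t])))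
    (fun o => chainP k o i 0 * obj_fb pb t (eps smp t o) l b i 0).
  apply: measurable_funM; first by apply: known_mono kc => d ?; left.
  by apply: known_mono (known_fb i) => d ?; right.
have b1 o : `|indic_m k o| <= 1 by rewrite /indic_m; case: eqP => _; rewrite ?normr1 ?normr0.
have b2 o : `|chainP k o i 0 * obj_fb pb t (eps smp t o) l b i 0| <= lg1 * l2norm (x - y) * lf0.
  by rewrite normrM ler_pM ?chain_le.
split.
  apply: (@integrable_bounded _ _ _ _ _ (1 * (lg1 * l2norm (x - y) * lf0))).
    apply: measurable_funM; first exact: (known_measurable Hd dM (@known_indic k)).
    exact: (known_measurable Hd dZE kprod).
  by move=> o; rewrite normrM ler_pM.
rewrite (product_expectation Hd dM dZE disj2 (@known_indic k) kprod b1 b2).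
rewrite mean_mtil_indicator//; congr (_ * _).
rewrite (product_expectation Hd dZ' dE' disj1 kc (known_fb i)
  (fun o => chain_le k _ i) (fun o => fb_le _ i)).
rewrite -(mean_neumann_chain km) -(mean_outer_gradient_b tT so b Xl).2 !mxE; congr (_ * _).
apply: (law_Rintegral eps_law (h := fun e => obj_fb pb t e l b i 0)).
by case: (rs_random HS b tT1 Xl) => -[].
Qed.

(** Each value of the index has probability [1 / m], which cancels the [m] in the estimate and
    leaves a partial Neumann sum with [m] terms. *)
Lemma estimate_mean_pairing :
  vintegrable P (hypergrad_est pb smp lg1 m t l b) ->
  dotv (vmean P (hypergrad_est pb smp lg1 m t l b)) (x - y) =
  dotv (ul l b) (x - y) - dotv ((ulb l b)^T *m (x - y))
    ((lg1^-1 *: \sum_(i < m) (1%:M - lg1^-1 *: ubb l b) ^+ i) *m ub l b).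
Proof.
move=> ie; have [mm mlt _] := mtil_law.
rewrite dotvC -Rintegral_dotv//.
have [ifl efl] := mean_outer_gradient_l tT so b Xl Xx Xy.
have pairE o : dotv (x - y) (hypergrad_est pb smp lg1 m t l b o) =
    dotv (obj_fl pb t (eps smp t o) l b) (x - y) +
    - (m%:R / lg1) * \sum_(k < m) \sum_i summand k i o.
  rewrite dotvC hypergrad_pairing mulNr; congr (_ - _ * _).
  rewrite (bigD1 (Ordinal (mlt o)))//= [X in _ + X]big1 ?addr0 => [|k kM].
    by rewrite /dotv; apply: eq_bigr => i _; rewrite /summand /indic_m eqxx mul1r.
  apply: big1 => i _; rewrite /summand /indic_m; case: eqP; last by rewrite mul0r.
  by move=> E'; case/eqP: kM; apply: val_inj.
rewrite (_ : (fun o => dotv _ (hypergrad_est _ _ _ _ _ _ _ o)) = fun o =>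
   dotv (obj_fl pb t (eps smp t o) l b) (x - y) +
    - (m%:R / lg1) * \sum_(k < m) \sum_i summand k i o); last exact/funext.
have is_ : P.-integrable setT (EFin \o (fun o => \sum_(k < m) \sum_i summand k i o)).
  by do 2! apply: integrable_big_sum => ?; exact: (mean_summand _ (ltn_ord _)).1.
rewrite RintegralD//; last 2 first.
- exact: (law_integrable eps_law ifl).
- exact: integrable_scale.
rewrite (law_Rintegral eps_law (h := fun e => dotv (obj_fl pb t e l b) (x - y))); last first.
  by have /integrableP[/measurable_EFinP] := ifl.
rewrite efl RintegralZl// mulNr; congr (_ - _).
rewrite Rintegral_big_sum => [|k]; last first.
  by apply: integrable_big_sum => ?; exact: (mean_summand _ (ltn_ord _)).1.
set Rb := 1%:M - _; set Gv := (ulb l b)^T *m _.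
have RbT k : (Rb ^+ k)^T = Rb ^+ k.
  have Rb1 : Rb^T = Rb.
    by rewrite /Rb linearB/= linearZ/= tr_scalar_mx (hessian_sym lg2_ge0 si b Xl).
  elim: k => [|k IH]; first by rewrite expr0 trmx1.
  by rewrite {1}exprS trmx_mul IH Rb1 exprSr.
have E1 (k : 'I_m) : \int[P]_o (\sum_i summand k i o) = m%:R^-1 * dotv (Rb ^+ k *m Gv) (ub l b).
  rewrite Rintegral_big_sum => [|i]; last exact: (mean_summand _ (ltn_ord _)).1.
  rewrite /dotv mulr_sumr; apply: eq_bigr => i _.
  exact: (mean_summand _ (ltn_ord _)).2.
under eq_bigr do rewrite E1.
rewrite -mulr_sumr -scalemxAl dotvZr mulmx_suml dotvC dotv_suml mulrA.
have m0 : (m%:R : R) != 0 by rewrite pnatr_eq0 -lt0n (rs_m HS).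
have -> : m%:R / lg1 * m%:R^-1 = lg1^-1 by rewrite mulrAC divff// mul1r.
congr (_ * _); apply: eq_bigr => k _.
by rewrite dotv_trmxl RbT dotvC.
Qed.

End Expectation.
End Chain.
End Round.
End EstimateMean.

(** * Measurability and bias of the estimate *)

Section EstimateMeasurability.
Local Notation "S .-known" := (measurable_fun (setT : set (info smp S)))
  (at level 2, format "S .-known").

Definition round_draws (t : nat) : set draw :=
  [set d | [\/ d = DrawEps t, d = DrawM t | exists2 j, (j < m)%N & d = DrawZeta t j]].

Lemma round_draws_drawn t : (1 <= t <= T)%N -> round_draws t `<=` drawn T K w m.
Proof. by move=> tT _ [->|->|[j jm ->]]. Qed.

Section Round.
Context (t : nat).
Hypothesis tT : (1 <= t <= T)%N.

Let tT1 : (1 <= t <= T.+1)%N.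
Proof. by case/andP: tT => -> /leqW ->. Qed.

Lemma known_estimate l b : X l ->
  vmeasurable (T := info smp (round_draws t)) (hypergrad_est pb smp lg1 m t l b).
Proof.
move=> Xl i; have [_ _ hM _ _] := rs_indep HS; have [mm mlt _] := hM t tT.
have [[_ mfl mfb] [_ _ mglb mgbb]] := rs_random HS b tT1 Xl.
have kz j : (j < m)%N -> (round_draws t).-known (zeta smp t j).
  by move=> jm; apply: known_zeta; constructor 3; exists j.
have ke : (round_draws t).-known (eps smp t) by apply: known_eps; constructor 1.
have km : (round_draws t).-known (mtil smp t) by apply: known_mtil; constructor 2.
(* The length of the product is random, so it is fixed first; only lengths below [m] occur, and
   their samples all belong to the round. *)
rewrite /hypergrad_est; apply: (@measurable_select _ (info smp (round_draws t)) _ _ nat (mtil smp t)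
   (fun k o => hypergrad pb lg1 m t l b (eps smp t o) (fun j => zeta smp t j o) k i 0)).
  move=> k; have := km measurableT [set k] I; rewrite setTI; congr measurable.
move=> o0; move: (mtil smp t o0) (mlt o0) => k kltm.
have kprod : mmeasurable (T := info smp (round_draws t)) (fun o =>
    \prod_(1 <= j < k.+1) (1%:M - lg1^-1 *: obj_gbb pb t (zeta smp t j o) l b)).
  elim: k kltm => [|k IH] kltm.
    by under eq_fun do rewrite big_geq//; exact: mmeasurable_cst.
  under eq_fun do rewrite big_nat_recr//=.
  apply: mmeasurable_mul; first exact: IH (ltnW kltm).
  apply: mmeasurableB; first exact: mmeasurable_cst.
  apply: mmeasurableZ => p q.
  exact: (measurableT_comp (mgbb p q) (kz _ kltm)).
have kfl : mmeasurable (T := info smp (round_draws t)) (fun o => obj_fl pb t (eps smp t o) l b).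
  by move=> p q; rewrite ord1; exact: (measurableT_comp (mfl p) ke).
have kfb : mmeasurable (T := info smp (round_draws t)) (fun o => obj_fb pb t (eps smp t o) l b).
  by move=> p q; rewrite ord1; exact: (measurableT_comp (mfb p) ke).
have kglb : mmeasurable (T := info smp (round_draws t)) (fun o => obj_glb pb t (zeta smp t 0 o) l b).
  by move=> p q; exact: (measurableT_comp (mglb p q) (kz _ (rs_m HS))).
apply: (mmeasurableB kfl _ i 0).
by apply: mmeasurable_mul => //; apply: mmeasurable_mul => //; exact: mmeasurableZ.
Qed.

Lemma estimate_integrable l b : X l -> vintegrable P (hypergrad_est pb smp lg1 m t l b).
Proof.
move=> Xl; have [_ _ v] := rs_C HS b tT Xl.
have mv : vmeasurable (hypergrad_est pb smp lg1 m t l b).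
  by move=> i; exact: (known_measurable (rs_indep HS) (round_draws_drawn tT) (@known_estimate l b Xl i)).
by have [] := vintegrable_of_variance mv v.
Qed.

Local Notation joint := [set z : 'cV[R]_(d1 + d2) | X (usubmx z)].

Let joint_diff (z a : 'cV[R]_(d1 + d2)) :
  col_mx (usubmx z - usubmx a) (dsubmx z - dsubmx a) = z - a.
Proof. by rewrite -col_mxB !vsubmxK. Qed.

Lemma hypergrad_continuous e z k a : joint a ->
  mcontinuous_relative joint a
    (fun v => hypergrad pb lg1 m t (usubmx v) (dsubmx v) e z k).
Proof.
move=> Xa; have [ho hi _ _] := rs_A HS tT1.
have [f1 f2 f3] := ho e.
have cfl : mcontinuous_relative joint a (fun v => obj_fl pb t e (usubmx v) (dsubmx v)).
  apply: (@mcontinuous_relative_vlipschitz _ _ _ _ _ _ lf1) => v Xv; rewrite -joint_diff.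
  exact: (partial_gradient_lipschitz_l (ul := obj_fl pb t e) (ub := obj_fb pb t e) f3).
have cfb : mcontinuous_relative joint a (fun v => obj_fb pb t e (usubmx v) (dsubmx v)).
  apply: (@mcontinuous_relative_vlipschitz _ _ _ _ _ _ lf1) => v Xv; rewrite -joint_diff.
  exact: (partial_gradient_lipschitz (ul := obj_fl pb t e) (ub := obj_fb pb t e) f3).
have cglb j : mcontinuous_relative joint a (fun v => obj_glb pb t (z j) (usubmx v) (dsubmx v)).
  apply: (@mcontinuous_relative_lipschitz _ _ _ _ _ _ _ lg2) => v Xv; rewrite -joint_diff.
  by have [_ _ _ H _] := hi (z j); exact: H.
have cgbb j : mcontinuous_relative joint a (fun v => obj_gbb pb t (z j) (usubmx v) (dsubmx v)).
  apply: (@mcontinuous_relative_lipschitz _ _ _ _ _ _ _ lg2) => v Xv; rewrite -joint_diff.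
  by have [_ _ _ _ H] := hi (z j); exact: H.
apply: mcontinuous_relativeB => //; apply: mcontinuous_relative_mul => //.
apply: mcontinuous_relative_mul => //; apply: mcontinuous_relativeZ.
apply: mcontinuous_relative_prod => j; apply: mcontinuous_relativeB.
  exact: mcontinuous_relative_cst.
exact: mcontinuous_relativeZ.
Qed.

Section Random.
Context (S' : set draw) (l : Omega -> 'cV[R]_d1) (b : Omega -> 'cV[R]_d2).
Hypothesis Xl : forall o, X (l o).
Hypothesis kl : vmeasurable (T := info smp S') l.
Hypothesis kb : vmeasurable (T := info smp S') b.

(** The past enters only through the point and the new draws only through the samples: for a fixed
    point the map is measurable, for fixed samples it is continuous. *)
Lemma joint_known_estimate i :
  measurable_fun (setT : set (info smp S' * info smp (round_draws t))%type)
    (fun z => hypergrad_est pb smp lg1 m t (l z.1) (b z.1) z.2 i 0).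
Proof.
pose v (z : info smp S' * info smp (round_draws t)) := col_mx (l z.1) (b z.1).
rewrite (_ : (fun z => _) = fun z =>
  hypergrad_est pb smp lg1 m t (usubmx (v z)) (dsubmx (v z)) z.2 i 0); last first.
  by apply/funext => z; rewrite col_mxKu col_mxKd.
apply: (@measurable_caratheodory R _ (info smp S' * info smp (round_draws t))%type _ joint
  (fun v z => hypergrad_est pb smp lg1 m t (usubmx v) (dsubmx v) z.2 i 0) v).
- apply: vmeasurable_col_mx => j; first exact: (measurableT_comp (kl j) measurable_fst).
  exact: (measurableT_comp (kb j) measurable_fst).
- by move=> z; rewrite /= col_mxKu.
- move=> c Xc; exact: (measurableT_comp (@known_estimate (usubmx c) (dsubmx c) Xc i) measurable_snd).
- by move=> z c Xc; exact: hypergrad_continuous.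
Qed.

Lemma joint_known_batch_gradient k j i (S'' : set draw) : S'' (DrawBatch t k j) ->
  measurable_fun (setT : set (info smp S' * info smp S'')%type)
    (fun z => obj_gb pb t (batch smp t k j z.2) (l z.1) (b z.1) i 0).
Proof.
move=> Sd.
pose v (z : info smp S' * info smp S'') := col_mx (l z.1) (b z.1).
rewrite (_ : (fun z => _) = fun z =>
  obj_gb pb t (batch smp t k j z.2) (usubmx (v z)) (dsubmx (v z)) i 0); last first.
  by apply/funext => z; rewrite col_mxKu col_mxKd.
apply: (@measurable_caratheodory R _ (info smp S' * info smp S'')%type _ joint
  (fun v z => obj_gb pb t (batch smp t k j z.2) (usubmx v) (dsubmx v) i 0) v).
- apply: vmeasurable_col_mx => a; first exact: (measurableT_comp (kl a) measurable_fst).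
  exact: (measurableT_comp (kb a) measurable_fst).
- by move=> z; rewrite /= col_mxKu.
- move=> c Xc; have [_ [_ mgb _ _]] := rs_random HS (dsubmx c) tT1 Xc.
  have kb2 : measurable_fun (setT : set (info smp S'')) (batch smp t k j) by exact: known_batch.
  exact: (measurableT_comp (mgb i) (measurableT_comp kb2 measurable_snd)).
- move=> z a Xa; have [_ hi _ _] := rs_A HS tT1.
  have [_ _ lg _ _] := hi (batch smp t k j z.2).
  apply: (@mcontinuous_relative_vlipschitz _ _ joint a _
    (fun v => obj_gb pb t (batch smp t k j z.2) (usubmx v) (dsubmx v)) lg1 _ i 0) => c Xc.
  rewrite -joint_diff.
  exact: (partial_gradient_lipschitz (ul := obj_gl pb t _) (ub := obj_gb pb t _) lg).
Qed.

End Random.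
End Round.

Lemma estimate_bias t l b x y : (1 <= t <= T)%N -> X l -> X x -> X y ->
  `|dotv (vmean P (hypergrad_est pb smp lg1 m t l b) - gradF pb t l) (x - y)| <=
  (M_f lf0 lf1 lg1 lg2 mu * l2norm (b - betahat pb t l) + lg1 / mu * lf0 * w%:R^-1)
    * l2norm (x - y).
Proof.
move=> tT Xl Xx Xy; have tT1 : (1 <= t <= T.+1)%N by case/andP: tT => -> /leqW ->.
have [_ _ [ul [ub so]] [gl [gb [glb [gbb si]]]]] := rs_A HS tT1.
have bc z : X z -> gb z (betahat pb t z) = 0 by move=> Xz; exact: (betahat_critical tT1 Xz si).
rewrite dotvBl (estimate_mean_pairing tT Xl Xx Xy so si (estimate_integrable tT b Xl)).
have := hypergradient_bias cX (rs_lf0 HS) (ltW (rs_lf1 HS)) (rs_lg1 HS) (rs_lg2 HS) (rs_mu HS)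
  (rs_mu_le HS) so si (fun z Xz => (rs_B HS tT1 Xz).1) bc m b Xl Xx Xy.
move=> /le_trans; apply; rewrite ler_wpM2r ?l2norm_ge0// lerD2l ler_wpM2l ?(rs_neumann HS)//.
by rewrite mulr_ge0 ?(rs_lf0 HS)// divr_ge0// ltW// ?(rs_mu HS)// (rs_lg1 HS).
Qed.

End EstimateMeasurability.

(** * Bregman steps *)

Section BregmanSteps.

Lemma reg_segment a b s : X a -> X b -> 0 <= s <= 1 ->
  reg pb (a + s *: (b - a)) <= reg pb a + s * (reg pb b - reg pb a).
Proof.
move=> Xa Xb /andP[s0 s1].
have hc : @convex_function R 'cV[R]_d1 X (reg pb) := rs_reg HS.
have := hc (Itv01 s0 s1) b a.
rewrite !inE => /(_ Xb Xa); rewrite segment_mid => /le_trans; apply.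
by rewrite le_eqVlt; apply/orP; left; apply/eqP; rewrite convRE /= /unstable.onem; ring.
Qed.

Section Round.
Context (t : nat).
Hypothesis tT : (1 <= t <= T)%N.

Local Notation phi := (dgf pb t).
Local Notation dphi := (dgf_grad pb t).
Local Notation step := (bregman_step pb t alpha).

Lemma step_argmin u q : X u -> is_argmin X (bregman_obj pb t alpha u q) (step u q).
Proof. by move=> Xu; exact: (@getPex _ [set x | is_argmin X (bregman_obj pb t alpha u q) x] (rs_steps HS q tT Xu)). Qed.

Lemma step_dom u q : X u -> X (step u q).
Proof. by move=> /(step_argmin q)[]. Qed.

Lemma dgf_lower x y : X x -> X y ->
  phi x + dotv (dphi x) (y - x) + rho / 2 * l2norm (y - x) ^+ 2 <= phi y.
Proof.
move=> Xx Xy; have [g1 _ g3] := rs_F HS tT.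
exact: (strongly_convex_lower cX g3 (g1 _ Xx)).
Qed.

Lemma step_variational u q y : X u -> X y ->
  0 <= dotv (q + alpha^-1 *: (dphi (step u q) - dphi u)) (y - step u q)
       + (reg pb y - reg pb (step u q)).
Proof.
move=> Xu Xy; have a0 := rs_alpha HS; have [g1 _ _] := rs_F HS tT.
have Xs := step_dom q Xu.
apply: (@argmin_variational R d1 X (fun z => dotv q z + alpha^-1 * bregman pb t z u) (reg pb)) => //.
- exact: cX.
- exact: reg_segment.
- rewrite (_ : (fun z => _) = bregman_obj pb t alpha u q); first exact: step_argmin.
  by apply/funext => z; rewrite /bregman_obj addrAC.
- move=> e e0; have [r r0 Hr] := g1 _ Xs _ (mulr_gt0 a0 e0); exists r => // z Xz zs.
  rewrite (_ : _ - _ - _ = alpha^-1 * (phi z - phi (step u q) - dotv (dphi (step u q)) (z - step u q))).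
    rewrite normrM gtr0_norm ?invr_gt0// -(ler_pM2l a0) !mulrA divff ?gt_eqF// mul1r.
    exact: Hr.
  by rewrite /bregman !dotvDl !dotvBr !dotvZl !dotvBl; ring.
Qed.

(** The minimiser is compared with the competitor [u], where the divergence vanishes; strong
    convexity bounds the divergence at the minimiser from below. *)
Lemma step_descent u q : X u ->
  rho / (2 * alpha) * l2norm (step u q - u) ^+ 2 <=
    dotv q (u - step u q) + (reg pb u - reg pb (step u q)).
Proof.
move=> Xu; have [Xs /(_ u Xu)] := step_argmin q Xu.
have -> : bregman_obj pb t alpha u q u = dotv q u + reg pb u.
  by rewrite /bregman_obj /bregman !subrr dotv0r subrr mulr0 addr0.
rewrite /bregman_obj.
have := dgf_lower Xu Xs; have a0 := rs_alpha HS.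
have -> : rho / (2 * alpha) * l2norm (step u q - u) ^+ 2 =
  alpha^-1 * (rho / 2 * l2norm (step u q - u) ^+ 2) by field; exact: lt0r_neq0.
move=> H H'; rewrite dotvBr.
have : alpha^-1 * (rho / 2 * l2norm (step u q - u) ^+ 2) <= alpha^-1 * bregman pb t (step u q) u.
  by rewrite ler_pM2l ?invr_gt0// /bregman; lra.
lra.
Qed.

Lemma dgf_monotone x y : X x -> X y ->
  rho * l2norm (x - y) ^+ 2 <= dotv (dphi x - dphi y) (x - y).
Proof.
move=> Xx Xy; have := dgf_lower Xx Xy; have := dgf_lower Xy Xx.
rewrite dotvBl (l2norm_distC y x) -(opprB x y) !dotvNr; lra.
Qed.

(** Each variational inequality is tested with the other step. The data enter only through
    [q - alpha^-1 dphi u], hence the step depends on [u] and [q] only through this vector. *)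
Lemma step_monotone u u' q q' : X u -> X u' ->
  rho / alpha * l2norm (step u q - step u' q') ^+ 2 <=
  dotv ((q - alpha^-1 *: dphi u) - (q' - alpha^-1 *: dphi u')) (step u' q' - step u q).
Proof.
move=> Xu Xu'; have a0 := rs_alpha HS.
have Xs := step_dom q Xu; have Xs' := step_dom q' Xu'.
have := step_variational q Xu Xs'; have := step_variational q' Xu' Xs.
have := dgf_monotone Xs Xs'.
rewrite -(ler_pM2l (_ : 0 < alpha^-1)) ?invr_gt0//.
rewrite -(opprB (step u' q') (step u q)) l2normN !dotvNr !dotvBl !dotvDl !dotvZl !dotvBl.
have -> : rho / alpha = alpha^-1 * rho by rewrite mulrC.
lra.
Qed.

(** The bound on [q - q'] is asked only along [X - X], which is all that is known when [q'] is built
    from relative gradients. *)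
Lemma step_perturbation u q q' c : X u -> 0 <= c ->
  (forall x y, X x -> X y -> `|dotv (q - q') (x - y)| <= c * l2norm (x - y)) ->
  l2norm (step u q - step u q') <= alpha / rho * c.
Proof.
move=> Xu c0 H; have a0 := rs_alpha HS; have r0 := rs_rho HS.
have := step_monotone q q' Xu Xu.
have -> : q - alpha^-1 *: dphi u - (q' - alpha^-1 *: dphi u) = q - q'.
  by rewrite opprB addrA subrK.
have := le_trans (ler_norm _) (H _ _ (step_dom q' Xu) (step_dom q Xu)).
rewrite (l2norm_distC (step u q')) => h1 h2; have := le_trans h2 h1.
have [->|n0] := eqVneq (l2norm (step u q - step u q')) 0.
  by rewrite mulr_ge0// divr_ge0// ltW.
rewrite expr2 mulrA ler_pM2r ?lt_def ?n0 ?l2norm_ge0// => h.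
by rewrite mulrAC ler_pdivlMr// mulrC -ler_pdivrMl// mulrA [alpha^-1 * _]mulrC.
Qed.

Lemma dgf_grad_continuous x i : X x -> continuous_relative X x (fun z => dphi z i 0).
Proof.
move=> Xx e e0; have [_ + _] := rs_F HS tT.
move=> /subspace_continuousP/(_ x Xx) cphi.
have : (fun z => dphi z i 0) @ within X (nbhs x) --> dphi x i 0.
  exact: (cvg_comp _ _ cphi (@coord_continuous _ _ _ i 0 (dphi x))).
move=> /cvgrPdist_le/(_ e e0); rewrite near_withinE => /nbhs_ballP[r /= r0 Hr].
exists r => // b Xb xb; rewrite distrC; apply: Hr => //.
split=> // p q; rewrite ord1 /ball /= (le_lt_trans _ xb)//.
rewrite l2norm_distC (le_trans _ (normr_coord_le _ p))//.
by rewrite [X in _ <= `|X|]mxE [X in _ <= `|_ + X|]mxE.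
Qed.

(** By [step_monotone] the step is a function [F] of [q - alpha^-1 dphi u] alone, realised as a step
    from the fixed point [lam1]. [F] is Lipschitz, and the gradient of the distance generating
    function is continuous on [X]. *)
Lemma vmeasurable_step d (U : measurableType d) (u q : U -> 'cV[R]_d1) :
  vmeasurable u -> vmeasurable q -> (forall x, X (u x)) ->
  vmeasurable (fun x => step (u x) (q x)).
Proof.
move=> mu_ mq Xu i; have a0 := rs_alpha HS; have r0 := rs_rho HS; have X1 := rs_init HS.
pose F p := step lam1 (p + alpha^-1 *: dphi lam1).
have FE v z : X v -> step v z = F (z - alpha^-1 *: dphi v).
  move=> Xv; apply/eqP; rewrite -subr_eq0; apply/eqP/l2norm_eq0/eqP; rewrite -sqrf_eq0.
  have := step_monotone z (z - alpha^-1 *: dphi v + alpha^-1 *: dphi lam1) Xv X1.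
  rewrite addrK subrr dotv0l pmulr_rle0 ?divr_gt0// -/(F _) => h.
  by rewrite eq_le h sqr_ge0.
have mdphi : vmeasurable (fun x => dphi (u x)).
  move=> j; apply: (@measurable_caratheodory R _ U _ X (fun a _ => dphi a j 0)) => //.
  by move=> x a Xa; exact: dgf_grad_continuous.
have mp : vmeasurable (fun x => q x - alpha^-1 *: dphi (u x)).
  by apply: vmeasurableB => //; exact: vmeasurableZ.
rewrite (_ : (fun x => _) = fun x => F (q x - alpha^-1 *: dphi (u x)) i 0); last first.
  by apply/funext => x; rewrite FE.
apply: (@measurable_caratheodory R _ U _ setT (fun a _ => F a i 0)) => //.
move=> x a _.
apply: (@mcontinuous_relative_vlipschitz _ _ setT a _ F (alpha / rho) _ i 0) => b _.
rewrite /F; apply: step_perturbation => //; first exact: l2norm_ge0.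
by move=> z z' _ _; rewrite opprD addrACA subrr addr0 dotv_abs_le.
Qed.

End Round.

(** What needs proof is that [h] is bounded below on [X], so that [inf] is a genuine infimum: the
    variational inequality of one step gives an affine minorant, and [X] is bounded. *)
Lemma reg_gap l : X l -> reg pb lam1 - reg pb l <= reg pb lam1 - inf [set reg pb l | l in X].
Proof.
move=> Xl; rewrite lerD2l lerN2.
have t1 : (1 <= 1 <= T)%N.
  by case/andP: (rs_w HS) => w1 wT; rewrite (leq_trans w1 wT).
have X1 := rs_init HS.
set s := bregman_step pb 1 alpha lam1 0.
have Xs : X s := step_dom t1 0 X1.
apply: inf_lbound; last by exists l.
exists (reg pb s - l2norm (0 + alpha^-1 *: (dgf_grad pb 1 s - dgf_grad pb 1 lam1)) * S).
move=> _ [y Xy <-]; have := step_variational t1 0 X1 Xy.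
have [_ _ /(_ y s Xy Xs) H] := rs_D HS.
have := dotv_le (0 + alpha^-1 *: (dgf_grad pb 1 s - dgf_grad pb 1 lam1)) (y - s).
rewrite -/s => h1 h2; have := ler_wpM2l (l2norm_ge0 (0 + alpha^-1 *: (dgf_grad pb 1 s - dgf_grad pb 1 lam1))) H.
lra.
Qed.

End BregmanSteps.

(** * Iterates as functions of past draws *)

Section Histories.
Local Notation "S .-known" := (measurable_fun (setT : set (info smp S)))
  (at level 2, format "S .-known").
Local Notation est t := (hypergrad_est pb smp lg1 m t).
Local Notation window := (window_est pb smp lg1 m w lam beta).

Lemma lam_dom t o : (1 <= t <= T.+1)%N -> X (lam t o).
Proof.
elim: t => [//|[|t] IH] /andP[_ tT].
  by have [-> _ _] := rs_run HS o; exact: rs_init HS.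
have [_ _ H] := rs_run HS o.
have tT' : (1 <= t.+1 <= T)%N by rewrite ltnS in tT.
rewrite (H _ tT').2; apply: (step_dom tT'); apply: IH.
exact: ltnW tT.
Qed.

Definition draw_round (d : draw) : nat :=
  match d with DrawEps t | DrawM t | DrawZeta t _ | DrawBatch t _ _ => t end.

Definition history (t : nat) : set draw :=
  [set d | drawn T K w m d /\ (draw_round d < t)%N].

(** A filtration refined to single samples: what is known when [k] batches of round [t] are complete
    and [j] samples of the next one are drawn. The sample that follows is independent of it. *)
Definition batch_history (t k j : nat) : set draw :=
  history t `|` [set d | drawn T K w m d /\ exists k' j', d = DrawBatch t k' j' /\
    ((k' <= k)%N \/ k' = k.+1 /\ (j' < j)%N)].

Lemma history_drawn t : history t `<=` drawn T K w m.
Proof. by move=> d []. Qed.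

Lemma batch_history_drawn t k j : batch_history t k j `<=` drawn T K w m.
Proof. by move=> d [[]|[]]. Qed.

Lemma history_mono s t : (s <= t)%N -> history s `<=` history t.
Proof. by move=> st d [Dd ds]; split => //; exact: leq_trans st. Qed.

Lemma batch_history_history t k j : batch_history t k j `<=` history t.+1.
Proof.
move=> d [|[Dd [k' [j' [dE' _]]]]]; first exact: history_mono.
by split=> //; rewrite dE' /=.
Qed.

Lemma batch_history_mono t k k' j j' : (k < k')%N \/ k = k' /\ (j <= j')%N ->
  batch_history t k j `<=` batch_history t k' j'.
Proof.
move=> kk d [|[Dd [a [c [dE' H]]]]]; [by left|right; split=> //; exists a, c; split => //].
case: H => [ak|[-> cj]]; case: kk => [lt|[<- jj]].
- by left; rewrite (leq_trans ak)// ltnW.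
- by left.
- by left.
- by right; split=> //; exact: leq_trans jj.
Qed.

Lemma round_draws_history t : (1 <= t <= T)%N -> round_draws t `<=` history t.+1.
Proof.
move=> tT d Hd; split; first exact: (@round_draws_drawn t tT).
by case: Hd => [->|->|[j _ ->]].
Qed.

(** Joint measurability is stated with past and fresh draws at separate points; the run evaluates
    both at the same [o]. *)
Lemma known_diagonal dU (U : measurableType dU) S1 S2 S3 (f : Omega -> Omega -> U) :
  S1 `<=` S3 -> S2 `<=` S3 ->
  measurable_fun (setT : set (info smp S1 * info smp S2)%type) (fun z => f z.1 z.2) ->
  S3.-known (fun o => f o o).
Proof.
move=> S13 S23 mf.
have md : measurable_fun (setT : set (info smp S3))
    (fun o => (o, o) : (info smp S1 * info smp S2)%type).
  by apply: measurable_fun_pair; [apply: (known_mono S13)|apply: (known_mono S23)].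
exact: (measurableT_comp mf md).
Qed.

Section Step.
Context (t : nat).
Hypothesis tT : (1 <= t <= T)%N.
Hypothesis klam : forall s, (1 <= s <= t)%N -> vmeasurable (T := info smp (history s)) (lam s).
Hypothesis kbeta : forall s, (1 <= s <= t)%N -> vmeasurable (T := info smp (history s)) (beta s).

Let t_le s : (1 <= s <= t)%N -> (1 <= s <= T)%N.
Proof. by case/andP=> -> st; case/andP: tT => _; exact: leq_trans. Qed.

Let dom_s s o : (1 <= s <= t)%N -> X (lam s o).
Proof. by move=> /t_le /andP[s1 sT]; apply: lam_dom; rewrite s1 leqW. Qed.

Definition inner_iterate s k o :=
  inner_loop pb eta w s (lam s o) (fun k j => batch smp s k j o) (beta s o) k.

Lemma inner_iterateS s k o : inner_iterate s k.+1 o = inner_iterate s k o -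
  eta *: (w%:R^-1 *: \sum_(j < w) obj_gb pb s (batch smp s k.+1 j o) (lam s o) (inner_iterate s k o)).
Proof. by []. Qed.

Lemma known_batch_gradient s k j : (1 <= s <= t)%N -> (k < K)%N -> (j < w)%N ->
  vmeasurable (T := info smp (batch_history s k 0)) (inner_iterate s k) ->
  vmeasurable (T := info smp (batch_history s k j.+1))
    (fun o => obj_gb pb s (batch smp s k.+1 j o) (lam s o) (inner_iterate s k o)).
Proof.
move=> st kK jw IH i.
have kl : vmeasurable (T := info smp (batch_history s k 0)) (lam s).
  by move=> a; apply: known_mono (klam st a) => d Hd; left.
have := joint_known_batch_gradient (t_le st) (fun o => dom_s o st) kl IH
  (S'' := [set DrawBatch s k.+1 j]) i erefl.
move=> H; apply: (known_diagonal (f := fun o o' =>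
  obj_gb pb s (batch smp s k.+1 j o') (lam s o) (inner_iterate s k o) i 0) _ _ H).
  by apply: batch_history_mono; right.
move=> _ ->; right; split; last by exists k.+1, j; split=> //; right.
by split => //; exact: t_le.
Qed.

Lemma known_inner_iterate s k : (1 <= s <= t)%N -> (k <= K)%N ->
  vmeasurable (T := info smp (batch_history s k 0)) (inner_iterate s k).
Proof.
move=> st; elim: k => [|k IH] kK.
  by move=> i; apply: known_mono (kbeta st i) => d Hd; left.
have mono : batch_history s k w `<=` batch_history s k.+1 0.
  by apply: batch_history_mono; left.
rewrite (_ : inner_iterate s k.+1 = fun o => inner_iterate s k o -
  eta *: (w%:R^-1 *: \sum_(j < w) obj_gb pb s (batch smp s k.+1 j o) (lam s o) (inner_iterate s k o))) //.
apply: vmeasurableB.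
  by move=> i; apply: known_mono (IH (ltnW kK) i); apply: batch_history_mono; left.
do 2! apply: vmeasurableZ; apply: vmeasurable_sum => j _ i.
apply: known_mono (known_batch_gradient st kK (ltn_ord j) (IH (ltnW kK)) i).
by apply: batch_history_mono; left.
Qed.

Lemma known_beta_next s : (1 <= s <= t)%N ->
  vmeasurable (T := info smp (batch_history s K 0)) (beta s.+1).
Proof.
move=> st; rewrite (_ : beta s.+1 = inner_iterate s K); first exact: known_inner_iterate.
by apply/funext => o; have [_ _ /(_ s (t_le st))[]] := rs_run HS o.
Qed.

Lemma known_estimate_run s : (1 <= s <= t)%N ->
  vmeasurable (T := info smp (history s.+1)) (fun o => est s (lam s o) (beta s.+1 o) o).
Proof.
move=> st i.
have kl : vmeasurable (T := info smp (batch_history s K 0)) (lam s).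
  by move=> a; apply: known_mono (klam st a) => d Hd; left.
apply: (known_diagonal (f := fun o o' => est s (lam s o) (beta s.+1 o) o' i 0) _ _
  (joint_known_estimate (t_le st) (fun o => dom_s o st) kl (known_beta_next st) i)).
- exact: batch_history_history.
- exact/round_draws_history/t_le.
Qed.

Lemma known_window : vmeasurable (T := info smp (history t.+1)) (window t).
Proof.
apply: vmeasurableZ; apply: vmeasurable_sum => j jt i.
have st : (1 <= t - j <= t)%N by rewrite subn_gt0 jt leq_subr.
apply: known_mono (known_estimate_run st i).
by apply: history_mono; rewrite ltnS leq_subr.
Qed.

Lemma known_lam_next : vmeasurable (T := info smp (history t.+1)) (lam t.+1).
Proof.
rewrite (_ : lam t.+1 = fun o => bregman_step pb t alpha (lam t o) (window t o)).
  have tt : (1 <= t <= t)%N by case/andP: tT => ->; rewrite leqnn.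
  apply: (vmeasurable_step tT) => [i||o]; last exact: dom_s.
    apply: known_mono (klam tt i); exact: history_mono.
  exact: known_window.
by apply/funext => o; have [_ _ /(_ t tT)[]] := rs_run HS o.
Qed.

End Step.

(** The iterates of round [t] use only draws of earlier rounds, so all draws of round [t] are fresh
    for them. Both sequences are treated together because each update reads the other. *)
Lemma known_iterates t : (1 <= t <= T.+1)%N -> forall s, (1 <= s <= t)%N ->
  vmeasurable (T := info smp (history s)) (lam s) /\
  vmeasurable (T := info smp (history s)) (beta s).
Proof.
elim: t => [//|t IH] /andP[_ tT] s /andP[s1]; rewrite leq_eqVlt => /predU1P[->|st]; last first.
  have t1 : (0 < t)%N by rewrite (leq_trans s1).
  by apply: IH; [rewrite t1 leqW|rewrite s1].
case: t => [|t] in IH tT *.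
  have -> : lam 1%N = fun=> lam1 by apply/funext => o; have [-> _ _] := rs_run HS o.
  have -> : beta 1%N = fun=> beta1 by apply/funext => o; have [_ -> _] := rs_run HS o.
  by split; exact: vmeasurable_cst.
have tT' : (1 <= t.+1 <= T)%N := tT.
have IH' := IH (ltnW tT).
have kl r rt := (IH' r rt).1; have kb r rt := (IH' r rt).2.
have tt : (1 <= t.+1 <= t.+1)%N := leqnn _.
split; first exact: (known_lam_next tT' kl kb).
by move=> i; apply: known_mono (known_beta_next tT' kl kb tt i); exact: batch_history_history.
Qed.

End Histories.

(** * Error of the inner loop *)

Section NoiseBounds.

(** Extended-valued, so that the recursions can be stated before any moment is known to be
    finite. *)
Definition msq n (V : Omega -> 'cV[R]_n) : \bar R := (\int[P]_o (l2norm (V o) ^+ 2)%:E)%E.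

Lemma msq_ge0 n (V : Omega -> 'cV[R]_n) : (0 <= msq V)%E.
Proof. by apply: integral_ge0 => o _; rewrite lee_fin sqr_ge0. Qed.

Lemma msq_le n n' (V : Omega -> 'cV[R]_n) (W : Omega -> 'cV[R]_n') c :
  vmeasurable V -> vmeasurable W -> 0 <= c ->
  (forall o, l2norm (V o) <= c * l2norm (W o)) -> (msq V <= (c ^+ 2)%:E * msq W)%E.
Proof.
move=> mV mW c0 VW; rewrite /msq -ge0_integralZl_EFin ?sqr_ge0//; last 2 first.
- by move=> o _; rewrite lee_fin sqr_ge0.
- exact/measurable_EFinP/measurable_l2norm_sqr.
apply: ge0_lower_integral_le => o; first by rewrite lee_fin sqr_ge0.
by rewrite -EFinM lee_fin -exprMn l2norm_sqr_le.
Qed.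

Section Round.
Context (t : nat).
Hypothesis tT : (1 <= t <= T)%N.

Let tT1 : (1 <= t <= T.+1)%N.
Proof. by case/andP: tT => -> /leqW ->. Qed.

Let Xlam o : X (lam t o). Proof. exact: lam_dom _ _ tT1. Qed.

Lemma betahat_round_lipschitz l l' : X l -> X l' ->
  l2norm (betahat pb t l - betahat pb t l') <= lg1 / mu * l2norm (l - l').
Proof.
move=> Xl Xl'; have [_ _ _ [gl [gb [glb [gbb si]]]]] := rs_A HS tT1.
apply: (betahat_lipschitz (rs_lg1 HS) (rs_mu HS) si (fun z Xz => (rs_B HS tT1 Xz).1)) => //.
by move=> z Xz; exact: (betahat_critical tT1 Xz si).
Qed.

Lemma vmeasurable_betahat d (U : measurableType d) (u : U -> 'cV[R]_d1) :
  vmeasurable u -> (forall x, X (u x)) -> vmeasurable (fun x => betahat pb t (u x)).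
Proof.
move=> mu_ Xu i.
apply: (@measurable_caratheodory R _ U _ X (fun a _ => betahat pb t a i 0)) => // x a Xa.
apply: (@mcontinuous_relative_vlipschitz _ _ X a _ (betahat pb t) (lg1 / mu) _ i 0) => b Xb.
exact: betahat_round_lipschitz.
Qed.

Local Notation G l b := (grad_on setT (gmean pb t l) b).
Local Notation B o := (betahat pb t (lam t o)).

Let known_lam : vmeasurable (T := info smp (history t)) (lam t).
Proof. by apply: (known_iterates tT1 _).1; case/andP: tT1 => ->; rewrite leqnn. Qed.

Let known_past s : (1 <= s <= t)%N ->
  vmeasurable (T := info smp (history s)) (lam s) /\
  vmeasurable (T := info smp (history s)) (beta s).
Proof. exact: (known_iterates tT1). Qed.

Let tt : (1 <= t <= t)%N. Proof. by case/andP: tT => ->; rewrite leqnn. Qed.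

Let known_inner k : (k <= K)%N -> vmeasurable (T := info smp (batch_history t k 0)) (inner_iterate t k).
Proof.
exact: (known_inner_iterate tT (fun s st => (known_past st).1) (fun s st => (known_past st).2) tt).
Qed.

Let batch_law k j : (1 <= k <= K)%N -> (j < w)%N -> has_law P (batch smp t k j) (lawZ pb).
Proof.
by move=> kK jw; case: (rs_indep HS) => _ _ _ H _; apply: H; split.
Qed.

Let measurable_gb l b i : X l -> measurable_fun setT (fun z => obj_gb pb t z l b i 0).
Proof. by move=> Xl; case: (rs_random HS b tT1 Xl) => _ []. Qed.

Let batch_mean k j l b : (1 <= k <= K)%N -> (j < w)%N -> X l ->
  vmean P (fun o => obj_gb pb t (batch smp t k j o) l b) = G l b.
Proof.
move=> kK jw Xl; have [<- _ _] := rs_C HS b tT Xl.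
apply/matrixP => i a; rewrite ord1 !mxE.
exact: (law_Rintegral (batch_law kK jw) (measurable_gb b i Xl)).
Qed.

Let batch_variance k j l b : (1 <= k <= K)%N -> (j < w)%N -> X l ->
  (\int[P]_o (l2norm (obj_gb pb t (batch smp t k j o) l b - G l b) ^+ 2)%:E <= (sg ^+ 2)%:E)%E.
Proof.
move=> kK jw Xl; have [_ + _] := rs_C HS b tT Xl; apply: le_trans.
rewrite (law_integral (batch_law kK jw)
  (h := fun z => (l2norm (obj_gb pb t z l b - G l b) ^+ 2)%:E))//.
apply/measurable_EFinP; apply: measurable_l2norm_sqr; apply: vmeasurableB.
  by move=> i; exact: measurable_gb.
exact: vmeasurable_cst.
Qed.

(** Interpolates between the exact gradient step ([j = 0]) and the batch step ([j = w]), both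
    relative to the minimiser, adding one centred sample at a time. *)
Let partial k j o : 'cV[R]_d2 :=
  inner_iterate t k o - eta *: G (lam t o) (inner_iterate t k o) - B o +
  - (eta / w%:R) *: \sum_(i < j) (obj_gb pb t (batch smp t k.+1 i o) (lam t o) (inner_iterate t k o)
     - G (lam t o) (inner_iterate t k o)).

Let known_G k j : (k < K)%N -> (j < w)%N ->
  vmeasurable (T := info smp (batch_history t k 0))
    (fun o => G (lam t o) (inner_iterate t k o)).
Proof.
move=> kK jw.
rewrite (_ : (fun o => _) = fun o => vmean P (fun o' =>
  obj_gb pb t (batch smp t k.+1 j o') (lam t o) (inner_iterate t k o))); last first.
  by apply/funext => o; rewrite batch_mean.
have D2 : [set DrawBatch t k.+1 j] `<=` drawn T K w m by move=> _ ->; split.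
have kl : vmeasurable (T := info smp (batch_history t k 0)) (lam t).
  by move=> a; apply: known_mono (known_lam a) => d Hd; left.
apply: (known_mean (rs_indep HS) D2 (S := batch_history t k 0)) => i.
exact: (joint_known_batch_gradient tT Xlam kl (known_inner (ltnW kK))).
Qed.

Let known_partial k j : (k < K)%N -> (j <= w)%N ->
  vmeasurable (T := info smp (batch_history t k j)) (partial k j).
Proof.
move=> kK jw.
have w0 : (0 < w)%N by case/andP: (rs_w HS).
have mono i : (i <= j)%N -> batch_history t k i `<=` batch_history t k j.
  by move=> ij; apply: batch_history_mono; right.
have kG : vmeasurable (T := info smp (batch_history t k j))
    (fun o => G (lam t o) (inner_iterate t k o)).
  by move=> a; apply: known_mono (known_G kK w0 a); exact: mono.
have kl : vmeasurable (T := info smp (batch_history t k j)) (lam t).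
  by move=> a; apply: known_mono (known_lam a) => d Hd; left.
have ki : vmeasurable (T := info smp (batch_history t k j)) (inner_iterate t k).
  by move=> a; apply: known_mono (known_inner (ltnW kK) a); exact: mono.
apply: vmeasurableD; first apply: vmeasurableB.
- by apply: vmeasurableB => //; exact: vmeasurableZ.
- exact: vmeasurable_betahat.
- apply: vmeasurableZ; apply: vmeasurable_sum => i _; apply: vmeasurableB => // a.
  have iw : (i < w)%N by exact: leq_trans (ltn_ord i) jw.
  have := known_batch_gradient tT (fun s st => (known_past st).1)
    tt kK iw (known_inner (ltnW kK)) a.
  by apply: known_mono; apply: mono.
Qed.

Let noise_step k j : (k < K)%N -> (j < w)%N ->
  (msq (partial k j.+1) <= msq (partial k j) + ((eta / w%:R) ^+ 2 * sg ^+ 2)%:E)%E.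
Proof.
move=> kK jw.
have D2 : [set DrawBatch t k.+1 j] `<=` drawn T K w m by move=> _ ->; split.
have disj : batch_history t k j `&` [set DrawBatch t k.+1 j] = set0.
  apply/seteqP; split=> // d [Hd dd]; rewrite dd in Hd; case: Hd => [[_ H]|[_ [k' [j' [dE' H]]]]].
    by move: H; rewrite /draw_round ltnn.
  by case: dE' H => <- <- [|[_]]; rewrite ltnn.
have kl : vmeasurable (T := info smp (batch_history t k j)) (lam t).
  by move=> a; apply: known_mono (known_lam a) => d Hd; left.
have ki : vmeasurable (T := info smp (batch_history t k j)) (inner_iterate t k).
  move=> a; apply: known_mono (known_inner (ltnW kK) a).
  by apply: batch_history_mono; right.
have := @fresh_noise _ _ _ _ _ _ _ _ _ P pb smp T K w m (rs_indep HS)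
  (batch_history t k j) [set DrawBatch t k.+1 j] (@batch_history_drawn t k j) D2 disj
  d2 (partial k j) (fun o o' => obj_gb pb t (batch smp t k.+1 j o') (lam t o) (inner_iterate t k o))
  (- (eta / w%:R)) (sg ^+ 2) (sqr_ge0 _) (known_partial kK (ltnW jw))
  (fun i => joint_known_batch_gradient tT Xlam kl ki i erefl).
rewrite sqrrN => H; apply: le_trans (H _); last first.
  by move=> o; rewrite batch_mean//; exact: batch_variance.
rewrite le_eqVlt; apply/orP; left; apply/eqP; apply: eq_integral => o _.
by rewrite batch_mean// /partial big_ord_recr/= scalerDr addrA.
Qed.

Let noise_sum k j : (k < K)%N -> (j <= w)%N ->
  (msq (partial k j) <= msq (partial k 0) + (j%:R * ((eta / w%:R) ^+ 2 * sg ^+ 2))%:E)%E.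
Proof.
move=> kK; elim: j => [|j IH] jw; first by rewrite mul0r adde0.
apply: le_trans (noise_step kK jw) _; apply: le_trans (leeD2r _ (IH (ltnW jw))) _.
by rewrite -addeA -EFinD -natr1 mulrDl mul1r.
Qed.

Local Notation r := ((1 - eta * mu) ^+ 2).

Let D k o := inner_iterate t k o - B o.

Let measurable_D k : (k <= K)%N -> vmeasurable (D k).
Proof.
move=> kK; apply: vmeasurableB.
  by move=> i; exact: (known_measurable (rs_indep HS) (@batch_history_drawn t k 0) (known_inner kK i)).
apply: vmeasurable_betahat => // i.
exact: (known_measurable (rs_indep HS) (@history_drawn t) (known_lam i)).
Qed.

Lemma step_mu_le1 : eta * mu <= 1.
Proof.
have := rs_step_size HS; have := rs_mu HS; have := rs_mu_le HS; have := rs_lg1 HS.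
have := rs_eta HS => e0 L0 mL m0; rewrite ler_pdivlMr ?addr_gt0//; nra.
Qed.

Let inner_step k : (k < K)%N ->
  (msq (D k.+1) <= r%:E * msq (D k) + (eta ^+ 2 * sg ^+ 2 / w%:R)%:E)%E.
Proof.
move=> kK; have w0 : (0 < w)%N by case/andP: (rs_w HS).
have wn0 : (w%:R : R) != 0 by rewrite pnatr_eq0 -lt0n.
have -> : D k.+1 = partial k w.
  apply/funext => o; rewrite /D /partial inner_iterateS sumrB sumr_const card_ord.
  set Sg := \sum_(i < w) _; set g := grad_on _ _ _; rewrite -[g *+ w]scaler_nat.
  by apply/matrixP => i a; rewrite !mxE; field.
apply: le_trans (noise_sum kK (leqnn w)) _.
have -> : w%:R * ((eta / w%:R) ^+ 2 * sg ^+ 2) = eta ^+ 2 * sg ^+ 2 / w%:R by field.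
apply: leeD2r.
have [_ _ _ [gl [gb [glb [gbb si]]]]] := rs_A HS tT1.
apply: msq_le => [||| o].
- by move=> i; exact: (known_measurable (rs_indep HS) (@batch_history_drawn t k 0) (known_partial kK (leq0n w) i)).
- exact: measurable_D (ltnW kK).
- by rewrite subr_ge0 step_mu_le1.
rewrite /partial big_ord0 scaler0 addr0 (grad_on_gmean _ (Xlam o) si).
have := inner_contraction si (rs_mu HS) (rs_mu_le HS) (inner_iterate t k o) (B o)
  (rs_B HS tT1 (Xlam o)).1 (Xlam o) (rs_eta HS) (rs_step_size HS).
by rewrite (betahat_critical tT1 (Xlam o) si) subr0 addrAC.
Qed.

Lemma inner_loop_error :
  (msq (fun o => beta t.+1 o - B o)%R <=
    r%:E * msq (fun o => beta t o - B o)%R + (K%:R * (eta ^+ 2 * sg ^+ 2 / w%:R))%:E)%E.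
Proof.
have -> : (fun o => beta t.+1 o - B o) = D K.
  by apply/funext => o; rewrite /D; have [_ _ /(_ t tT)[-> _]] := rs_run HS o.
have v0 : 0 <= eta ^+ 2 * sg ^+ 2 / w%:R by rewrite divr_ge0 ?ler0n// mulr_ge0 ?sqr_ge0.
have r1 : r <= 1.
  have em0 : 0 <= eta * mu by rewrite mulr_ge0 ?ltW ?(rs_eta HS) ?(rs_mu HS).
  by have := step_mu_le1; rewrite expr2; nra.
(* Of the [K] contractions only the first is kept and the later ones are bounded by [1]; the noise
   is counted [K] times. *)
suff H k : (0 < k)%N -> (k <= K)%N -> (msq (D k) <= r%:E * msq (D 0) +
    (k%:R * (eta ^+ 2 * sg ^+ 2 / w%:R))%:E)%E by exact: H (rs_K HS) (leqnn K).
elim: k => [//|k IH] _ kK.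
have [->|k0] := posnP k; first by rewrite mul1r; exact: inner_step (rs_K HS).
apply: le_trans (inner_step kK) _; rewrite -natr1 mulrDl mul1r EFinD addeA.
apply: leeD2r; apply: le_trans (IH k0 (ltnW kK)).
by rewrite -[leRHS]mul1e lee_wpmul2r ?msq_ge0// lee_fin.
Qed.

End Round.
End NoiseBounds.

(** * Noise of the window average *)

Section WindowNoise.
Local Notation est t := (hypergrad_est pb smp lg1 m t).
Local Notation q := (1 - mu / lg1).

(** The factor [m] cancels the probability [1 / m] of each index, and the geometric sum is at most
    [1 / (1 - q) = lg1 / mu]. *)
Lemma mean_neumann_weight t : (1 <= t <= T)%N ->
  (\int[P]_o (m%:R * q ^+ mtil smp t o)%:E <= (lg1 / mu)%:E)%E.
Proof.
move=> tT; have [mm mlt _] := mtil_law tT.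
have mu0 := rs_mu HS; have L0 := rs_lg1 HS.
have q0 : 0 <= q by rewrite subr_ge0 ler_pdivrMr ?mul1r ?(rs_mu_le HS).
have m0 : (m%:R : R) != 0 by rewrite pnatr_eq0 -lt0n (rs_m HS).
pose ind k o : R := (mtil smp t o == k)%:R.
have mind k : measurable_fun setT (ind k).
  have mf : measurable_fun [set: nat] (fun n : nat => (n == k)%:R : R) by [].
  exact: (measurableT_comp mf).
have iind k : P.-integrable setT (EFin \o ind k).
  by apply: (@integrable_bounded _ _ _ P _ 1) => // o; rewrite /ind; case: eqP; rewrite ?normr1 ?normr0.
have -> : (fun o => (m%:R * q ^+ mtil smp t o)%:E) =
    EFin \o (fun o => \sum_(k <- index_iota 0 m) (m%:R * q ^+ k) * ind k o).
  apply/funext => o /=; congr (_%:E); rewrite (bigD1_seq (mtil smp t o)) ?mem_index_iota ?mlt ?iota_uniq//=.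
  rewrite big1 ?addr0 /ind ?eqxx ?mulr1// => k.
  by rewrite eq_sym => /negbTE ->; rewrite mulr0.
have iF k : P.-integrable setT (EFin \o (fun o => (m%:R * q ^+ k) * ind k o)).
  exact: integrable_scale.
rewrite integral_EFin ?integrable_big_sum// Rintegral_big_sum// lee_fin.
rewrite (_ : \sum_(k <- _) _ = \sum_(k < m) q ^+ k); last first.
  rewrite -[RHS](big_mkord xpredT (fun k => q ^+ k)); apply: eq_big_nat => k km.
  by rewrite RintegralZl// (mean_mtil_indicator tT km) mulrAC mulfV// mul1r.
have gq : (\sum_(k < m) q ^+ k) * (mu / lg1) <= 1.
  have := subrX1 q m; have := exprn_ge0 m q0.
  move: (\sum_(k < m) _) (q ^+ m) => Sg qm qm0 Hqm; nra.
by rewrite -[lg1 / mu]invf_div -[leRHS]div1r ler_pdivlMr ?divr_gt0.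
Qed.

Let known_past t : (1 <= t <= T)%N -> forall s, (1 <= s <= t)%N ->
  vmeasurable (T := info smp (history s)) (lam s) /\
  vmeasurable (T := info smp (history s)) (beta s).
Proof.
move=> tT; apply: known_iterates.
by case/andP: tT => -> /leqW ->.
Qed.

(** The subtracted mean integrates the draws with the iterates frozen at [o], so it plays the role
    of a conditional expectation. *)
Definition estimate_noise s o : 'cV[R]_d1 :=
  est s (lam s o) (beta s.+1 o) o - vmean P (est s (lam s o) (beta s.+1 o)).

Section Round.
Context (s : nat).
Hypothesis sT : (1 <= s <= T)%N.

Let ss : (1 <= s <= s)%N. Proof. by case/andP: sT => ->; rewrite leqnn. Qed.

Let past_drawn : batch_history s K 0 `<=` drawn T K w m.
Proof. exact: batch_history_drawn. Qed.

Let draws_disjoint : batch_history s K 0 `&` round_draws s = set0.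
Proof.
apply/seteqP; split=> // d [Hd dd].
case: Hd => [[_ H]|[_ [k [j [dB _]]]]].
  by case: dd H => [->|->|[j _ ->]]; rewrite /draw_round ltnn.
by case: dd dB => [->|->|[i _ ->]].
Qed.

Let lam_known : vmeasurable (T := info smp (batch_history s K 0)) (lam s).
Proof. by move=> i; apply: known_mono ((known_past sT ss).1 i) => d Hd; left. Qed.

Let beta_known : vmeasurable (T := info smp (batch_history s K 0)) (beta s.+1).
Proof.
exact: (known_beta_next sT (fun r rs => (known_past sT rs).1) (fun r rs => (known_past sT rs).2) ss).
Qed.

Let lamX o : dom pb (lam s o).
Proof. by apply: lam_dom; case/andP: sT => -> /leqW ->. Qed.

Let joint i := joint_known_estimate sT lamX lam_known beta_known i.

Lemma known_estimate_noise : vmeasurable (T := info smp (history s.+1)) (estimate_noise s).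
Proof.
apply: vmeasurableB.
  exact: (known_estimate_run sT (fun r rs => (known_past sT rs).1) (fun r rs => (known_past sT rs).2) ss).
move=> i; apply: known_mono (known_mean (rs_indep HS) (@round_draws_drawn s sT) joint i).
exact: batch_history_history.
Qed.

Lemma fresh_estimate_noise (a : Omega -> 'cV[R]_d1) c :
  vmeasurable (T := info smp (history s)) a ->
  (msq (fun o => a o + c *: estimate_noise s o)%R <= msq a + (c ^+ 2 * sf ^+ 2)%:E)%E.
Proof.
move=> ka; apply: (fresh_noise (rs_indep HS) past_drawn (@round_draws_drawn s sT) draws_disjoint
  c (sqr_ge0 sf) _ joint).
  by move=> i; apply: known_mono (ka i) => d Hd; left.
by move=> o; have [_ _] := rs_C HS (beta s.+1 o) sT (lamX o).
Qed.

End Round.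

(** Rounds are added from the oldest on, so that each noise is fresh for the partial sum. There are
    [minn w t <= w] of them, each of weight [1 / w^2]. *)
Lemma window_noise t : (1 <= t <= T)%N ->
  (msq (fun o => w%:R^-1 *: \sum_(i < w | (i < t)%N) estimate_noise (t - i) o)%R <=
    (sf ^+ 2 / w%:R)%:E)%E.
Proof.
move=> tT; have w0 : (0 < w)%N by case/andP: (rs_w HS).
have wR : (0 : R) < w%:R by rewrite ltr0n.
pose n := minn w t; pose f j o := w%:R^-1 *: \sum_(i < j) estimate_noise ((t - n).+1 + i) o.
have rT j : (j < n)%N -> (1 <= (t - n).+1 + j <= T)%N.
  by case/andP: tT => _ tT jn; rewrite addSn/= (leq_trans _ tT)// -[ltnRHS](@subnK n t) ?ltn_add2l// geq_minr.
have known_f j : (j <= n)%N -> vmeasurable (T := info smp (history ((t - n).+1 + j))) (f j).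
  move=> jn; apply: vmeasurableZ; apply: vmeasurable_sum => i _ a.
  apply: known_mono (known_estimate_noise (rT i (leq_trans (ltn_ord i) jn)) a).
  by apply: history_mono; rewrite -addnS leq_add2l.
have H j : (j <= n)%N -> (msq (f j) <= (j%:R * (w%:R^-1 ^+ 2 * sf ^+ 2))%:E)%E.
  elim: j => [|j IH] jn.
    rewrite mul0r; rewrite (_ : msq (f 0) = 0)//; apply: integral0_eq => o _.
    by rewrite /f big_ord0 scaler0 l2norm0 expr0n.
  rewrite (_ : f j.+1 = fun o => f j o + w%:R^-1 *: estimate_noise ((t - n).+1 + j) o); last first.
    by apply/funext => o; rewrite /f big_ord_recr/= scalerDr.
  apply: le_trans (fresh_estimate_noise (rT j jn) _ (known_f j (ltnW jn))) _.
  by rewrite -natr1 mulrDl mul1r EFinD leeD2r// IH// ltnW.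
rewrite (_ : (fun o => _) = f n); last first.
  by apply/funext => o; rewrite /f -(window_sum (fun s => estimate_noise s o)).
apply: le_trans (H n (leqnn n)) _; rewrite lee_fin.
apply: (@le_trans _ _ (w%:R * (w%:R^-1 ^+ 2 * sf ^+ 2))).
  by apply: ler_wpM2r; [rewrite mulr_ge0 ?sqr_ge0|rewrite ler_nat geq_minl].
suff -> : w%:R * (w%:R^-1 ^+ 2 * sf ^+ 2) = sf ^+ 2 / w%:R by [].
by field; rewrite gt_eqF.
Qed.

End WindowNoise.

(** * Regret *)

Section TotalBounds.
Local Notation est t := (hypergrad_est pb smp lg1 m t).
Local Notation q := (1 - mu / lg1).
Local Notation gap_h := (reg pb lam1 - inf [set reg pb l | l in X]).

Let w_gt0 : (0 : R) < w%:R.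
Proof. by rewrite ltr0n; case/andP: (rs_w HS). Qed.

Let S_ge0 : 0 <= S.
Proof.
have [_ _ /(_ _ _ (rs_init HS) (rs_init HS))] := rs_D HS.
by rewrite subrr l2norm0.
Qed.

Let run_dom t o : (1 <= t <= T.+1)%N -> X (lam t o).
Proof. exact: lam_dom _ _. Qed.

Let gap_h_ge0 : 0 <= gap_h.
Proof. by have := reg_gap (rs_init HS); rewrite subrr. Qed.

Let measurable_run t : (1 <= t <= T.+1)%N -> vmeasurable (lam t) /\ vmeasurable (beta t).
Proof.
move=> tT; have tt : (1 <= t <= t)%N by case/andP: tT => ->; rewrite leqnn.
have [kl kb] := known_iterates tT tt.
split=> i; exact: (known_measurable (rs_indep HS) (@history_drawn t) (_ : measurable_fun _ _)).
Qed.

Let movement t o := l2norm (lam t.+1 o - lam t o) ^+ 2.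

Let measurable_movement t : (1 <= t <= T)%N -> measurable_fun setT (movement t).
Proof.
case/andP=> t1 tT; apply: measurable_l2norm_sqr; apply: vmeasurableB.
  by apply: (measurable_run _).1; exact: tT.
by apply: (measurable_run _).1; rewrite t1 ltnW.
Qed.

Let neumann_weight t o : R := m%:R * q ^+ mtil smp t o.

Let neumann_weight_bound t : (1 <= t <= T)%N -> mean_bound P (neumann_weight t) (lg1 / mu).
Proof.
move=> tT; split; last exact: (mean_neumann_weight tT).
  have [mm _ _] := mtil_law tT; apply: measurable_funM => //.
  have mf : measurable_fun [set: nat] (fun n : nat => q ^+ n : R) by [].
  exact: (measurableT_comp mf).
move=> o; rewrite mulr_ge0 ?exprn_ge0// subr_ge0 ler_pdivrMr ?mul1r ?(rs_mu_le HS)//.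
exact: rs_lg1 HS.
Qed.

(* Exchanging the order of summation pairs the estimate of round s with the telescoped
   displacement from round s to round s + w, whose length is at most S. *)
Let movement_pathwise o :
  rho / (2 * alpha) * \sum_(1 <= t < T.+1) movement t o <=
  lf0 * S / w%:R * \sum_(1 <= t < T.+1) (1 + neumann_weight t o) + gap_h.
Proof.
pose e s := est s (lam s o) (beta s.+1 o) o.
pose win t := window_est pb smp lg1 m w lam beta t o.
have T1 : (1 <= T.+1)%N by [].
have step t : (1 <= t < T.+1)%N -> rho / (2 * alpha) * movement t o <=
    dotv (win t) (lam t o - lam t.+1 o) + (reg pb (lam t o) - reg pb (lam t.+1 o)).
  case/andP=> t1 tT; have tT' : (1 <= t <= T)%N by rewrite t1.
  have [_ _ /(_ t tT')[_ lE]] := rs_run HS o.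
  have Xt : X (lam t o) by apply: run_dom; rewrite t1 ltnW.
  by have := step_descent tT' (win t) Xt; rewrite -lE.
rewrite mulr_sumr; apply: le_trans (ler_sum_nat step) _; rewrite big_split/=.
apply: lerD; last first.
  have -> : \sum_(1 <= t < T.+1) (reg pb (lam t o) - reg pb (lam t.+1 o)) =
      reg pb (lam 1 o) - reg pb (lam T.+1 o).
    rewrite -[RHS]opprB -(telescope_sumr (fun t => reg pb (lam t o)) T1) -sumrN.
    by apply: eq_bigr => t _; rewrite opprB.
  have [-> _ _] := rs_run HS o; apply: reg_gap.
  by apply: run_dom; rewrite leqnn.
have -> : \sum_(1 <= t < T.+1) dotv (win t) (lam t o - lam t.+1 o) =
    w%:R^-1 * \sum_(1 <= s < T.+1) dotv (e s) (lam s o - lam (minn (s + w) T.+1) o).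
  transitivity (w%:R^-1 * \sum_(1 <= t < T.+1) \sum_(i < w | (i < t)%N)
      dotv (e (t - i)%N) (lam t o - lam t.+1 o)).
    rewrite mulr_sumr; apply: eq_bigr => t _.
    by rewrite /win /window_est dotvZl dotv_suml.
  rewrite (swap_window_sum (fun s t => dotv (e s) (lam t o - lam t.+1 o))); congr (_ * _).
  apply: eq_big_nat => s /andP[_ sT].
  by rewrite -(window_telescope (fun t => lam t o)) 1?ltnW// dotv_sumr.
rewrite [lf0 * S / _]mulrC -mulrA ler_wpM2l ?invr_ge0 ?(ltW w_gt0)// mulr_sumr.
apply: ler_sum_nat => s /andP[s1 sT].
have sT' : (1 <= s <= T)%N by rewrite s1.
have Xs : X (lam s o) by apply: run_dom; rewrite s1 ltnW.
have Xr : X (lam (minn (s + w) T.+1) o).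
  by apply: run_dom; rewrite geq_minr andbT leq_min/= addn_gt0 s1.
apply: le_trans (ler_norm _) _.
have := hypergrad_pairing_bound (beta s.+1 o) sT' Xs Xs Xr (eps smp s o)
  (fun j => zeta smp s j o) (mtil smp s o).
move=> H; apply: le_trans H _; rewrite [leRHS]mulrAC ler_wpM2l//.
  by rewrite mulr_ge0 ?(rs_lf0 HS)// addr_ge0// ; have [_ /(_ o)] := neumann_weight_bound sT'.
by have [_ _] := rs_D HS; exact.
Qed.

Local Notation kg := (lg1 / mu).

Definition movement_budget : R :=
  2 * alpha / rho * (lf0 * S / w%:R * (T%:R * (1 + kg)) + gap_h).

Let movement_mean :
  mean_bound P (fun o => \sum_(1 <= t < T.+1) movement t o) movement_budget.
Proof.
have a0 := rs_alpha HS; have r0 := rs_rho HS.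
have c0 : 0 <= lf0 * S / w%:R by rewrite divr_ge0 ?mulr_ge0 ?(rs_lf0 HS) ?(ltW w_gt0).
have b0 : 0 <= 2 * alpha / rho by rewrite divr_ge0 ?mulr_ge0 ?(ltW a0) ?(ltW r0).
have Hsum : mean_bound P (fun o => \sum_(1 <= t < T.+1) (1 + neumann_weight t o))
    (\sum_(1 <= t < T.+1) (1 + kg)).
  apply: mean_bound_sum => t; rewrite mem_index_iota => tT.
  by apply: mean_boundD; [exact: mean_bound_cst|exact: neumann_weight_bound].
have := mean_boundZ b0 (mean_boundD (mean_boundZ c0 Hsum) (mean_bound_cst P gap_h_ge0)).
rewrite sumr_const_nat subn1/= -[_ *+ T]mulr_natl; apply: mean_bound_le => //.
- under eq_fun do rewrite big_nat.
  by apply: measurable_big_sum => t tT; exact: measurable_movement.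
- by move=> o; rewrite big_nat sumr_ge0// => t _; exact: sqr_ge0.
- move=> o; have := movement_pathwise o.
  have -> : rho / (2 * alpha) = (2 * alpha / rho)^-1 by rewrite invf_div.
  by rewrite mulrC ler_pdivrMr ?divr_gt0 ?mulr_gt0// [leRHS]mulrC.
Qed.

(** The exchange of sums bounds only the total movement, whereas the recursion for the inner errors
    consumes it round by round. *)
Let round_movement : exists2 a : nat -> R,
  forall t, (1 <= t <= T)%N -> mean_bound P (movement t) (a t) &
  \sum_(1 <= t < T.+1) a t <= movement_budget.
Proof.
have mmv t : t \in index_iota 1 T.+1 -> measurable_fun setT (movement t).
  by rewrite mem_index_iota; exact: measurable_movement.
have [a Ha sa] := mean_bound_split mmv (fun t o _ => sqr_ge0 _) movement_mean.
by exists a => // t tT; apply: Ha; rewrite mem_index_iota.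
Qed.

Local Notation x := (eta * mu).
Local Notation batch_noise := (K%:R * (eta ^+ 2 * sg ^+ 2 / w%:R)).
Local Notation gap_beta := (l2norm (beta1 - betahat pb 1 lam1)).

Let drift t := sup [set l2norm (betahat pb t.-1 l - betahat pb t l) ^+ 2 | l in X].

(** The supremum is a true bound because both minimiser maps are Lipschitz on a set of diameter at
    most [S]. *)
Let drift_ge t l : (2 <= t <= T)%N -> X l ->
  l2norm (betahat pb t.-1 l - betahat pb t l) ^+ 2 <= drift t.
Proof.
case/andP=> t2 tT Xl; apply: ub_le_sup; last by exists l.
have t1 : (1 <= t.-1 <= T)%N by case: t t2 tT => [|[|t]]//= _ /ltnW.
have t1' : (1 <= t <= T)%N by rewrite tT (ltnW t2).
have X1 := rs_init HS.
exists ((kg * S + (l2norm (betahat pb t.-1 lam1 - betahat pb t lam1) + kg * S)) ^+ 2).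
move=> _ [l' Xl' <-]; apply: l2norm_sqr_le.
have kg0 : 0 <= kg by rewrite divr_ge0 ?ltW ?(rs_lg1 HS) ?(rs_mu HS).
apply: le_trans (l2norm_triangle (betahat pb t.-1 lam1) _ _) _; apply: lerD.
  apply: le_trans (betahat_round_lipschitz t1 Xl' X1) _.
  by rewrite ler_wpM2l//; have [_ _] := rs_D HS; exact.
apply: le_trans (l2norm_triangle (betahat pb t lam1) _ _) _; rewrite lerD2l.
apply: le_trans (betahat_round_lipschitz t1' X1 Xl') _.
by rewrite ler_wpM2l//; have [_ _] := rs_D HS; exact.
Qed.

(** Error after the inner loop of round [t]; [tracking] is the error before it. *)
Let inner_error t o := l2norm (beta t.+1 o - betahat pb t (lam t o)) ^+ 2.
Let tracking t o := l2norm (beta t o - betahat pb t (lam t o)) ^+ 2.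

Let measurable_inner_error t : (1 <= t <= T)%N -> measurable_fun setT (inner_error t).
Proof.
move=> tT; case/andP: (tT) => t1 tT'; apply: measurable_l2norm_sqr; apply: vmeasurableB.
  by apply: (measurable_run _).2; exact: tT'.
apply: (vmeasurable_betahat tT) => [|o]; first by apply: (measurable_run _).1; rewrite t1 ltnW.
by apply: run_dom; rewrite t1 ltnW.
Qed.

Let measurable_tracking t : (1 <= t <= T)%N -> measurable_fun setT (tracking t).
Proof.
move=> tT; case/andP: (tT) => t1 tT'; apply: measurable_l2norm_sqr; apply: vmeasurableB.
  by apply: (measurable_run _).2; rewrite t1 ltnW.
apply: (vmeasurable_betahat tT) => [|o]; first by apply: (measurable_run _).1; rewrite t1 ltnW.
by apply: run_dom; rewrite t1 ltnW.
Qed.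

Let x_gt0 : 0 < x. Proof. by rewrite mulr_gt0 ?(rs_eta HS) ?(rs_mu HS). Qed.

(** The weighted square inequality is used with [x = eta mu]: the loss [1 + x] is absorbed by the
    squared contraction, since [(1 + x) (1 - x)^2 <= 1 - x]. *)
Let tracking_step t o : (1 <= t < T)%N ->
  tracking t.+1 o <= (1 + x) * inner_error t o +
    (1 + x^-1) * (2 * (kg ^+ 2 * movement t o) + 2 * drift t.+1).
Proof.
case/andP=> t1 tT; have t1' : (1 <= t <= T)%N by rewrite t1 ltnW.
have Xt : X (lam t o) by apply: run_dom; rewrite t1 ltnW// ltnW.
have Xt1 : X (lam t.+1 o) by apply: run_dom; rewrite /= ltnW.
set b := betahat pb t (lam t o); set b' := betahat pb t (lam t.+1 o).
set b'' := betahat pb t.+1 (lam t.+1 o).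
apply: (@le_trans _ _ ((l2norm (beta t.+1 o - b) + l2norm ((b - b') + (b' - b''))) ^+ 2)).
  by apply: l2norm_sqr_le; rewrite addrA subrK; exact: l2norm_triangle.
apply: le_trans (square_sum_le _ _ x_gt0) _; rewrite lerD2l ler_wpM2l//.
  by rewrite addr_ge0 ?invr_ge0 ?(ltW x_gt0).
apply: le_trans (l2norm_sqrD_le _ _) _; apply: lerD; rewrite ler_wpM2l//.
  rewrite -exprMn; apply: l2norm_sqr_le; rewrite [l2norm (lam _ _ - _)]l2norm_distC.
  exact: (betahat_round_lipschitz t1' Xt Xt1).
by apply: (@drift_ge t.+1) => //; rewrite ltnS t1.
Qed.

Definition inner_error_budget : R :=
  x^-1 * (gap_beta ^+ 2 + (T%:R * (2 * batch_noise) +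
    2 * (1 + x^-1) * (kg ^+ 2 * movement_budget + H2 pb T))) + T%:R * batch_noise.

Let batch_noise_ge0 : 0 <= batch_noise.
Proof. by rewrite mulr_ge0// divr_ge0 ?(ltW w_gt0)// mulr_ge0 ?sqr_ge0. Qed.

Let inner_error_of_tracking t p : (1 <= t <= T)%N -> mean_bound P (tracking t) p ->
  mean_bound P (inner_error t) ((1 - x) ^+ 2 * p + batch_noise).
Proof.
move=> tT [_ _ Hp]; split; [exact: measurable_inner_error|by move=> o; exact: sqr_ge0|].
apply: le_trans (inner_loop_error tT) _.
rewrite EFinD; apply: leeD2r; rewrite (EFinM ((1 - x) ^+ 2)).
by apply: lee_wpmul2l => //; rewrite lee_fin sqr_ge0.
Qed.

Let inner_error_rounds : exists2 e : nat -> R,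
  forall t, (1 <= t <= T)%N -> mean_bound P (inner_error t) (e t) &
  \sum_(1 <= t < T.+1) e t <= inner_error_budget.
Proof.
have [a Ha sa] := round_movement.
have x1 : x <= 1 := step_mu_le1.
(* [p n] will bound the mean tracking error of round [n.+1]. The [2] before [batch_noise] majorises
   [1 + x], and the shifts of [drift] and [a] account for rounds starting at [1]. *)
pose u n := 2 * batch_noise + (1 + x^-1) * (2 * (kg ^+ 2 * a n.+1) + 2 * drift n.+2).
pose p := fix p n := if n is n'.+1 then (1 - x) * p n' + u n' else gap_beta ^+ 2.
have h0 t : (2 <= t <= T)%N -> 0 <= drift t.
  by move=> tT; apply: le_trans (drift_ge tT (rs_init HS)); exact: sqr_ge0.
have a0 n : (n < T)%N -> 0 <= a n.+1 by move=> nT; exact: mean_bound_ge0 (Ha n.+1 nT).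
have Hp n : (n < T)%N -> mean_bound P (tracking n.+1) (p n).
  elim: n => [|n IH] nT.
    have -> : tracking 1 = cst (gap_beta ^+ 2).
      by apply/funext => o; rewrite /tracking; have [-> -> _] := rs_run HS o.
    exact/mean_bound_cst/sqr_ge0.
  have nT' : (1 <= n.+1 < T)%N by [].
  have nT1 : (1 <= n.+1 <= T)%N by exact: ltnW nT.
  have He := inner_error_of_tracking nT1 (IH (ltnW nT)).
  have x2 : 0 <= 1 + x by rewrite addr_ge0 ?(ltW x_gt0).
  have x3 : 0 <= 1 + x^-1 by rewrite addr_ge0 ?invr_ge0 ?(ltW x_gt0).
  have dr0 : 0 <= 2 * drift n.+2 by rewrite mulr_ge0// h0.
  have Hm := mean_boundD (mean_boundZ (ler0n _ 2) (mean_boundZ (sqr_ge0 kg) (Ha n.+1 nT1)))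
    (mean_bound_cst P dr0).
  apply: mean_bound_le (mean_boundD (mean_boundZ x2 He) (mean_boundZ x3 Hm)).
  - exact: measurable_tracking.
  - by move=> o; exact: sqr_ge0.
  - by move=> o; exact: tracking_step.
  - rewrite [p n.+1]/= /u addrA; apply: lerD => //.
    have pn0 := mean_bound_ge0 (IH (ltnW nT)).
    move: (x_gt0) (x1) batch_noise_ge0 pn0; move: x batch_noise (p n) => y c pn y0 y1 c0 pn0.
    (* Slack of [(1 + y) (1 - y)^2 <= 1 - y]; [H2] is the slack of [1 + y <= 2] on the noise. *)
    have H1 : 0 <= (1 - y) * pn * (y ^+ 2) by rewrite mulr_ge0 ?sqr_ge0 ?mulr_ge0 ?subr_ge0.
    have H2 : 0 <= (1 - y) * c by rewrite mulr_ge0 ?subr_ge0.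
    rewrite -subr_ge0; have := addr_ge0 H1 H2; congr (_ <= _); ring.
exists (fun t => (1 - x) ^+ 2 * p t.-1 + batch_noise).
  by case=> [//|t] tT; apply: inner_error_of_tracking => //; exact: Hp.
rewrite big_split/= sumr_const_nat subn1/= -[_ *+ T]mulr_natl lerD2r.
have T0 : (0 < T)%N by case/andP: (rs_w HS); exact: leq_trans.
have p0 n : (n < T)%N -> 0 <= p n by move=> nT; exact: mean_bound_ge0 (Hp n nT).
apply: (@le_trans _ _ (\sum_(n < T) p n)).
  rewrite big_add1/= big_mkord; apply: ler_sum => n _.
  rewrite -[leRHS]mul1r ler_wpM2r ?p0//.
  by rewrite exprn_ile1// ?subr_ge0// gerBl ltW.
have -> : \sum_(n < T) p n = \sum_(n < T.-1.+1) p n by rewrite prednK.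
have lastT : (T.-1 < T)%N by rewrite prednK.
apply: le_trans (linear_recursion_sum (u := u) x_gt0 x1 (p0 _ lastT) (fun i _ => erefl)) _.
rewrite ler_wpM2l ?invr_ge0 ?(ltW x_gt0)// lerD2l /u big_split/= sumr_const card_ord -[_ *+ _]mulr_natl -mulr_sumr.
have x3 : 0 <= 1 + x^-1 by rewrite addr_ge0 ?invr_ge0 ?(ltW x_gt0).
apply: lerD.
  by apply: ler_wpM2r; [exact: mulr_ge0|rewrite ler_nat leq_pred].
rewrite [2 * _]mulrC -mulrA ler_wpM2l// big_split/= -!mulr_sumr -mulrDr ler_wpM2l//.
apply: lerD.
  rewrite ler_wpM2l ?sqr_ge0//; apply: le_trans sa.
  rewrite big_add1/= big_mkord -[in leRHS](prednK T0) big_ord_recr/= lerDl.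
  exact: a0.
by rewrite /H2 big_add1 big_add1/= big_mkord.
Qed.

Local Notation Mf := (M_f lf0 lf1 lg1 lg2 mu).

Let noise t o := w%:R^-1 *: \sum_(i < w | (i < t)%N) estimate_noise (t - i) o.

Let bias s o := Mf * l2norm (beta s.+1 o - betahat pb s (lam s o)) + kg * lf0 * w%:R^-1.

Let window_bias t o := w%:R^-1 * \sum_(i < w | (i < t)%N) bias (t - i) o.

Let kg_ge0 : 0 <= kg.
Proof. by rewrite divr_ge0 ?ltW ?(rs_lg1 HS) ?(rs_mu HS). Qed.

Let Mf_ge0 : 0 <= Mf.
Proof.
have c0 : 0 <= lf0 * lg2 / mu by rewrite divr_ge0 ?mulr_ge0 ?(rs_lf0 HS) ?(rs_lg2 HS) ?(ltW (rs_mu HS)).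
have l0 := ltW (rs_lf1 HS).
apply: addr_ge0; first by apply: addr_ge0 => //; exact: mulr_ge0.
by apply: mulr_ge0 => //; exact: addr_ge0.
Qed.

Let bias_ge0 s o : 0 <= bias s o.
Proof.
apply: addr_ge0; first by rewrite mulr_ge0 ?l2norm_ge0.
by rewrite mulr_ge0 ?invr_ge0 ?(ltW w_gt0)// mulr_ge0 ?(rs_lf0 HS).
Qed.

Let window_deviation t o y z : (1 <= t <= T)%N -> X y -> X z ->
  `|dotv (window_est pb smp lg1 m w lam beta t o - gradFw pb w lam t o) (y - z)| <=
  (l2norm (noise t o) + window_bias t o) * l2norm (y - z).
Proof.
case/andP=> t1 tT Xy Xz.
have -> : window_est pb smp lg1 m w lam beta t o - gradFw pb w lam t o =
    noise t o + w%:R^-1 *: \sum_(i < w | (i < t)%N)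
      (vmean P (est (t - i) (lam (t - i)%N o) (beta (t - i).+1 o)) - gradF pb (t - i) (lam (t - i)%N o)).
  rewrite -scalerDr -scalerBr; congr (_ *: _); rewrite -sumrB -big_split/=.
  by apply: eq_bigr => i _; rewrite /estimate_noise addrA subrK.
rewrite dotvDl mulrDl (le_trans (ler_normD _ _))//; apply: lerD; first exact: dotv_abs_le.
rewrite dotvZl dotv_suml normrM ger0_norm ?invr_ge0 ?(ltW w_gt0)// /window_bias -mulrA.
rewrite ler_wpM2l ?invr_ge0 ?(ltW w_gt0)// mulr_suml.
apply: le_trans (ler_norm_sum _ _ _) _; apply: ler_sum => i it.
have tiT : (1 <= t - i <= T)%N by rewrite subn_gt0 it (leq_trans (leq_subr _ _)).
apply: estimate_bias => //; apply: run_dom.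
by case/andP: tiT => -> /leqW ->.
Qed.

(** The step actually taken uses the estimate, the regret uses the smoothed gradient. Their
    difference is a perturbation of size [alpha / rho] times the deviation, and the rest is the
    movement divided by [alpha]. *)
Let grad_map_bound t o : (1 <= t <= T)%N ->
  l2norm (grad_map pb t (lam t o) (gradFw pb w lam t o) alpha) ^+ 2 <=
  2 / alpha ^+ 2 * movement t o +
    2 / rho ^+ 2 * (2 * l2norm (noise t o) ^+ 2 + 2 * window_bias t o ^+ 2).
Proof.
move=> tT; have a0 := rs_alpha HS; have r0 := rs_rho HS.
have Xt : X (lam t o) by apply: run_dom; case/andP: tT => -> /leqW ->.
set g := gradFw _ _ _ _ _; set c := l2norm (noise t o) + window_bias t o.
have wb0 : 0 <= window_bias t o.
  by rewrite mulr_ge0 ?invr_ge0 ?(ltW w_gt0)// sumr_ge0.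
have c0 : 0 <= c by rewrite addr_ge0 ?l2norm_ge0.
have := step_perturbation tT Xt c0 (fun y z Xy Xz => window_deviation o tT Xy Xz).
have [_ _ /(_ t tT)[_ <-]] := rs_run HS o => pert.
have -> : grad_map pb t (lam t o) g alpha =
    - alpha^-1 *: (lam t.+1 o - lam t o) +
      alpha^-1 *: (lam t.+1 o - bregman_step pb t alpha (lam t o) g).
  rewrite /grad_map scaleNr -scalerN -scalerDr opprB; congr (_ *: _).
  by rewrite addrA subrK.
apply: le_trans (l2norm_sqrD_le _ _) _; apply: lerD.
  rewrite l2normZ exprMn normrN real_normK ?num_real// mulrA exprVn.
  by [].
have cle : c ^+ 2 <= 2 * l2norm (noise t o) ^+ 2 + 2 * window_bias t o ^+ 2.
  by have := square_sum_le (l2norm (noise t o)) (window_bias t o) ltr01; rewrite invr1 -[1 + 1]/2%:R.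
rewrite -[2 / _ * _]mulrA ler_wpM2l//.
apply: (@le_trans _ _ ((rho^-1 * c) ^+ 2)).
  apply: l2norm_sqr_le; rewrite l2normZ ger0_norm ?invr_ge0 ?(ltW a0)//.
  by rewrite ler_pdivrMl// mulrA.
by rewrite exprMn exprVn ler_wpM2l// invr_ge0 sqr_ge0.
Qed.

(** After Jensen each round is counted in at most [w] windows, which cancels the weight [1 / w]. *)
Let window_bias_sum o : \sum_(1 <= t < T.+1) window_bias t o ^+ 2 <=
  \sum_(1 <= s < T.+1) (2 * Mf ^+ 2 * inner_error s o + 2 * (kg * lf0 / w%:R) ^+ 2).
Proof.
have w0 : (0 < w)%N by case/andP: (rs_w HS).
apply: (@le_trans _ _ (\sum_(1 <= t < T.+1) w%:R^-1 * \sum_(i < w | (i < t)%N) bias (t - i) o ^+ 2)).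
  by apply: ler_sum => t _; exact: square_mean_le.
rewrite -mulr_sumr (swap_window_sum (fun s _ => bias s o ^+ 2)) ler_pdivrMl// mulr_sumr.
apply: ler_sum => s _; apply: (@le_trans _ _ (\sum_(i < w) bias s o ^+ 2)).
  by rewrite big_mkcond; apply: ler_sum => i _; case: ifP => // _; exact: sqr_ge0.
rewrite sumr_const card_ord -[leLHS]mulr_natl ler_wpM2l//.
have := square_sum_le (Mf * l2norm (beta s.+1 o - betahat pb s (lam s o))) (kg * lf0 * w%:R^-1) ltr01.
by rewrite invr1 -[1 + 1]/2%:R exprMn mulrA.
Qed.

Definition regret_budget : R := 2 / alpha ^+ 2 * movement_budget +
  2 / rho ^+ 2 * (2 * (T%:R * (sf ^+ 2 / w%:R)) +
    2 * (2 * Mf ^+ 2 * inner_error_budget + T%:R * (2 * (kg * lf0 / w%:R) ^+ 2))).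

Lemma regret_bound : (regret pb P T w alpha lam <= regret_budget%:E)%E.
Proof.
have a0 := rs_alpha HS; have r0 := rs_rho HS.
have [e He se] := inner_error_rounds.
have Hn : mean_bound P (fun o => \sum_(1 <= t < T.+1) l2norm (noise t o) ^+ 2)
    (\sum_(1 <= t < T.+1) (sf ^+ 2 / w%:R)).
  apply: mean_bound_sum => t; rewrite mem_index_iota => tT.
  split; [|by move=> o; exact: sqr_ge0|exact: (window_noise tT)].
  apply: measurable_l2norm_sqr; apply: vmeasurableZ; apply: vmeasurable_sum => i it.
  have tiT : (1 <= t - i <= T)%N.
    by case/andP: tT => _ tT; rewrite subn_gt0 it (leq_trans (leq_subr _ _)).
  move=> a; exact: (known_measurable (rs_indep HS) (@history_drawn _) (known_estimate_noise tiT a)).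
have bb0 : 0 <= 2 * (kg * lf0 / w%:R) ^+ 2 by rewrite mulr_ge0 ?sqr_ge0.
have M0 : 0 <= 2 * Mf ^+ 2 by rewrite mulr_ge0 ?sqr_ge0.
have Hb : mean_bound P (fun o => \sum_(1 <= s < T.+1)
      (2 * Mf ^+ 2 * inner_error s o + 2 * (kg * lf0 / w%:R) ^+ 2))
    (\sum_(1 <= s < T.+1) (2 * Mf ^+ 2 * e s + 2 * (kg * lf0 / w%:R) ^+ 2)).
  apply: mean_bound_sum => s; rewrite mem_index_iota => sT.
  by apply: mean_boundD; [apply: mean_boundZ => //; exact: He|exact: mean_bound_cst].
have ca : 0 <= 2 / alpha ^+ 2 by rewrite divr_ge0 ?sqr_ge0.
have cr : 0 <= 2 / rho ^+ 2 by rewrite divr_ge0 ?sqr_ge0.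
have H := mean_boundD (mean_boundZ ca movement_mean)
  (mean_boundZ cr (mean_boundD (mean_boundZ (ler0n _ 2) Hn) (mean_boundZ (ler0n _ 2) Hb))).
have [_ _] := H; rewrite /regret expectation.unlock => H'.
apply: (@le_trans _ _ (\int[P]_o (2 / alpha ^+ 2 * \sum_(1 <= t < T.+1) movement t o +
  2 / rho ^+ 2 * (2 * \sum_(1 <= t < T.+1) l2norm (noise t o) ^+ 2 +
    2 * \sum_(1 <= s < T.+1) (2 * Mf ^+ 2 * inner_error s o + 2 * (kg * lf0 / w%:R) ^+ 2)))%:E)%E).
  (* The integrand of the regret involves chosen gradients and is not shown to be measurable;
     monotonicity of the lower integral is enough. *)
  apply: ge0_lower_integral_le => o; rewrite lee_fin; first by rewrite sumr_ge0// => t _; exact: sqr_ge0.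
  apply: (@le_trans _ _ (\sum_(1 <= t < T.+1) (2 / alpha ^+ 2 * movement t o +
    2 / rho ^+ 2 * (2 * l2norm (noise t o) ^+ 2 + 2 * window_bias t o ^+ 2)))).
    by apply: ler_sum_nat => t tT; exact: grad_map_bound.
  rewrite big_split/= -!mulr_sumr lerD2l ler_wpM2l// big_split/= -!mulr_sumr lerD2l ler_wpM2l//.
apply: le_trans H' _; rewrite lee_fin lerD2l ler_wpM2l//.
rewrite sumr_const_nat subn1/= -[_ *+ T]mulr_natl lerD2l ler_wpM2l//.
by rewrite big_split/= -mulr_sumr sumr_const_nat subn1/= -[_ *+ T]mulr_natl lerD2r ler_wpM2l.
Qed.

Local Notation k0 := (kappa_max lf1 rho alpha).
Local Notation D0 := (movement_rate lf0 lf1 rho S alpha gap_h).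
Local Notation X0 := (memory_max lf1 lg1 rho eta alpha).
Local Notation E0 := (inner_rate lf0 lf1 lg1 rho S eta alpha K gap_h gap_beta).
Local Notation M0 := (M_max lf0 lf1 lg1 lg2 rho alpha).
Local Notation C0 := (rate_constant lf0 lf1 lg1 lg2 rho S eta alpha K gap_h gap_beta).
Hypothesis kappa_le : lg1 / mu <= k0.

Local Notation tau := (T%:R / w%:R : R).
(** The common yardstick: each budget is at most a constant times this quantity. *)
Local Notation U := (tau * (1 + sf ^+ 2 + sg ^+ 2) + H2 pb T).

Lemma H2_ge0 : 0 <= H2 pb T.
Proof.
by apply: sumr_ge0 => t _; apply: sup_nonneg => _ [l _ <-]; exact: sqr_ge0.
Qed.

Let k0_ge0 : 0 <= k0. Proof. exact: le_trans kappa_le. Qed.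

(** This is [w <= T]. It lets the initial gaps, which do not grow with [T], be absorbed into
    [T / w]. *)
Let tau_ge1 : 1 <= tau.
Proof. by rewrite ler_pdivlMr// mul1r ler_nat; case/andP: (rs_w HS). Qed.

Let tau_ge0 : 0 <= tau. Proof. exact: le_trans tau_ge1. Qed.

Let U_ge : [/\ tau <= U, tau * sf ^+ 2 <= U, tau * sg ^+ 2 <= U & tau + H2 pb T <= U].
Proof.
have a := mulr_ge0 tau_ge0 (sqr_ge0 sf); have b := mulr_ge0 tau_ge0 (sqr_ge0 sg).
by have := H2_ge0; have := tau_ge0; split; lra.
Qed.

Let lf0S_ge0 : 0 <= lf0 * S.
Proof. by rewrite mulr_ge0 ?(rs_lf0 HS). Qed.

Let step_ratio_ge0 : 0 <= 2 * alpha / rho.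
Proof. by rewrite divr_ge0 ?mulr_ge0 ?ltW ?(rs_alpha HS) ?(rs_rho HS). Qed.

Let D0_ge0 : 0 <= D0.
Proof. by rewrite mulr_ge0// addr_ge0// mulr_ge0// addr_ge0. Qed.

Let movement_le : movement_budget <= D0 * tau.
Proof.
rewrite /movement_budget /movement_rate -[leRHS]mulrA ler_wpM2l// mulrDl; apply: lerD.
  have -> : lf0 * S / w%:R * (T%:R * (1 + lg1 / mu)) = lf0 * S * (1 + lg1 / mu) * tau by ring.
  by rewrite ler_wpM2r// ler_wpM2l// lerD2l.
by rewrite -[leLHS]mulr1 ler_wpM2l.
Qed.

Let movement_ge0 : 0 <= movement_budget.
Proof.
rewrite mulr_ge0// addr_ge0// mulr_ge0 ?divr_ge0 ?(ltW w_gt0)//.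
by rewrite mulr_ge0// addr_ge0.
Qed.

Let memory_le : (eta * mu)^-1 <= X0.
Proof.
have e0 := rs_eta HS; have m0 := rs_mu HS; have L0 := rs_lg1 HS.
have -> : (eta * mu)^-1 = lg1 / mu / (eta * lg1) by field; rewrite !gt_eqF.
by rewrite ler_wpM2r// invr_ge0 mulr_ge0 ?ltW.
Qed.

Let memory_ge0 : 0 <= (eta * mu)^-1.
Proof. by rewrite invr_ge0 mulr_ge0 ?ltW ?(rs_eta HS) ?(rs_mu HS). Qed.

Let X0_ge0 : 0 <= X0. Proof. exact: le_trans memory_le. Qed.

Let U_ge1 : 1 <= U. Proof. by have [h _ _ _] := U_ge; exact: le_trans h. Qed.

Let U_ge0 : 0 <= U. Proof. exact: le_trans U_ge1. Qed.

Let B0_ge0 : 0 <= K%:R * eta ^+ 2. Proof. by rewrite mulr_ge0 ?sqr_ge0. Qed.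

Let noise_le : T%:R * (K%:R * (eta ^+ 2 * sg ^+ 2 / w%:R)) <= K%:R * eta ^+ 2 * U.
Proof.
have -> : T%:R * (K%:R * (eta ^+ 2 * sg ^+ 2 / w%:R)) = K%:R * eta ^+ 2 * (tau * sg ^+ 2) by ring.
by have [_ _ h _] := U_ge; exact: ler_wpM2l.
Qed.

Let sqr_le (a b : R) : 0 <= a -> a <= b -> a ^+ 2 <= b ^+ 2.
Proof. by move=> a0 ab; rewrite ler_pXn2r// nnegrE (le_trans a0). Qed.

Let drift_le : (lg1 / mu) ^+ 2 * movement_budget + H2 pb T <=
  (k0 ^+ 2 * D0 + 1) * U.
Proof.
have [h _ _ h'] := U_ge; rewrite mulrDl mul1r; apply: lerD; last first.
  by apply: le_trans h'; rewrite lerDr.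
apply: (@le_trans _ _ ((lg1 / mu) ^+ 2 * (D0 * tau))); first by rewrite ler_wpM2l ?sqr_ge0.
rewrite mulrA; apply: ler_pM => //; first by rewrite mulr_ge0 ?sqr_ge0.
by rewrite ler_wpM2r// sqr_le.
Qed.

Let inner_le : inner_error_budget <= E0 * U.
Proof.
rewrite /inner_error_budget /inner_rate [leRHS]mulrDl; apply: lerD => //.
rewrite -[leRHS]mulrA; apply: ler_pM => //.
  rewrite addr_ge0 ?sqr_ge0// addr_ge0//.
    by rewrite mulr_ge0// mulr_ge0// -mulrA mulr_ge0// mulr_ge0 ?sqr_ge0// divr_ge0 ?sqr_ge0.
  apply: mulr_ge0; first by rewrite mulr_ge0 ?addr_ge0.
  by apply: addr_ge0 H2_ge0; exact: mulr_ge0 (sqr_ge0 _) movement_ge0.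
rewrite [leRHS]mulrDl [leLHS]addrA; apply: lerD.
  rewrite [leRHS]mulrDl; apply: lerD; first by rewrite -[leLHS]mulr1 ler_wpM2l ?sqr_ge0.
  by rewrite mulrCA -[leRHS]mulrA ler_wpM2l.
rewrite -[leRHS]mulrA; apply: ler_pM => //.
- by rewrite mulr_ge0 ?addr_ge0.
- by apply: addr_ge0 H2_ge0; exact: mulr_ge0 (sqr_ge0 _) movement_ge0.
- by rewrite ler_wpM2l// lerD2l.
Qed.

Let Mf_le : 0 <= M_f lf0 lf1 lg1 lg2 mu <= M0.
Proof.
have f1 := ltW (rs_lf1 HS).
have c0 : 0 <= lf0 * lg2 / lg1 by rewrite divr_ge0 ?mulr_ge0 ?(rs_lf0 HS) ?(rs_lg2 HS) ?(ltW (rs_lg1 HS)).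
have -> : M_f lf0 lf1 lg1 lg2 mu =
    lf1 + lf1 * (lg1 / mu) + lf0 * lg2 / lg1 * ((lg1 / mu) * (1 + lg1 / mu)).
  by rewrite /M_f /kappa_g; field; rewrite !gt_eqF ?(rs_lg1 HS) ?(rs_mu HS).
have -> : M0 = lf1 + lf1 * k0 + lf0 * lg2 / lg1 * (k0 * (1 + k0)).
  by rewrite /M_max; ring.
have kg1 : 0 <= 1 + lg1 / mu by rewrite addr_ge0.
apply/andP; split.
  apply: addr_ge0; first by apply: addr_ge0 => //; exact: mulr_ge0.
  by apply: mulr_ge0 => //; exact: mulr_ge0.
apply: lerD; first by rewrite lerD2l ler_wpM2l.
by rewrite ler_wpM2l// ler_pM ?addr_ge0// lerD2l.
Qed.

Let E0_ge0 : 0 <= E0.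
Proof.
have x1 : 0 <= 1 + X0 by rewrite addr_ge0.
have k1 : 0 <= k0 ^+ 2 * D0 + 1 by rewrite addr_ge0// mulr_ge0 ?sqr_ge0.
apply: addr_ge0 => //; apply: mulr_ge0 => //; apply: addr_ge0.
  by apply: addr_ge0; [exact: sqr_ge0|exact: mulr_ge0].
by rewrite mulr_ge0 ?mulr_ge0.
Qed.

Lemma rate_constant_ge0 : 0 <= C0.
Proof.
have ca : 0 <= 2 / alpha ^+ 2 by rewrite divr_ge0 ?sqr_ge0.
have cr : 0 <= 2 / rho ^+ 2 by rewrite divr_ge0 ?sqr_ge0.
have m2 : 0 <= 2 * M0 ^+ 2 * E0 by rewrite mulr_ge0// mulr_ge0 ?sqr_ge0.
have k2 : 0 <= 2 * (k0 * lf0) ^+ 2 by rewrite mulr_ge0 ?sqr_ge0.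
apply: addr_ge0; first exact: mulr_ge0.
by apply: mulr_ge0 => //; apply: addr_ge0 => //; apply: mulr_ge0 => //; exact: addr_ge0.
Qed.

Lemma regret_rate : (regret pb P T w alpha lam <= (C0 * U)%:E)%E.
Proof.
have [tU sfU _ _] := U_ge.
have ca : 0 <= 2 / alpha ^+ 2 by rewrite divr_ge0 ?sqr_ge0.
have cr : 0 <= 2 / rho ^+ 2 by rewrite divr_ge0 ?sqr_ge0.
apply: le_trans regret_bound _; rewrite lee_fin /regret_budget /rate_constant [leRHS]mulrDl.
apply: lerD; first by rewrite -[leRHS]mulrA ler_wpM2l// (le_trans movement_le)// ler_wpM2l.
rewrite -[leRHS]mulrA ler_wpM2l// [leRHS]mulrDl; apply: lerD.
  by rewrite ler_wpM2l// [leLHS](_ : _ = tau * sf ^+ 2)//; ring.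
rewrite -[leRHS]mulrA ler_wpM2l// [leRHS]mulrDl; apply: lerD.
  have /andP[m0 mM] := Mf_le.
  apply: (@le_trans _ _ (2 * M_f lf0 lf1 lg1 lg2 mu ^+ 2 * (E0 * U))).
    by rewrite ler_wpM2l// mulr_ge0 ?sqr_ge0.
  by rewrite mulrA ler_wpM2r// ler_wpM2r// ler_wpM2l// sqr_le.
(* A truncation bias of order [1 / w] per round contributes [T / w^2] once squared and summed, which
   is at most [T / w]. *)
have -> : T%:R * (2 * (lg1 / mu * lf0 / w%:R) ^+ 2) = 2 * (lg1 / mu * lf0) ^+ 2 * (tau / w%:R).
  by field; rewrite !gt_eqF ?(rs_mu HS).
apply: ler_pM.
- by rewrite mulr_ge0 ?sqr_ge0.
- by rewrite divr_ge0 ?(ltW w_gt0).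
- apply: ler_wpM2l => //; apply: sqr_le; first by rewrite mulr_ge0 ?(rs_lf0 HS).
  by apply: ler_wpM2r => //; exact: rs_lf0 HS.
- apply: le_trans tU; rewrite ler_pdivrMr// -[leLHS]mulr1 ler_wpM2l//.
  by rewrite ler1n; case/andP: (rs_w HS).
Qed.

End TotalBounds.

End Run.

Theorem theorem5p4 (R : realType) (lf0 lf1 lg1 lg2 rho S Q eta alpha : R) (K : nat)
    (lf0_ge0 : 0 <= lf0) (lf1_gt0 : 0 < lf1) (lg1_gt0 : 0 < lg1)
    (lg2_ge0 : 0 <= lg2) (rho_gt0 : 0 < rho) (eta_gt0 : 0 < eta)
    (alpha_gt0 : 0 < alpha) (K_ge1 : (1 <= K)%N) :
  exists C : R -> R -> R,
  forall (d1 d2 : nat) (dE dZ dO : measure_display)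
    (E : measurableType dE) (Z : measurableType dZ) (Omega : measurableType dO)
    (P : probability Omega R) (pb : problem R d1 d2 E Z)
    (smp : samples Omega E Z) (T w : nat) (mu sf sg : R)
    (lam1 : 'cV[R]_d1) (beta1 : 'cV[R]_d2)
    (lam : nat -> Omega -> 'cV[R]_d1) (beta : nat -> Omega -> 'cV[R]_d2),
  let s := w in
  let m := neumann_size lg1 mu w in
  0 < mu -> 0 <= sf -> 0 <= sg ->
  (1 <= w <= T)%N ->
  random_objectives pb T ->
  convex_regularizer pb ->
  bregman_steps_exist pb T alpha ->
  assumptionA pb T lf0 lf1 lg1 lg2 ->
  assumptionB pb T mu ->
  assumptionC pb P smp T m lg1 sf sg ->
  assumptionD pb S ->
  assumptionE pb T Q ->
  assumptionF pb T rho ->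
  eta <= 2 / (lg1 + mu) ->
  alpha <= alpha_max lf0 lf1 lg1 lg2 mu rho eta K ->
  independent_draws pb P smp T K s m ->
  dom pb lam1 ->
  sobbo pb smp T K s m w lg1 eta alpha lam1 beta1 lam beta ->
  let gap_h := reg pb lam1 - inf [set reg pb l | l in dom pb] in
  let gap_beta := l2norm (beta1 - betahat pb 1 lam1) in
  let kg := kappa_g lg1 mu in
  (regret pb P T w alpha lam <=
    (C gap_h gap_beta *
      (T%:R / w%:R * (1 + kg ^+ 2 + sf ^+ 2 + kg ^+ 2 * sg ^+ 2) +
       V1 pb T + kg ^+ 2 * H2 pb T))%:E)%E.
Proof.
pose C gh gb := rate_constant lf0 lf1 lg1 lg2 rho S eta alpha K gh gb.
exists C => d1 d2 dE dZ dO E Z Omega P pb smp T w mu sf sg lam1 beta1 lam beta s m mu0 sf0 sg0 wT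
  rand conv steps HA HB HC HD HE HF etamu alphamax indep X1 run.
cbv zeta; set kg := kappa_g lg1 mu.
have w0 : (0 < w)%N by case/andP: wT.
have T1 : (1 <= 1 <= T.+1)%N by [].
have m0 : (0 < m)%N by rewrite /m /neumann_size addn1.
have tau0 : 0 <= T%:R / w%:R :> R by rewrite divr_ge0.
have V0 : 0 <= V1 pb T.
  by apply: sumr_ge0 => t _; apply: sup_nonneg => _ [l _ <-].
have h0 : 0 <= H2 pb T.
  by apply: sumr_ge0 => t _; apply: sup_nonneg => _ [l _ <-]; exact: sqr_ge0.
have [muL|Lmu] := leP mu lg1.
  have HS : run_setting P pb smp T K w m lf0 lf1 lg1 lg2 rho S eta alpha mu sf sg
      lam1 beta1 lam beta.
    by split=> //; exact: neumann_size_rate.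
  have kle := kappa_g_le lf0_ge0 lf1_gt0 lg1_gt0 lg2_ge0 rho_gt0 alpha_gt0 mu0 alphamax.
  apply: le_trans (regret_rate HS kle) _; rewrite lee_fin ler_wpM2l//.
    exact: (rate_constant_ge0 HS kle).
  (* With [kappa_g >= 1] the terms of [regret_rate] are dominated by those of the claim, where
     [sg ^+ 2] and [H2] carry the weight [kg ^+ 2]. *)
  have kg1 : 1 <= kg ^+ 2 by rewrite exprn_ege1// /kg /kappa_g ler_pdivlMr ?mul1r.
  apply: lerD; last by rewrite -[leLHS]mul1r ler_wpM2r.
  rewrite -[leLHS]addr0; apply: lerD => //; rewrite ler_wpM2l//.
  apply: lerD; first by rewrite lerD2r lerDl (le_trans ler01).
  by rewrite -[leLHS]mul1r ler_wpM2r ?sqr_ge0.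
have d20 : d2 = 0%N.
  apply/eqP; rewrite -leqn0 leqNgt; apply/negP => d2_gt0.
  have [_ _ _ [gl [gb [glb [gbb si]]]]] := HA 1%N T1.
  have [gg _ lG _ _] := si.
  have := strongly_convex_le_lipschitz d2_gt0 (fun z => partial_gradient gg z X1)
    (fun z z' => partial_gradient_lipschitz_b lG z z' X1) (HB _ _ T1 X1).1.
  by rewrite leNgt Lmu.
have norm0 (u : 'cV[R]_d2) : l2norm u = 0 by exact: l2norm_dim0.
have HS : run_setting P pb smp T K w m lf0 lf1 lg1 lg2 rho S eta alpha lg1 sf 0
    lam1 beta1 lam beta.
  split=> //.
  - rewrite divff ?gt_eqF// subrr expr0n; case: m m0 {HC indep run} => //= *.
    by rewrite invr_ge0.
  - move=> t l tT Xl; have [g1 g2] := HB t l tT Xl.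
    by split=> [x y a Ax Ay a01|z x y a Ax Ay a01]; rewrite norm0 expr0n mulr0;
      [have := g1 x y a Ax Ay a01|have := g2 z x y a Ax Ay a01]; rewrite norm0 expr0n mulr0.
  - move=> t l b tT Xl; have [c1 c2 c3] := HC t l b tT Xl; split=> //.
    by rewrite integral0_eq ?expr0n// => z _; rewrite norm0 expr0n.
  (* Lowering [mu] to [lg1] only enlarges the range of admissible inner steps. *)
  - apply: le_trans etamu _; rewrite ler_pM2l// lef_pV2 ?posrE ?addr_gt0//.
    by rewrite lerD2l ltW.
have kle : lg1 / lg1 <= kappa_max lf1 rho alpha by rewrite divff ?gt_eqF// le_max lexx.
(* Here [kappa_g < 1], so the weight [kg ^+ 2] cannot be compared with [1]; instead [H2] vanishes,
   as every vector of the inner space has norm [0]. *)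
have H20 : H2 pb T = 0.
  apply/eqP; rewrite eq_le h0 andbT; apply: sumr_le0 => t _.
  apply: ge_sup; first by exists (l2norm (betahat pb t.-1 lam1 - betahat pb t lam1) ^+ 2), lam1.
  by move=> _ [l _ <-]; rewrite norm0 expr0n.
apply: le_trans (regret_rate HS kle) _; rewrite lee_fin ler_wpM2l//.
  exact: (rate_constant_ge0 HS kle).
rewrite H20 mulr0 !addr0 expr0n/= addr0 -[leLHS]addr0; apply: lerD => //; rewrite ler_wpM2l//.
have k2 := sqr_ge0 kg; have k3 : 0 <= kg ^+ 2 * sg ^+ 2 by rewrite mulr_ge0 ?sqr_ge0.
lra.
Qed.
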